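(* Assume that $0<\alpha<1/2$. Then there exists smooth periodic initial data $u_0(x)$ such that the solution $u(x,t)$ of $$u_t=u\,u_x-(-\Delta)^\alpha u,\qquad u(x,0)=u_0(x),$$ blows up in $H^s$ in a finite time for each $s\ge\frac32-2\alpha$.
   Context: All functions are real-valued and have mean zero on the circle $\mathbb S^1$ (equivalently, they are periodic on $\mathbb R$ with period $1$). $H^s$ denotes the $L^2$-based Sobolev space on $\mathbb S^1$ restricted to mean-zero functions, with norm $\|f\|_s=\|(-\Delta)^{s/2}f\|_{L^2}$. $(-\Delta)^\alpha$ is the Fourier multiplier with symbol $|2\pi k|^{2\alpha}$, $k\in\mathbb Z$. For smooth $u_0$ there is a local in time solution, $C^\infty$ in $x$; ''the solution'' refers to it and its continuation. Solutions are understood in the weak sense: for every smooth periodic $\varphi(x)$, $(u,\varphi)_t=-\tfrac12(u^2,\varphi_x)-(u,(-\Delta)^\alpha\varphi)$ for a.e. $t$, with $(u,\varphi)(0)=(u_0,\varphi)$, where $(\cdot,\cdot)$ is the $L^2$ pairing. ''Blows up in $H^s$ in a finite time'' means that the maximal time of existence of the solution in the class $C([0,T),H^s)$ is finite, i.e. the solution cannot be continued as an element of $C([0,T],H^s)$ for all finite $T$. *)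

(* Defs.v *)
From mathcomp Require Import all_boot all_order all_algebra.
From mathcomp Require Import all_classical all_reals all_analysis.

Set Implicit Arguments.
Unset Strict Implicit.
Unset Printing Implicit Defensive.
Import Order.TTheory GRing.Theory Num.Theory.
Import numFieldNormedType.Exports.
Local Open Scope classical_set_scope.
Local Open Scope ring_scope.

(* The circle is R/Z: functions on it are functions R -> R of period 1, and
   integrals over it are integrals over [0, 1]. *)

Definition smooth (R : realType) (f : R -> R) : Prop :=
  forall (n : nat) (x : R), derivable (derive1n n f) x 1.

Definition smooth_periodic (R : realType) (f : R -> R) : Prop :=
  smooth f /\ periodic f 1.

Definition pairing (R : realType) (f g : R -> R) : R :=
  \int[lebesgue_measure]_(x in `[0%R, 1%R]) (f x * g x).

Definition mean_zero (R : realType) (f : R -> R) : Prop :=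
  \int[lebesgue_measure]_(x in `[0%R, 1%R]) f x = 0.

(* The Fourier coefficient \int f(x) e^(-2 i pi k x) dx of a real-valued f is
   fcos f k - i fsin f k, and the one of index -k is its conjugate. Sums over
   all k in Z are therefore written below as twice the sums over k >= 1; the
   k = 0 terms vanish, by the mean-zero condition or because |0|^(2 alpha) = 0
   for alpha > 0. *)
Definition fcos (R : realType) (f : R -> R) (k : nat) : R :=
  pairing f (fun x => cos (2 * pi * k%:R * x)).

Definition fsin (R : realType) (f : R -> R) (k : nat) : R :=
  pairing f (fun x => sin (2 * pi * k%:R * x)).

Definition fractional_laplacian (R : realType) (alpha : R) (f : R -> R) :
    R -> R := fun x =>
  limn (fun n => \sum_(1 <= k < n)
    2 * (2 * pi * k%:R) `^ (2 * alpha) *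
      (fcos f k * cos (2 * pi * k%:R * x) +
       fsin f k * sin (2 * pi * k%:R * x))).

(* The L^2 norm of (-Delta)^(s/2) f, computed on the Fourier side. *)
Definition sobolev_norm (R : realType) (s : R) (f : R -> R) : \bar R :=
  ((\sum_(1 <= k <oo)
     (2 * (2 * pi * k%:R) `^ (2 * s) * (fcos f k ^+ 2 + fsin f k ^+ 2))%:E)
   `^ 2^-1)%E.

(* H^s for s >= 0; elements are representatives of classes modulo equality
   almost everywhere. *)
Definition in_sobolev (R : realType) (s : R) (f : R -> R) : Prop :=
  [/\ periodic f 1,
      measurable_fun [set: R] f,
      lebesgue_measure.-integrable `[0%R, 1%R] (fun x => (f x ^+ 2)%:E),
      mean_zero f &
      (sobolev_norm s f < +oo)%E].

(* u \in C([0, T), H^s) *)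
Definition continuous_in_sobolev (R : realType) (s T : R) (u : R -> R -> R) :
    Prop :=
  (forall t : R, 0 <= t < T -> in_sobolev s (u t)) /\
  (forall t0 : R, 0 <= t0 < T ->
    sobolev_norm s (fun x => u t x - u t0 x)
      @[t --> within [set t : R | 0 <= t < T] (nbhs t0)] --> 0%E).

Definition absolutely_continuous (R : realType) (a b : R) (g : R -> R) :
    Prop :=
  forall e : R, 0 < e -> exists2 d : R, 0 < d &
    forall (n : nat) (l r : 'I_n -> R),
      (forall i, a <= l i /\ l i <= r i /\ r i <= b) ->
      trivIset [set: 'I_n] (fun i => `]l i, r i[%classic) ->
      \sum_(i < n) (r i - l i) < d ->
      \sum_(i < n) `|g (r i) - g (l i)| < e.

(* Weak solutions on [0, T) of u_t = u u_x - (-Delta)^alpha u, u(0) = u0.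
   An equation for the time derivative at almost every t determines the
   pairing only together with its (local) absolute continuity in t. *)
Definition weak_solution (R : realType) (alpha T : R) (u0 : R -> R)
    (u : R -> R -> R) : Prop :=
  forall phi : R -> R, smooth_periodic phi ->
    [/\ pairing (u 0) phi = pairing u0 phi,
        forall b : R, 0 < b < T ->
          absolutely_continuous 0 b (fun t => pairing (u t) phi) &
        {ae lebesgue_measure, forall t : R, 0 < t < T ->
          is_derive t 1 (fun t => pairing (u t) phi)
            (- 2^-1 * pairing (fun x => u t x ^+ 2) (phi^`())%classic
             - pairing (u t) (fractional_laplacian alpha phi))}].

(* Solutions on [0, T) of class C^oo in x, for all times and uniformly enough
   to be continuous in time with values in every H^r. *)
Definition smooth_solution (R : realType) (alpha T : R) (u0 : R -> R)
    (u : R -> R -> R) : Prop :=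
  [/\ weak_solution alpha T u0 u,
      forall t : R, 0 <= t < T -> smooth_periodic (u t) &
      forall r : R, 0 <= r -> continuous_in_sobolev r T u].

(* v on [0, T') agrees with u on [0, T) for all common times, as elements of
   L^2. *)
Definition agree (R : realType) (T T' : R) (u v : R -> R -> R) : Prop :=
  forall t : R, 0 <= t < T -> t < T' ->
    {ae lebesgue_measure, forall x, v t x = u t x}.

(* Supremum of the T' such that the solution u on [0, T) is, up to
   restriction or continuation, a solution in C([0, T'), H^s). *)
Definition maximal_time (R : realType) (alpha s T : R) (u0 : R -> R)
    (u : R -> R -> R) : \bar R :=
  ereal_sup [set T'%:E | T' in [set T' : R | 0 < T' /\
    exists v, [/\ weak_solution alpha T' u0 v,
                  continuous_in_sobolev s T' v & agree T T' u v]]].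

Definition blows_up_in_finite_time (R : realType) (alpha s T : R)
    (u0 : R -> R) (u : R -> R -> R) : Prop :=
  (maximal_time alpha s T u0 u < +oo)%E.

(* Main.v *)
Require Import Defs.
From mathcomp Require Import all_boot all_order all_algebra.
From mathcomp Require Import all_classical all_reals all_analysis.
From mathcomp Require Import measurable_realfun.
From mathcomp Require Import ring lra zify.
Set Implicit Arguments.
Unset Strict Implicit.
Unset Printing Implicit Defensive.
Import Order.TTheory GRing.Theory Num.Theory.
Import numFieldNormedType.Exports.
Local Open Scope classical_set_scope.
Local Open Scope ring_scope.

(* Blow-up. Write F_n for the Fejer kernels, theta = 2^(2 alpha - 1) < 1,
   psi = sum_{j <= J} theta^j F_(2^j), and let phi be odd with
   phi' = M F_(2^J) - psi, where M = sum theta^j: a sawtooth whose jump is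
   smoothed at scale 2^-J. Then |phi| <= M and, by a dyadic estimate,
   |(-Delta)^alpha phi| <= K psi pointwise with K independent of J. Test the
   equation against phi(. - y) and let l be the pairing. Writing a = v(t, y),
   Cauchy-Schwarz with weight psi gives
     l' + a (v, phi'(. - y)) >= l^2 / (4 M^2) - C - (M/2) ((v - a)^2, F_(2^J)).
   The second term is removed by moving the centre y with velocity -a, and the
   last one is small for J large, because s > 1/2 makes v(t, .) equicontinuous
   uniformly in t in [0, 2]. Hence l satisfies a Riccati inequality and becomes
   infinite before t = 2 if u0 = A sin(2 pi x) with A large. The argument
   applies to any weak solution in C([0, T'), H^s) with T' > 2, so uniqueness
   is not needed.

   Existence. u = sum_n t^n U_n with U_n a trigonometric polynomial of degree
   n + 1 given by (n + 1) U_(n+1) = (1/2) (sum_i U_i U_(n-i))' - (-Delta)^alpha U_n.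
   Both operators cost at most a factor of the order of the degree n + 2, which
   the factor n + 1 absorbs, so the Wiener norms of the U_n grow geometrically. *)

(** * Integrals over a period *)

(** The centre should follow y' = - v(t, y), but v(t, .) is merely continuous, so this equation need
    not have a unique solution; moreover the weak form gives l' only for a fixed test function and
    almost every t. Time is therefore cut into short steps: the centre is frozen during a step and
    displaced at its end, and Cousin's lemma chooses and glues the steps. Each of them lowers 1 / l
    at a fixed rate, which replaces the comparison with a Riccati equation.

    Origin of theta: at distance |z| from the jump, (-Delta)^alpha phi has size |z|^(-2 alpha), cut
    off at scale 2^-J. The peak of theta^j F_(2^j) has height (2 theta)^j = 2^(2 alpha j) on the
    scale 2^-j, so psi has the same profile. Its integral, the sum of the theta^j, stays bounded in
    J because alpha < 1/2. Hence the threshold that l must exceed does not depend on J: the datum u0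
    is fixed first, and J is chosen afterwards from the modulus of continuity of the given
    solution. *)

Definition I01 (R : realType) (f : R -> R) : R :=
  \int[lebesgue_measure]_(x in `[0%R, 1%R]) f x.

Definition ok01 (R : realType) (f : R -> R) : Prop :=
  lebesgue_measure.-integrable `[0%R, 1%R] (EFin \o f).

Section integral01.
Context {R : realType}.
Implicit Types (f g : R -> R) (c : R).

Let m01 : measurable (`[0%R, 1%R] : set (measurableTypeR R)). Proof. exact: measurable_itv. Qed.

Lemma pairingE f g : pairing f g = I01 (fun x => f x * g x). Proof. by []. Qed.

Lemma ok01_ext f g : (forall x, f x = g x) -> ok01 f -> ok01 g.
Proof. by move=> /funext ->. Qed.

Lemma eq_I01 f g : (forall x, 0 <= x <= 1 -> f x = g x) -> I01 f = I01 g.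
Proof.
move=> fg; apply: eq_Rintegral => x; rewrite inE /= in_itv /= => h; exact: fg.
Qed.

Lemma ok01_cont f : continuous f -> ok01 f.
Proof.
move=> cf; apply: continuous_compact_integrable; first exact: segment_compact.
exact: continuous_subspaceT.
Qed.

Lemma ok01D f g : ok01 f -> ok01 g -> ok01 (fun x => f x + g x).
Proof. by move=> hf hg; exact: (@integrableD _ _ _ _ _ m01 (EFin \o f) (EFin \o g)). Qed.

Lemma ok01Z c f : ok01 f -> ok01 (fun x => c * f x).
Proof. by move=> hf; exact: (@integrableZl _ _ _ _ _ m01 c (EFin \o f)). Qed.

Lemma ok01N f : ok01 f -> ok01 (fun x => - f x).
Proof.
by move=> /(ok01Z (-1)); apply: ok01_ext => x; rewrite mulN1r.
Qed.

Lemma ok01B f g : ok01 f -> ok01 g -> ok01 (fun x => f x - g x).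
Proof. by move=> hf hg; apply: ok01D => //; apply: ok01N. Qed.

Lemma ok01_cst c : ok01 (fun _ : R => c).
Proof. by apply: ok01_cont => x; exact: cvg_cst. Qed.

Lemma ok01_abs f : ok01 f -> ok01 (fun x => `|f x|).
Proof. exact: integrable_norm. Qed.

Lemma ok01_sum (I : Type) (r : seq I) (h : I -> R -> R) :
  (forall i, ok01 (h i)) -> ok01 (fun x => \sum_(i <- r) h i x).
Proof.
move=> hh; elim: r => [|i r IH].
  by apply: ok01_ext (ok01_cst 0) => x; rewrite big_nil.
by apply: ok01_ext (ok01D (hh i) IH) => x; rewrite big_cons.
Qed.

Lemma ok01_mfun f : ok01 f -> measurable_fun (`[0%R, 1%R] : set (measurableTypeR R)) f.
Proof. by move=> /measurable_int /measurable_EFinP. Qed.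

Lemma ok01_le f g : measurable_fun (`[0%R, 1%R] : set (measurableTypeR R)) f ->
  ok01 g -> (forall x, 0 <= x <= 1 -> `|f x| <= g x) -> ok01 f.
Proof.
move=> mf hg fg; apply: (le_integrable m01 _ _ hg); first exact/measurable_EFinP.
move=> x /=; rewrite in_itv /= lee_fin => h.
by apply: (le_trans (fg x h)); exact: ler_norm.
Qed.

Lemma ok01M f g c : ok01 f -> measurable_fun (`[0%R, 1%R] : set (measurableTypeR R)) g ->
  (forall x, 0 <= x <= 1 -> `|g x| <= c) -> ok01 (fun x => f x * g x).
Proof.
move=> hf mg bg.
apply: (ok01_le _ (ok01Z c (ok01_abs hf))).
  by apply: measurable_funM => //; exact: ok01_mfun.
by move=> x h; rewrite normrM mulrC ler_wpM2r// bg.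
Qed.

Lemma cont_bounded01 f : continuous f ->
  exists c, forall x, 0 <= x <= 1 -> `|f x| <= c.
Proof.
move=> cf.
have [M [_ hM]] : bounded_set (f @` `[0%R, 1%R]).
  apply/compact_bounded/continuous_compact; last exact: segment_compact.
  exact: continuous_subspaceT.
exists (M + 1) => x hx; apply: (hM (M + 1)); first by rewrite ltrDl.
by exists x => //=; rewrite in_itv.
Qed.

Lemma cont_mfun01 f : continuous f -> measurable_fun (`[0%R, 1%R] : set (measurableTypeR R)) f.
Proof. by move=> /ok01_cont /ok01_mfun. Qed.

Lemma ok01M_cont f g : ok01 f -> continuous g -> ok01 (fun x => f x * g x).
Proof.
move=> hf cg; have [c hc] := cont_bounded01 cg.
by apply: ok01M hc => //; exact: cont_mfun01.
Qed.

Lemma ok01_sqr f : measurable_fun (`[0%R, 1%R] : set (measurableTypeR R)) f ->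
  ok01 (fun x => f x ^+ 2) -> ok01 f.
Proof.
move=> mf h2; apply: (ok01_le mf (ok01D h2 (ok01_cst 1))) => x _.
have := sqr_ge0 (`|f x| - 1); rewrite -[f x ^+ 2]real_normK ?num_real//.
by have := normr_ge0 (f x); nra.
Qed.

Lemma I01D f g : ok01 f -> ok01 g -> I01 (fun x => f x + g x) = I01 f + I01 g.
Proof. by move=> hf hg; rewrite /I01 RintegralD. Qed.

Lemma I01B f g : ok01 f -> ok01 g -> I01 (fun x => f x - g x) = I01 f - I01 g.
Proof. by move=> hf hg; rewrite /I01 RintegralB. Qed.

Lemma I01Z c f : ok01 f -> I01 (fun x => c * f x) = c * I01 f.
Proof. by move=> hf; rewrite /I01 RintegralZl. Qed.

Lemma I01_cst c : I01 (fun=> c) = c.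
Proof.
rewrite /I01 Rintegral_cst//.
have /= -> := @lebesgue_measure_itv R `[0%R, 1%R].
by rewrite lte_fin ltr01 oppr0 adde0 mulr1. Qed.

Lemma I01_sum (I : Type) (r : seq I) (h : I -> R -> R) :
  (forall i, ok01 (h i)) ->
  I01 (fun x => \sum_(i <- r) h i x) = \sum_(i <- r) I01 (h i).
Proof.
move=> hh; elim: r => [|i r IH].
  rewrite big_nil -[RHS](I01_cst 0); apply: eq_I01 => x _; by rewrite big_nil.
rewrite big_cons -IH -I01D//; last exact: ok01_sum.
by apply: eq_I01 => x _; rewrite big_cons.
Qed.

Lemma le_I01 f g : ok01 f -> ok01 g ->
  (forall x, 0 <= x <= 1 -> f x <= g x) -> I01 f <= I01 g.
Proof.
move=> hf hg fg; apply: le_Rintegral => // x /=; rewrite in_itv /=; exact: fg.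
Qed.

Lemma I01_ge0 f : (forall x, 0 <= x <= 1 -> 0 <= f x) -> 0 <= I01 f.
Proof. by move=> h; apply: Rintegral_ge0 => x /=; rewrite in_itv /=; exact: h. Qed.

Lemma I01_abs f : ok01 f -> `|I01 f| <= I01 (fun x => `|f x|).
Proof. by move=> hf; apply: le_normr_Rintegral. Qed.

Lemma I01_bound f c : ok01 f -> (forall x, 0 <= x <= 1 -> `|f x| <= c) ->
  `|I01 f| <= c.
Proof.
move=> hf fc; apply: (le_trans (I01_abs hf)); rewrite -[leRHS]I01_cst.
by apply: le_I01 => //; [exact: ok01_abs | exact: ok01_cst].
Qed.

Lemma I01_CS f g : ok01 (fun x => f x ^+ 2) -> ok01 (fun x => g x ^+ 2) ->
  ok01 (fun x => f x * g x) ->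
  I01 (fun x => f x * g x) ^+ 2 <= I01 (fun x => f x ^+ 2) * I01 (fun x => g x ^+ 2).
Proof.
move=> hf hg hfg.
set A := I01 (fun x => f x ^+ 2); set B := I01 (fun x => g x ^+ 2).
set C := I01 _.
have A0 : 0 <= A by apply: I01_ge0 => x _; exact: sqr_ge0.
have B0 : 0 <= B by apply: I01_ge0 => x _; exact: sqr_ge0.
have Q t : 0 <= A - 2 * t * C + t ^+ 2 * B.
  have -> : A - 2 * t * C + t ^+ 2 * B = I01 (fun x => (f x - t * g x) ^+ 2).
    rewrite /A /B /C -!I01Z// -I01B//; last exact: ok01Z.
    rewrite -I01D//; last 2 first.
      by apply: ok01B => //; exact: ok01Z.
      exact: ok01Z.
    by apply: eq_I01 => x _; ring.
  by apply: I01_ge0 => x _; exact: sqr_ge0.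
have [B00|B00] := eqVneq B 0.
  have [->|C0] := eqVneq C 0; first by rewrite expr0n /= mulr_ge0.
  (* For [B = 0] the quadratic is affine in [t]; at this point its value is [- A - 2 < 0]. *)
  have := Q ((A + 1) / C); rewrite B00 mulr0 addr0.
  have -> : 2 * ((A + 1) / C) * C = 2 * (A + 1) by field.
  by move: A0; clear; lra.
have Bp : 0 < B by rewrite lt_def B00.
have := Q (C / B).
have -> : A - 2 * (C / B) * C + (C / B) ^+ 2 * B = A - C ^+ 2 / B by field.
by rewrite subr_ge0 ler_pdivrMr.
Qed.

Lemma I01_lim (fn : nat -> R -> R) f (e : nat -> R) :
  (forall n, ok01 (fn n)) -> ok01 f ->
  (forall n x, 0 <= x <= 1 -> `|fn n x - f x| <= e n) ->
  e @ \oo --> 0 -> (fun n => I01 (fn n)) @ \oo --> I01 f.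
Proof.
move=> hn hf hb he.
apply/subr_cvg0; apply/norm_cvg0P.
apply: (squeeze_cvgr _ (cvg_cst 0) he).
apply: nearW => n; rewrite normr_ge0 /=; rewrite /= -I01B//.
by apply: I01_bound; [exact: ok01B|exact: hb].
Qed.

Lemma I01_deriv (F f : R -> R) : continuous f ->
  (forall x : R, is_derive x 1 F (f x)) -> I01 f = F 1 - F 0.
Proof.
move=> cf dF; rewrite /I01 /Rintegral.
have cF : continuous F.
  move=> x; apply: differentiable_continuous; apply/derivable1_diffP.
  by case: (dF x).
rewrite (@continuous_FTC2 _ f F)//.
- exact: continuous_subspaceT.
- split => //.
  + by apply: cvg_at_right_filter; exact: cF.
  + by apply: cvg_at_left_filter; exact: cF.
- by move=> x _; rewrite derive1E; case: (dF x).
Qed.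

Lemma I01_ae f g : measurable_fun (`[0%R, 1%R] : set (measurableTypeR R)) f ->
  measurable_fun (`[0%R, 1%R] : set (measurableTypeR R)) g ->
  {ae lebesgue_measure, forall x, 0 <= x <= 1 -> f x = g x} -> I01 f = I01 g.
Proof.
move=> mf mg fg; rewrite /I01 /Rintegral; congr fine.
apply: ae_eq_integral => //; try exact/measurable_EFinP.
move: fg; apply: filterS; first exact: (ae_filter_ringOfSetsType lebesgue_measure).
move=> x /= h; rewrite in_itv /= => /h -> //.
Qed.

End integral01.

(** * Difference quotients, mean values and Cousin's lemma *)

Section real_tools.
Context {R : realType}.
Implicit Types (f g : R -> R) (x y a b : R).

Lemma is_derive_eps f x d : is_derive x 1 f d -> forall e, 0 < e ->
  exists2 r : R, 0 < r & forall h, `|h| < r -> `|f (x + h) - f x - h * d| <= e * `|h|.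
Proof.
move=> [df dd] e e0.
have H : (fun h => h^-1 *: (f (h *: 1 + x) - f x)) @ 0^' --> d.
  by rewrite -dd; exact: df.
move/cvgrPdist_le : H => /(_ e e0) [r /= r0 hr].
exists r => // h hlt.
have [->|h0] := eqVneq h 0; first by rewrite addr0 subrr mul0r subr0 normr0 mulr0.
have := hr h; rewrite /= sub0r normrN => /(_ hlt h0).
rewrite /GRing.scale /= mulr1 => H.
have -> : f (x + h) - f x - h * d = - (h * (d - h^-1 * (f (h + x) - f x))).
  by rewrite [h + x]addrC; field.
by rewrite normrN normrM mulrC ler_wpM2r.
Qed.

(** Differentiability in a quantitative form that survives summation: quadratic errors are added
    term by term when a series is differentiated in [nser_deriv]. *)
Lemma is_derive_quad f x d C :
  (forall y, `|f y - f x - (y - x) * d| <= C * (y - x) ^+ 2) -> is_derive x 1 f d.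
Proof.
move=> H.
have C0 : 0 <= C.
  have := H (x + 1); have -> : x + 1 - x = 1 by ring.
  by rewrite expr1n mulr1; apply: le_trans.
have L : (fun h => h^-1 *: (f (h *: 1 + x) - f x)) @ 0^' --> d.
  apply/cvgrPdist_le => e e0; exists (e / (C + 1)).
    by rewrite /= divr_gt0// ltr_wpDl.
  move=> h /=; rewrite sub0r normrN => hlt h0.
  have := H (h + x); rewrite addrK /GRing.scale /= mulr1 => Hh.
  have -> : d - h^-1 * (f (h + x) - f x) = - (h^-1 * (f (h + x) - f x - h * d)).
    by field.
  rewrite normrN normrM normfV ler_pdivrMl ?normr_gt0//.
  apply: (le_trans Hh).
  have -> : h ^+ 2 = `|h| ^+ 2 by rewrite real_normK// num_real.
  have : `|h| * (C + 1) <= e by rewrite -ler_pdivlMr ?ltr_wpDl// ltW.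
  by have := normr_ge0 h; nra.
have D : derivable f x 1 by apply/cvg_ex; exists d.
by split => //; exact/cvg_lim.
Qed.

Lemma derive_continuous f (f1 : R -> R) :
  (forall x, is_derive x 1 f (f1 x)) -> continuous f.
Proof.
move=> df x; apply: differentiable_continuous; apply/derivable1_diffP.
by case: (df x).
Qed.

Lemma lip_bound f (f1 : R -> R) C :
  (forall x, is_derive x 1 f (f1 x)) -> (forall x, `|f1 x| <= C) ->
  forall x y, `|f y - f x| <= C * `|y - x|.
Proof.
move=> df bf x y.
wlog xy : x y / x <= y.
  by move=> W; have [/W//|/ltW/W] := leP x y; rewrite distrC [`|x - y|]distrC.
have [c _ ->] := MVT_segment xy (fun z _ => df z)
   (continuous_subspaceT (derive_continuous df)).
by rewrite normrM ler_wpM2r.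
Qed.

(** Mean value theorem for [f], then for [f1]; the usual factor 1/2 is given up. *)
Lemma taylor1_bound f (f1 f2 : R -> R) C :
  (forall x, is_derive x 1 f (f1 x)) -> (forall x, is_derive x 1 f1 (f2 x)) ->
  (forall x, `|f2 x| <= C) ->
  forall x y, `|f y - f x - (y - x) * f1 x| <= C * (y - x) ^+ 2.
Proof.
move=> df df1 bf x y.
have C0 : 0 <= C by apply: le_trans (bf 0).
have key z : x <= z -> `|f z - f x - (z - x) * f1 x| <= C * (z - x) ^+ 2.
  move=> xz; have [c] := MVT_segment xz (fun z _ => df z)
     (continuous_subspaceT (derive_continuous df)).
  rewrite in_itv /= => /andP[xc cz] ->.
  have -> : f1 c * (z - x) - (z - x) * f1 x = (f1 c - f1 x) * (z - x) by ring.
  rewrite normrM; have := lip_bound df1 bf x c.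
  rewrite [`|c - x|]ger0_norm ?subr_ge0// [`|z - x|]ger0_norm ?subr_ge0// expr2 mulrA => h.
  rewrite ler_wpM2r ?subr_ge0//; apply: (le_trans h).
  by rewrite ler_wpM2l// lerD2r.
have [/key//|yx] := leP x y.
have [c] := MVT_segment (ltW yx) (fun z _ => df z)
     (continuous_subspaceT (derive_continuous df)).
rewrite in_itv /= => /andP[yc cx] E.
have -> : f y - f x - (y - x) * f1 x = (f1 x - f1 c) * (x - y).
  have -> : f y - f x = - (f x - f y) by ring.
  by rewrite E; ring.
rewrite normrM; have := lip_bound df1 bf c x.
rewrite [`|x - c|]ger0_norm ?subr_ge0// [`|x - y|]ger0_norm ?subr_ge0 ?(ltW yx)// => h.
have -> : (y - x) ^+ 2 = (x - y) ^+ 2 by ring.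
rewrite expr2 mulrA ler_wpM2r ?subr_ge0 ?(ltW yx)//; apply: (le_trans h).
by rewrite ler_wpM2l// lerD2l lerN2.
Qed.

(** Cousin's lemma, by the supremum of the [x] with [P a x]. It replaces compactness three times: in
    the growth lemma, for the uniform energy bound, and to chain the time steps of the blow-up
    argument. *)
Lemma cousin (P : R -> R -> Prop) a b : a <= b ->
  (forall u v w, a <= u -> u <= v -> v <= w -> w <= b -> P u v -> P v w -> P u w) ->
  (forall x, a <= x <= b -> exists2 d, 0 < d &
     forall u w, a <= u -> u <= x -> x <= w -> w <= b -> w - u < d -> P u w) ->
  P a b.
Proof.
move=> ab glue loc.
pose S := [set x | a <= x <= b /\ P a x].
have Sa : S a.
  split; first by rewrite lexx ab.
  have [|d d0 h] := loc a; first by rewrite lexx ab.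
  by apply: h => //; rewrite subrr.
have hS : has_sup S.
  by split; [exists a | exists b => x [/andP[_ ]]].
have as_ : a <= sup S by apply: ub_le_sup => //; case: hS.
have sb : sup S <= b by apply: ge_sup; [exists a | move=> x [/andP[_ ]]].
have [|d d0 hd] := loc (sup S); first by rewrite as_ sb.
have d20 : 0 < d / 2 by rewrite divr_gt0.
have [x Sx hx] := sup_adherent d20 hS.
have xs : x <= sup S by apply: ub_le_sup => //; case: hS.
case: Sx => /andP[ax xb] Pax.
(* [P a w] puts [w] below the supremum, which leaves only [w = b]. *)
pose w := Num.min b (sup S + d / 4).
have sw : sup S <= w by rewrite le_min sb/= lerDl divr_ge0// ltW.
have wb : w <= b by rewrite ge_min lexx.
have wd : w <= sup S + d / 4 by rewrite ge_min lexx orbT.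
have Paw : P a w.
  apply: (glue a x w) => //; first exact: le_trans sw.
  by apply: hd => //; move: d0 wd hx; clear; lra.
have ws : w <= sup S.
  apply: ub_le_sup; first by case: hS.
  by split => //; rewrite (le_trans as_ sw) wb.
have : w = b.
  rewrite /w /Num.min; case: ltP => // h.
  by move: ws; rewrite /w /Num.min ltNge h /=; move: d0; clear; lra.
by move=> <-.
Qed.

End real_tools.

(** * A growth lemma for absolutely continuous functions *)

Section growth.
Context {R : realType}.
Implicit Types (g D : R -> R).

Lemma sum_disjoint_itv_le (n : nat) (l r : 'I_n -> R) (U : set (measurableTypeR R)) (e : R) :
  measurable U -> (lebesgue_measure U < e%:E)%E ->
  (forall i, l i <= r i) -> (forall i x, l i < x < r i -> U x) ->
  trivIset [set: 'I_n] (fun i => `]l i, r i[%classic) ->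
  \sum_(i < n) (r i - l i) < e.
Proof.
move=> mU Ue lr lU tI; rewrite -lte_fin; apply: le_lt_trans Ue.
have mI (i : 'I_n) : measurable (`]l i, r i[%classic : set (measurableTypeR R)).
  exact: measurable_itv.
pose F (i : 'I_n) := (`]l i, r i[%classic : set (measurableTypeR R)).
have mFU : measurable (\big[setU/set0]_(i < n) F i).
  by apply: bigsetU_measurable => i _; exact: mI.
have <- : lebesgue_measure (\big[setU/set0]_(i < n) F i) = (\sum_(i < n) (r i - l i))%:E.
  rewrite measure_semi_additive_ord// -sumEFin; apply: eq_bigr => i _.
  have /= -> := @lebesgue_measure_itv R `](l i), (r i)[.
  rewrite lte_fin; case: ltP => // h.
  have -> : r i = l i by apply/eqP; rewrite eq_le h lr.
  by rewrite subrr.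
apply: le_measure; rewrite ?inE//.
move=> x; elim/big_ind : _ => //; first by move=> A B hA hB [/hA|/hB].
by move=> i _; rewrite /F /mkset in_itv /= => /lU.
Qed.

Lemma trivIset_split (n1 n2 : nat) (l1 r1 : 'I_n1 -> R) (l2 r2 : 'I_n2 -> R) (v : R) :
  (forall i, r1 i <= v) -> (forall i, v <= l2 i) ->
  trivIset [set: 'I_n1] (fun i => `]l1 i, r1 i[%classic) ->
  trivIset [set: 'I_n2] (fun i => `]l2 i, r2 i[%classic) ->
  trivIset [set: 'I_(n1 + n2)] (fun i =>
     `]match fintype.split i with inl j => l1 j | inr j => l2 j end,
       match fintype.split i with inl j => r1 j | inr j => r2 j end[%classic).
Proof.
move=> h1 h2 t1 t2 i j _ _ [x []] /=.
move: (splitK i) (splitK j).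
case: (fintype.split i) => a <-; case: (fintype.split j) => b <-; rewrite !in_itv /= => xa xb.
- by have -> // : a = b by apply: t1 => //; exists x; split; rewrite /= in_itv.
- exfalso; have := h1 a; have := h2 b; move: xa xb; clear; lra.
- exfalso; have := h1 b; have := h2 a; move: xa xb; clear; lra.
- by have -> // : a = b by apply: t2 => //; exists x; split; rewrite /= in_itv.
Qed.

(** The exceptional null set is covered by an open [U] of small measure. In a Cousin partition,
    intervals tagged outside [U] satisfy the bound up to [e] times their length by
    differentiability; those tagged in [U] have small total length, hence small total variation by
    absolute continuity. *)
Lemma AC_growth g D (b u w m : R) :
  absolutely_continuous 0 b g -> 0 <= u -> u <= w -> w <= b ->
  {ae lebesgue_measure, forall t : R, 0 < t < w -> is_derive t 1 g (D t)} ->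
  (forall t, u < t < w -> m <= D t) ->
  m * (w - u) <= g w - g u.
Proof.
move=> ac u0 uw wb ae mD; apply/ler_addgt0Pl => e0 e0p.
(* Three errors add up to [e0]: [e * (w - u)] from differentiability, [e] from the variation of [g]
   on [U], and [e] from [m] times the length of [U]. *)
pose e := e0 / (w - u + 1 + 1).
have ep : 0 < e by rewrite divr_gt0// -addrA ltr_wpDl// subr_ge0.
have [d d0 acd] := ac e ep.
have e2 : 0 < e / (`|m| + 1) by rewrite divr_gt0// ltr_wpDl.
pose d' := Num.min d (e / (`|m| + 1)).
have d'0 : 0 < d' by rewrite lt_min d0.
have s2 (X Y : set (measurableTypeR R)) : measurable X -> measurable Y ->
    lebesgue_measure X = 0%E -> lebesgue_measure Y = 0%E ->
    lebesgue_measure (X `|` Y) = 0%E.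
  move=> mX mY X0 Y0; apply/eqP; rewrite eq_le measure_ge0 andbT.
  apply: (le_trans (measureU2 _ mX mY)).
  by have -> : (0 = lebesgue_measure X + lebesgue_measure Y)%E by rewrite X0 Y0 add0e.
have [A [mA A0 NA]] := ae.
have s1 (z : R) : lebesgue_measure ([set z] : set (measurableTypeR R)) = 0%E.
  exact: lebesgue_measure_set1.
(* The endpoints join the null set, since [mD] covers the open interval only. *)
have mB : measurable (A `|` ([set u] `|` [set w]) : set (measurableTypeR R)).
  by apply: measurableU => //; apply: measurableU; exact: measurable_set1.
have B0 : lebesgue_measure (A `|` ([set u] `|` [set w]) : set (measurableTypeR R)) = 0%E.
  apply: (s2 _ _ mA _ A0); first by apply: measurableU; exact: measurable_set1.
  by apply: (s2 _ _ _ _ (s1 u) (s1 w)); exact: measurable_set1.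
have [U [oU BU mUB]] := @lebesgue_regularity_outer R _ d' mB (eq_ind_r (fun z => (z < +oo)%E) (ltry 0) B0) d'0.
have mU : measurable (U : set (measurableTypeR R)) by exact: open_measurable.
have Ud : (lebesgue_measure (U : set (measurableTypeR R)) < d'%:E)%E.
  apply: le_lt_trans mUB.
  set B : set (measurableTypeR R) := A `|` _ in mB B0 BU *.
  have mD' : measurable (U `\` B : set (measurableTypeR R)) by exact: measurableD.
  rewrite -{1}(setDUK BU); apply: (le_trans (measureU2 _ mB mD')).
  by rewrite [X in (X + _)%E](B0) add0e.
(* The bad intervals are carried along as data: absolute continuity has to be applied once, to the
   whole family, after the gluing. *)
pose Pr x y := exists n (l r : 'I_n -> R), [/\ forall i, x <= l i /\ l i <= r i /\ r i <= y,
   forall i z, l i < z < r i -> U z,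
   trivIset [set: 'I_n] (fun i => `]l i, r i[%classic) &
   - e * (y - x) - \sum_(i < n) `|g (r i) - g (l i)| - `|m| * \sum_(i < n) (r i - l i)
     <= (g y - g x) - m * (y - x)].
have : Pr u w.
  apply: cousin => //.
    move=> x v y ux xv vy yw [n1 [l1 [r1 [a1 b1 c1 d1]]]] [n2 [l2 [r2 [a2 b2 c2 d2]]]].
    exists (n1 + n2)%N.
    exists (fun i => match fintype.split i with inl j => l1 j | inr j => l2 j end).
    exists (fun i => match fintype.split i with inl j => r1 j | inr j => r2 j end).
    split.
    - move=> i; case: (fintype.split i) => j.
        by have [? [? ?]] := a1 j; split => //; split => //; apply: le_trans vy.
      by have [? [? ?]] := a2 j; split => //; apply: le_trans xv _.
    - by move=> i z; case: (fintype.split i) => j; [exact: b1 | exact: b2].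
    - apply: (@trivIset_split _ _ _ _ _ _ v _ _ c1 c2) => i.
        by have [? [? ?]] := a1 i.
      by have [? [? ?]] := a2 i.
    - rewrite !big_split_ord /=.
      have sp1 (k : 'I_n1) : fintype.split (lshift n2 k) = inl k by exact: (unsplitK (inl k)).
      have sp2 (k : 'I_n2) : fintype.split (rshift n1 k) = inr k by exact: (unsplitK (inr k)).
      rewrite [X in _ - (X + _) - _](eq_bigr (fun k => `|g (r1 k) - g (l1 k)|)); last by move=> k _; rewrite sp1.
      rewrite [X in _ - (_ + X) - _](eq_bigr (fun k => `|g (r2 k) - g (l2 k)|)); last by move=> k _; rewrite sp2.
      rewrite [X in _ - _ - _ * (X + _)](eq_bigr (fun k => r1 k - l1 k)); last by move=> k _; rewrite sp1.
      rewrite [X in _ - _ - _ * (_ + X)](eq_bigr (fun k => r2 k - l2 k)); last by move=> k _; rewrite sp2.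
      by move: d1 d2; clear; lra.
  move=> x /andP[ux xw].
  have [xU|xU] := pselect (U x).
    have /nbhs_ballP [r /= r0 hr] : nbhs x U by exact: open_nbhs_nbhs.
    exists r => // p q up px xq qw qp.
    exists 1%N, (fun=> p), (fun=> q); split.
    - by move=> _; rewrite !lexx (le_trans px xq).
    - move=> _ z zpq; apply: hr; rewrite /ball /= ltr_norml.
      by move: zpq qp px xq; clear; lra.
    - by move=> i j _ _ _; rewrite !ord1.
    - rewrite !big_ord1.
      have H1 := ler_norm (- (g q - g p)); rewrite normrN in H1.
      have H2 : m * (q - p) <= `|m| * (q - p).
        by rewrite ler_wpM2r ?ler_norm// subr_ge0 (le_trans px xq).
      have H3 : 0 <= e * (q - p) by rewrite mulr_ge0 ?(ltW ep)// subr_ge0 (le_trans px xq).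
      move: H1 H2 H3; clear; rewrite mulNr; lra.
  have xB : ~ (A `|` ([set u] `|` [set w])) x by move=> /BU.
  have ux' : u < x.
    by rewrite lt_neqAle ux andbT; apply/eqP => E; apply: xB; right; left.
  have xw' : x < w.
    by rewrite lt_neqAle xw andbT; apply/eqP => E; apply: xB; right; right.
  have dx : is_derive x 1 g (D x).
    apply: contrapT => h; apply: xB; left; apply: NA => /= H; apply: h.
    by apply: H; rewrite (le_lt_trans u0 ux') xw'.
  have [r r0 hr] := is_derive_eps dx ep.
  have mDx : m <= D x by apply: mD; rewrite ux'.
  exists r => // p q up px xq qw qp.
  exists 0%N, (fun=> 0), (fun=> 0); split; try by case.
  rewrite !big_ord0 mulr0 !subr0.
  have := hr (q - x); rewrite ger0_norm ?subr_ge0// => /(_ _)/[dup].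
  have -> : x + (q - x) = q by ring.
  move=> H _; have {}H := H (ltac:(move: qp px; clear; lra)).
  have := hr (p - x); rewrite ler0_norm ?subr_le0// => H'.
  have {H'} := H' (ltac:(move: qp xq; clear; lra)).
  have -> : x + (p - x) = p by ring.
  move: H; rewrite !ler_norml => /andP[H1 _] /andP[_ H2].
  have H3 : m * (q - x) <= D x * (q - x) by rewrite ler_wpM2r// subr_ge0.
  have H4 : m * (x - p) <= D x * (x - p) by rewrite ler_wpM2r// subr_ge0.
  by move: H1 H2 H3 H4; clear; lra.
move=> [n [l [r [a1 b1 c1 d1]]]].
have slr : \sum_(i < n) (r i - l i) < d'.
  apply: sum_disjoint_itv_le Ud _ b1 c1 => // i.
  by have [_ []] := a1 i.
have sg : \sum_(i < n) `|g (r i) - g (l i)| < e.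
  apply: acd c1 _ => //; last by apply: lt_le_trans slr _; rewrite ge_min lexx.
  move=> i; have [h1 [h2 h3]] := a1 i; split; first exact: le_trans h1.
  by split => //; apply: le_trans wb.
have sm : `|m| * \sum_(i < n) (r i - l i) <= e.
  have h : \sum_(i < n) (r i - l i) <= e / (`|m| + 1).
    by apply: le_trans (ltW slr) _; rewrite ge_min lexx orbT.
  apply: (le_trans (ler_wpM2l (normr_ge0 _) h)).
  rewrite mulrA ler_pdivrMr ?ltr_wpDl// mulrDr mulr1 mulrC lerDl.
  exact: ltW.
have Ee : e * (w - u + 1 + 1) = e0.
  by rewrite /e divfK// gt_eqF// -addrA ltr_wpDl// subr_ge0.
by move: d1 sg sm Ee; clear; lra.
Qed.

End growth.

(** * Trigonometric polynomials *)

Section waves.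
Context {R : realType}.
Implicit Types (a b c x y : R) (j k : nat).

(** The phase lets one family hold cosines and sines (phase [- (pi / 2)]): differentiation and
    translation only change the phase and the coefficient. *)
Definition wave k a x : R := cos (2 * pi * k%:R * x + a).

Lemma is_derive_wave k a x :
  is_derive x 1 (wave k a) (2 * pi * k%:R * wave k (a + pi / 2) x).
Proof.
have H : is_derive x 1 (fun y : R => 2 * pi * k%:R * y + a) (2 * pi * k%:R).
  apply: (@is_derive_quad _ _ _ _ 0) => y.
  by rewrite (_ : _ - _ - _ = 0) ?normr0 ?mul0r//; ring.
rewrite /wave addrA cosDpihalf [X in is_derive _ _ _ X]mulrC.
exact: (@is_derive1_comp _ cos _ x _ _ (is_derive_cos _) H).
Qed.

Lemma wave_cont k a : continuous (wave k a).
Proof. exact: (derive_continuous (is_derive_wave k a)). Qed.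

Lemma wave_periodic k a : periodic (wave k a) 1.
Proof.
move=> x; rewrite /wave.
have -> : 2 * pi * k%:R * (x + 1) + a = (2 * pi * k%:R * x + a) + pi *+ 2 *+ k.
  by rewrite -mulrnA -(mulr_natr pi) natrM; ring.
by rewrite (periodicn (@cosD2pi R)).
Qed.

Lemma wave_le1 k a x : `|wave k a x| <= 1.
Proof. by rewrite ler_norml cos_geN1 cos_le1. Qed.

Lemma wave_shift k a x y : wave k a (x - y) = wave k (a - 2 * pi * k%:R * y) x.
Proof. by congr cos; ring. Qed.

Lemma wave0 a x : wave 0 a x = cos a.
Proof. by rewrite /wave mulr0 mul0r add0r. Qed.

Lemma cos_wave k : (fun x => cos (2 * pi * k%:R * x)) = wave k 0.
Proof. by apply/funext => x; rewrite /wave addr0. Qed.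

Lemma sin_wave k : (fun x => sin (2 * pi * k%:R * x)) = wave k (- (pi / 2)).
Proof. by apply/funext => x; rewrite /wave cosBpihalf. Qed.

Lemma fcosE (f : R -> R) k : fcos f k = I01 (fun x => f x * wave k 0 x).
Proof. by rewrite /fcos cos_wave. Qed.

Lemma fsinE (f : R -> R) k : fsin f k = I01 (fun x => f x * wave k (- (pi / 2)) x).
Proof. by rewrite /fsin sin_wave. Qed.

Lemma wave_mul j k a b x : (k <= j)%N ->
  wave j a x * wave k b x = 2^-1 * (wave (j + k) (a + b) x + wave (j - k) (a - b) x).
Proof.
move=> kj; rewrite /wave natrD natrB//.
set u := 2 * pi * j%:R * x + a; set v := 2 * pi * k%:R * x + b.
have -> : 2 * pi * (j%:R + k%:R) * x + (a + b) = u + v by rewrite /u /v; ring.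
have -> : 2 * pi * (j%:R - k%:R) * x + (a - b) = u - v by rewrite /u /v; ring.
by rewrite (cosB u v) (cosD u v); field.
Qed.

Lemma ok01_wave k a : ok01 (wave k a).
Proof. exact/ok01_cont/wave_cont. Qed.

Lemma pi2_gt0 : 0 < 2 * pi :> R.
Proof. by rewrite mulr_gt0// pi_gt0. Qed.

Lemma pi2k_gt0 k : (0 < k)%N -> 0 < 2 * pi * k%:R :> R.
Proof. by move=> k0; rewrite mulr_gt0 ?pi2_gt0// ltr0n. Qed.

Lemma pi2k_ge1 k : (0 < k)%N -> 1 <= 2 * pi * k%:R :> R.
Proof.
move=> k0; have k1 : 1 <= k%:R :> R by rewrite ler1n.
by have := @pi_ge2 R; nra.
Qed.

Lemma I01_wave k a : (0 < k)%N -> I01 (wave k a) = 0.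
Proof.
move=> k0; have w0 := pi2k_gt0 k0.
have D (x : R) : is_derive x 1 (wave k (a - pi / 2)) (2 * pi * k%:R * wave k a x).
  by have := is_derive_wave k (a - pi / 2) x; rewrite subrK.
have : I01 (fun x => 2 * pi * k%:R * wave k a x) = 0.
  rewrite (I01_deriv _ D); last first.
    move=> x; apply: cvgM; [exact: cvg_cst | exact: wave_cont].
  by rewrite -[X in wave _ _ X]add0r wave_periodic subrr.
rewrite I01Z; last exact: ok01_wave.
by move/eqP; rewrite mulf_eq0 (gt_eqF w0) /= => /eqP.
Qed.

Lemma I01_wave_mul j k a b : (0 < k)%N ->
  I01 (fun x => wave j a x * wave k b x) = if j == k then cos (a - b) / 2 else 0.
Proof.
move=> k0.
wlog kj : j k a b k0 / (k <= j)%N.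
  (* Exchanging the two waves requires a positive second frequency, so [j = 0] is settled
     directly. *)
  move=> W; have [kj|jk] := leqP k j; first exact: W.
  have [j0|j0] := posnP j.
    rewrite j0 eq_sym (gtn_eqF k0).
    rewrite -[RHS](mulr0 (cos a)) -(I01_wave b k0) -I01Z; last exact: ok01_wave.
    by apply: eq_I01 => x _; rewrite wave0.
  rewrite (_ : (fun x => _) = (fun x => wave k b x * wave j a x)); last first.
    by apply/funext => x; rewrite mulrC.
  by rewrite W//; [rewrite eq_sym -cosN opprB | exact: ltnW].
under eq_fun => x do rewrite wave_mul//.
rewrite I01Z; last by apply: ok01D; exact: ok01_wave.
rewrite I01D; try exact: ok01_wave.
rewrite I01_wave ?addn_gt0 ?k0 ?orbT// add0r.
have [->|jk] := eqVneq j k.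
  rewrite subnn (_ : I01 _ = cos (a - b)) 1?mulrC// -[RHS]I01_cst.
  by apply: eq_I01 => x _; rewrite wave0.
by rewrite I01_wave ?mulr0// subn_gt0 ltn_neqAle eq_sym jk.
Qed.

(* (c, (k, a)) stands for the function c cos(2 pi k x + a). *)
Definition term : Type := (R * (nat * R))%type.

Definition tp (s : seq term) x : R := \sum_(p <- s) p.1 * wave p.2.1 p.2.2 x.

Definition dterm (p : term) : term :=
  (p.1 * (2 * pi * p.2.1%:R), (p.2.1, p.2.2 + pi / 2)).

Definition lterm (alpha : R) (p : term) : term :=
  (p.1 * (2 * pi * p.2.1%:R) `^ (2 * alpha), p.2).

Lemma tp_cat s t x : tp (s ++ t) x = tp s x + tp t x.
Proof. by rewrite /tp big_cat. Qed.

Lemma tp_cons p s x : tp (p :: s) x = p.1 * wave p.2.1 p.2.2 x + tp s x.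
Proof. by rewrite /tp big_cons. Qed.

Lemma tp_nil x : tp [::] x = 0. Proof. by rewrite /tp big_nil. Qed.

Lemma tp_deriv s x : is_derive x 1 (tp s) (tp (map dterm s) x).
Proof.
elim: s => [|p s IH].
  rewrite tp_nil (_ : tp [::] = cst 0); first exact: is_derive_cst.
  by apply/funext => z; rewrite tp_nil.
rewrite /= tp_cons (_ : tp (p :: s) = p.1 \*: wave p.2.1 p.2.2 + tp s); last first.
  by apply/funext => z; rewrite tp_cons.
apply: is_deriveD.
have := @is_deriveZ _ _ _ _ p.1 x 1 _ (is_derive_wave p.2.1 p.2.2 x).
by rewrite /= /GRing.scale /= !mulrA.
Qed.

Lemma tp_cont s : continuous (tp s).
Proof. exact: (derive_continuous (tp_deriv s)). Qed.

Lemma ok01_tp s : ok01 (tp s). Proof. exact/ok01_cont/tp_cont. Qed.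

Lemma tp_periodic s : periodic (tp s) 1.
Proof. by move=> x; rewrite /tp; apply: eq_bigr => p _; rewrite wave_periodic. Qed.

Lemma smooth_of_derivs (F : nat -> R -> R) :
  (forall m x, is_derive x 1 (F m) (F m.+1 x)) ->
  smooth (F 0%N) /\ forall m, derive1n m (F 0%N) = F m.
Proof.
move=> dF.
have E m : derive1n m (F 0%N) = F m.
  elim: m => // m IH; rewrite derive1nS IH; apply/funext => x.
  by rewrite derive1E; case: (dF m x).
by split => // m x; rewrite E; case: (dF m x).
Qed.

Lemma tp_derivs s m x :
  is_derive x 1 (tp (iter m (map dterm) s)) (tp (iter m.+1 (map dterm) s) x).
Proof. by rewrite iterS; exact: tp_deriv. Qed.

Lemma tp_smooth s : smooth_periodic (tp s).
Proof.
by split; [have [] := smooth_of_derivs (tp_derivs s) | exact: tp_periodic].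
Qed.

Lemma derive1_tp s : (tp s)^`()%classic = tp (map dterm s).
Proof. by apply/funext => x; rewrite derive1E; case: (tp_deriv s x). Qed.

Lemma I01_tp_wave s k b : (0 < k)%N ->
  I01 (fun x => tp s x * wave k b x) =
  \sum_(p <- s | p.2.1 == k) p.1 * (cos (p.2.2 - b) / 2).
Proof.
move=> k0.
under eq_fun => x do rewrite /tp mulr_suml.
rewrite I01_sum; last first.
  move=> p; apply: ok01M_cont; last exact: wave_cont.
  exact/ok01Z/ok01_wave.
rewrite [RHS]big_mkcond; apply: eq_bigr => p _.
under eq_fun => x do rewrite -mulrA.
rewrite I01Z; last by apply: ok01M_cont; [exact: ok01_wave | exact: wave_cont].
by rewrite I01_wave_mul//; case: ifP => //; rewrite mulr0.
Qed.

Lemma fourier_tp s k x : (0 < k)%N ->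
  2 * (fcos (tp s) k * cos (2 * pi * k%:R * x) + fsin (tp s) k * sin (2 * pi * k%:R * x))
  = \sum_(p <- s | p.2.1 == k) p.1 * wave p.2.1 p.2.2 x.
Proof.
move=> k0; rewrite fcosE fsinE !I01_tp_wave//.
rewrite !mulr_suml -big_split mulr_sumr /=; apply: eq_bigr => p /eqP ->.
by rewrite /wave subr0 opprK cosDpihalf cosD; field.
Qed.

Lemma fractional_laplacian_tp alpha s : 0 < alpha ->
  fractional_laplacian alpha (tp s) = tp (map (lterm alpha) s).
Proof.
move=> a0; apply/funext => x; rewrite /fractional_laplacian.
apply: cvg_lim => //; apply: cvg_near_cst.
pose m := \max_(p <- s) p.2.1.
exists m.+1 => // n /= mn.
transitivity (\sum_(1 <= k < n) \sum_(p <- s | p.2.1 == k)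
     p.1 * (2 * pi * p.2.1%:R) `^ (2 * alpha) * wave p.2.1 p.2.2 x).
  rewrite big_nat_cond [RHS]big_nat_cond; apply: eq_bigr => k /andP[/andP[k0 _] _].
  rewrite -mulrA mulrCA fourier_tp// mulr_sumr; apply: eq_bigr => p /eqP ->.
  by ring.
rewrite /tp big_map (exchange_big_dep predT) //= [RHS]big_seq [LHS]big_seq.
apply: eq_bigr => p ps.
have pm : (p.2.1 <= m)%N by rewrite /m; apply: (leq_bigmax_seq p).
have [p0|p0] := posnP p.2.1.
  rewrite p0 mulr0 powR0 ?mulr0 ?mul0r; last by rewrite mulf_neq0 ?gt_eqF.
  by rewrite big1.
under eq_bigl => k do rewrite eq_sym.
rewrite -big_filter (_ : [seq i <- _ | _] = [:: p.2.1]) ?big_seq1//.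
apply: filter_pred1_uniq; first exact: iota_uniq.
by rewrite mem_index_iota p0 (leq_ltn_trans pm mn).
Qed.
End waves.

(** * Fejer kernels *)

Section fejer.
Context {R : realType}.
Implicit Types (x y z th : R) (b : nat -> R) (j k m n N : nat).

Lemma pi_le4 : pi <= 4 :> R.
Proof. by have [/andP[_]] := @pihalf_02_cos_pihalf R; lra. Qed.

Lemma abs_sin_le x : `|sin x| <= `|x|.
Proof.
have := @lip_bound R sin cos 1 (fun x => is_derive_sin x) _ 0 x.
rewrite sin0 !subr0 mul1r; apply=> z.
by rewrite ler_norml cos_geN1 cos_le1.
Qed.

Lemma cos_ge x : 1 - x ^+ 2 / 2 <= cos x.
Proof.
have -> : cos x = 1 - sin (x / 2) ^+ 2 *+ 2.
  have {1}-> : x = (x / 2) *+ 2 by rewrite -mulr_natr divfK.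
  by rewrite cos_mulr2n cos2sin2; ring.
rewrite lerD2l lerN2 -mulr_natr.
have : sin (x / 2) ^+ 2 <= (x / 2) ^+ 2.
  rewrite -(real_normK (num_real (sin (x / 2)))) -(real_normK (num_real (x / 2))).
  by rewrite lerXn2r ?nnegrE// abs_sin_le.
by rewrite exprMn; lra.
Qed.

(** On [0, 1] the cosine is at least 1/2, so [sin t >= t / 2]. Beyond 1 the sine is monotone, and
    [t / 4 <= 1 / 2] because [pi <= 4]. *)
Lemma sin_ge (t : R) : 0 <= t <= pi / 2 -> t / 4 <= sin t.
Proof.
have H (s : R) : 0 <= s <= 1 -> s / 2 <= sin s.
  move=> /andP[s0 s1].
  have [c] := MVT_segment s0 (fun z _ => is_derive_sin z)
    (continuous_subspaceT (@continuous_sin R)).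
  rewrite in_itv /= => /andP[c0 cs]; rewrite sin0 !subr0 => ->.
  have h := cos_ge c; rewrite [s / 2]mulrC; apply: ler_wpM2r => //.
  by apply: le_trans h; nra.
move=> /andP[t0 tpi]; have [t1|t1] := leP t 1.
  by apply: le_trans (H t _); rewrite ?t0 ?t1//; move: t0; clear; lra.
have p4 := pi_le4.
have : sin (1 : R) < sin t.
  rewrite ltr_sin// in_itv /=; move: t0 tpi t1 (@pi_ge2 R); clear; lra.
have := H 1; rewrite ler01 lexx => /(_ isT) h1 h2.
by move: h1 h2 p4 tpi; clear; lra.
Qed.

Lemma abs_sin_pi_ge x : `|x| <= 2^-1 -> `|x| / 2 <= `|sin (pi * x)|.
Proof.
move=> x2; have p2 := @pi_ge2 R.
have E : `|sin (pi * x)| = `|sin (pi * `|x|)|.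
  have [x0|x0] := leP 0 x; first by rewrite [`|x|]ger0_norm.
  by rewrite [`|x|]ltr0_norm// mulrN sinN normrN.
rewrite E; have h := normr_ge0 x.
apply: le_trans (ler_norm _); apply: (@le_trans _ _ (pi * `|x| / 4)).
  by nra.
by apply: sin_ge; apply/andP; split; nra.
Qed.

(** A cosine sum for [th = 0] and a sine sum for [th = - (pi / 2)]; all kernels and test functions
    below are of one of these two kinds. *)
Definition ssum (b : nat -> R) N (th z : R) : R := \sum_(1 <= k < N) b k * wave k th z.

Definition ts (b : nat -> R) N (th y : R) : seq term :=
  [seq (b k, (k, th - 2 * pi * k%:R * y)) | k <- index_iota 1 N].

Lemma tp_ts b N th y x : tp (ts b N th y) x = ssum b N th (x - y).
Proof.
rewrite /tp /ts big_map /ssum; apply: eq_bigr => k _ /=.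
by rewrite wave_shift.
Qed.

Lemma dterm_ts b N th y :
  map dterm (ts b N th y) = ts (fun k => b k * (2 * pi * k%:R)) N (th + pi / 2) y.
Proof.
rewrite /ts -map_comp; apply: eq_map => k; rewrite /dterm /=.
by congr (_, (_, _)); ring.
Qed.

Lemma lterm_ts alpha b N th y :
  map (lterm alpha) (ts b N th y) = ts (fun k => b k * (2 * pi * k%:R) `^ (2 * alpha)) N th y.
Proof. by rewrite /ts -map_comp; apply: eq_map. Qed.

Lemma ssum_deriv b N th z :
  is_derive z 1 (ssum b N th) (ssum (fun k => b k * (2 * pi * k%:R)) N (th + pi / 2) z).
Proof.
have E : ssum b N th = tp (ts b N th 0) by apply/funext => x; rewrite tp_ts subr0.
by rewrite E -[z in ssum _ _ _ z]subr0 -tp_ts -dterm_ts; exact: tp_deriv.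
Qed.

Lemma ssum_periodic b N th : periodic (ssum b N th) 1.
Proof. by move=> x; rewrite /ssum; apply: eq_bigr => k _; rewrite wave_periodic. Qed.

Lemma eq_ssum b b' N th z : (forall k, (0 < k < N)%N -> b k = b' k) -> ssum b N th z = ssum b' N th z.
Proof.
by move=> bb; apply: eq_big_nat => k kN; rewrite bb.
Qed.

Lemma ssum_widen b n N th z : (n <= N)%N -> (forall k, (n <= k)%N -> b k = 0) ->
  ssum b N th z = ssum b n th z.
Proof.
move=> nN b0; rewrite /ssum.
case: n nN b0 => [|n] nN b0.
  rewrite [RHS]big_geq// big1// => k _; by rewrite b0// mul0r.
rewrite (big_cat_nat (n := n.+1))//= [X in _ + X]big_nat_cond [X in _ + X]big1 ?addr0//.
by move=> k /andP[/andP[nk _] _]; rewrite b0// mul0r.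
Qed.

Lemma ssum_abs b N th z : `|ssum b N th z| <= \sum_(1 <= k < N) `|b k|.
Proof.
apply: (le_trans (ler_norm_sum _ _ _)); apply: ler_sum => k _.
by rewrite normrM ler_piMr// wave_le1.
Qed.

(** Twice the Fejer weight 1 - k / n, for the frequencies k and -k together. Truncated subtraction
    makes it vanish for [k >= n], so kernels of different orders can be summed over a common
    range. *)
Definition fcoef n k : R := 2 * ((n - k)%N%:R / n%:R).

Definition fejer n z : R := 1 + ssum (fcoef n) n 0 z.

Lemma fcoef_ge n k : (n <= k)%N -> fcoef n k = 0.
Proof. by rewrite -subn_eq0 => /eqP nk; rewrite /fcoef nk mul0r mulr0. Qed.

Lemma fejer_widen n N z : (n <= N)%N -> fejer n z = 1 + ssum (fcoef n) N 0 z.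
Proof. by move=> nN; rewrite (@ssum_widen _ n)// => k; exact: fcoef_ge. Qed.

(** The right-hand side is |sum_(k < n) e^(2 i pi k z)|^2, in real and imaginary parts. Positivity
    and both size estimates of the kernel follow from it. *)
Lemma fejer_sq n z : (0 < n)%N ->
  n%:R * fejer n z = (\sum_(0 <= k < n) wave k 0 z) ^+ 2
                   + (\sum_(0 <= k < n) wave k (- (pi / 2)) z) ^+ 2.
Proof.
(* The induction uses the unnormalized weights [m - k], which all grow by 1 with [m]. *)
have aux m : m%:R + 2 * ssum (fun k => (m - k)%N%:R) m 0 z
   = (\sum_(0 <= k < m) wave k 0 z) ^+ 2
                   + (\sum_(0 <= k < m) wave k (- (pi / 2)) z) ^+ 2.
  elim: m => [|m IH].
    by rewrite /ssum !big_geq// mulr0 addr0 expr0n /= addr0.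
  rewrite !(big_nat_recr m) //= .
  set C := \sum_(0 <= _ < m) _ in IH *; set D := \sum_(0 <= _ < m) wave _ (- _) _ in IH *.
  have cs : wave m 0 z ^+ 2 + wave m (- (pi / 2)) z ^+ 2 = 1.
    by rewrite /wave addr0 cosBpihalf cos2Dsin2.
  have -> : (C + wave m 0 z) ^+ 2 + (D + wave m (- (pi / 2)) z) ^+ 2
     = C ^+ 2 + D ^+ 2 + (wave m 0 z ^+ 2 + wave m (- (pi / 2)) z ^+ 2)
       + 2 * (C * wave m 0 z + D * wave m (- (pi / 2)) z) by ring.
  rewrite cs -IH.
  (* Each product pair is the cosine of a difference, of frequency [m - k]; the sum is then read
     backwards. *)
  have -> : C * wave m 0 z + D * wave m (- (pi / 2)) z = \sum_(1 <= k < m.+1) wave k 0 z.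
    rewrite /C /D !mulr_suml -big_split /= big_nat_rev /= add0n.
    rewrite [RHS]big_add1 /= !big_mkord; apply: eq_bigr => i _ /=.
    rewrite /wave !addr0 !cosBpihalf -cosB.
    rewrite -cosN; congr cos; rewrite natrB ?ltn_ord//; rewrite -natr1; ring.
  rewrite -(@ssum_widen _ m m.+1)//; last by move=> k mk; rewrite (eqP (_ : m - k == 0)%N) ?subn_eq0.
  have -> : ssum (fun k => (m.+1 - k)%N%:R) m.+1 0 z =
     ssum (fun k => (m - k)%N%:R) m.+1 0 z + \sum_(1 <= k < m.+1) wave k 0 z.
    rewrite /ssum -big_split /=; apply: eq_big_nat => k /andP[_ km].
    by rewrite subSn// -natr1 mulrDl mul1r.
  by rewrite -natr1; ring.
move=> n0; rewrite -aux /fejer mulrDr mulr1; congr (_ + _).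
rewrite /ssum !mulr_sumr; apply: eq_bigr => k _; rewrite /fcoef.
by field; rewrite pnatr_eq0 -lt0n.
Qed.

Lemma fejer_ge0 n z : (0 < n)%N -> 0 <= fejer n z.
Proof.
move=> n0; have n0' : 0 < n%:R :> R by rewrite ltr0n.
by rewrite -(pmulr_rge0 _ n0') fejer_sq// addr_ge0// sqr_ge0.
Qed.

Lemma fejer1 z : fejer 1 z = 1.
Proof. by rewrite /fejer /ssum big_geq// addr0. Qed.

(** In this range all phases are at most 1, so each of the [n] cosines is at least 1/2 and the real
    part in [fejer_sq] is at least [n / 2]. *)
Lemma fejer_near n z : (0 < n)%N -> `|z| <= (8 * n%:R)^-1 -> n%:R / 4 <= fejer n z.
Proof.
move=> n0 hz; have n0' : 0 < n%:R :> R by rewrite ltr0n.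
have H : n%:R / 2 <= \sum_(0 <= k < n) wave k 0 z.
  have -> : n%:R / 2 = \sum_(0 <= k < n) (2^-1 : R).
    by rewrite big_const_nat subn0 iter_addr_0 mulr_natl.
  rewrite !big_mkord; apply: ler_sum => i _.
  rewrite /wave addr0; apply: le_trans (cos_ge _).
  have h1 : `|2 * pi * i%:R * z| <= 1.
    rewrite !normrM (ger0_norm (pi_ge0 R)) [`|2|]ger0_norm// [`|i%:R|]ger0_norm//.
    have hin : i%:R <= n%:R :> R by rewrite ler_nat ltnW.
    have h2 : i%:R * `|z| <= 8^-1.
      apply: (@le_trans _ _ (n%:R * (8 * n%:R)^-1)).
        by apply: ler_pM.
      by rewrite invfM mulrC mulfVK ?gt_eqF.
    have p4 := pi_le4; have p2 := @pi_ge2 R.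
    have h3 : 0 <= i%:R * `|z| by rewrite mulr_ge0.
    by rewrite -mulrA; move: h2 h3 p4 p2; set X := i%:R * _; clear; nra.
  by rewrite -(real_normK (num_real (2 * pi * i%:R * z))); have := normr_ge0 (2 * pi * i%:R * z); nra.
rewrite -(ler_pM2l n0') fejer_sq//.
apply: (@le_trans _ _ ((\sum_(0 <= k < n) wave k 0 z) ^+ 2)); last first.
  by rewrite lerDl sqr_ge0.
by move: H; nra.
Qed.

(** Multiplied by [2 * sin (pi * z)], the two sums in [fejer_sq] telescope to boundary terms whose
    squares add up to at most 4. *)
Lemma fejer_tail n z : (0 < n)%N -> fejer n z * sin (pi * z) ^+ 2 <= n%:R^-1.
Proof.
move=> n0; have n0' : 0 < n%:R :> R by rewrite ltr0n.
have T m : 2 * sin (pi * z) * \sum_(0 <= k < m) wave k 0 z = sin ((2 * m%:R - 1) * pi * z) + sin (pi * z) /\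
   2 * sin (pi * z) * \sum_(0 <= k < m) wave k (- (pi / 2)) z = cos (pi * z) - cos ((2 * m%:R - 1) * pi * z).
  elim: m => [|m [IH1 IH2]].
    rewrite !big_geq// !mulr0 sub0r -mulrA mulN1r sinN cosN; split; ring.
  rewrite !big_nat_recr//= !(mulrDr (2 * sin (pi * z))) IH1 IH2 /wave addr0 cosBpihalf.
  set u := 2 * pi * m%:R * z; set v := pi * z.
  have -> : (2 * m%:R - 1) * pi * z = u - v by rewrite /u /v; ring.
  have -> : (2 * m.+1%:R - 1) * pi * z = u + v by rewrite /u /v -[m.+1%:R]natr1; ring.
  rewrite (sinB u v) (cosB u v) (sinD u v) (cosD u v); split; ring.
have [T1 T2] := T n.
have E : 4 * sin (pi * z) ^+ 2 * (n%:R * fejer n z) <= 4.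
  rewrite fejer_sq// mulrDr.
  have -> : 4 * sin (pi * z) ^+ 2 * (\sum_(0 <= k < n) wave k 0 z) ^+ 2 = (sin ((2 * n%:R - 1) * pi * z) + sin (pi * z)) ^+ 2.
    by rewrite -T1; ring.
  have -> : 4 * sin (pi * z) ^+ 2 * (\sum_(0 <= k < n) wave k (- (pi / 2)) z) ^+ 2 = (cos (pi * z) - cos ((2 * n%:R - 1) * pi * z)) ^+ 2.
    by rewrite -T2; ring.
  set u := (2 * _ - 1) * pi * z; set v := pi * z.
  have := cos2Dsin2 u; have := cos2Dsin2 v.
  have := sqr_ge0 (sin u - sin v); have := sqr_ge0 (cos u + cos v).
  by nra.
rewrite -(ler_pM2l n0') divff ?gt_eqF//.
by move: E; set A := n%:R; set B := fejer n z; set D := sin _ ^+ 2; lra.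
Qed.

Lemma fejer_deriv n z :
  is_derive z 1 (fun x => x + ssum (fun k => fcoef n k / (2 * pi * k%:R)) n (- (pi / 2)) x) (fejer n z).
Proof.
have -> : fejer n z = 1 + ssum (fun k => fcoef n k / (2 * pi * k%:R) * (2 * pi * k%:R)) n (- (pi / 2) + pi / 2) z.
  rewrite addNr /fejer; congr (1 + _); apply: eq_ssum => k /andP[k0 _].
  by rewrite divfK// gt_eqF// pi2k_gt0.
by apply: is_deriveD; exact: ssum_deriv.
Qed.

Lemma fejerE n y x : fejer n (x - y) = 1 + tp (ts (fcoef n) n 0 y) x.
Proof. by rewrite tp_ts. Qed.

Lemma ok01_fejer n y : ok01 (fun x => fejer n (x - y)).
Proof.
apply: (ok01_ext (fun x => esym (fejerE n y x))).
by apply: ok01D; [exact: ok01_cst | exact: ok01_tp].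
Qed.

Lemma fejer_cont n y : continuous (fun x => fejer n (x - y)).
Proof.
rewrite (_ : (fun x => _) = (fun x => 1 + tp (ts (fcoef n) n 0 y) x)).
  by move=> x; apply: cvgD; [exact: cvg_cst | exact: tp_cont].
by apply/funext => x; exact: fejerE.
Qed.

Lemma I01_tp s : (forall p, p \in s -> (0 < p.2.1)%N) -> I01 (tp s : R -> R) = 0.
Proof.
move=> hs; rewrite /tp I01_sum; last by move=> p; exact/ok01Z/ok01_wave.
rewrite big_seq big1// => p /hs p0; rewrite I01Z; last exact: ok01_wave.
by rewrite I01_wave// mulr0.
Qed.

Lemma I01_ts b N th y : I01 (tp (ts b N th y)) = 0.
Proof.
by apply: I01_tp => p /mapP[k]; rewrite mem_index_iota => /andP[k0 _] ->.
Qed.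

Lemma I01_fejer n y : I01 (fun x => fejer n (x - y)) = 1.
Proof.
under eq_fun => x do rewrite fejerE.
rewrite I01D; [|exact: ok01_cst|exact: ok01_tp].
by rewrite I01_cst I01_ts addr0.
Qed.

(** Summation by parts: what remains is a boundary term and the total variation of the decreasing
    weight [d]. *)
Lemma abel (d E : nat -> R) m n : (m <= n)%N ->
  (forall k, (m <= k)%N -> 0 <= d k.+1 <= d k) -> 0 <= d m -> (forall k, `|E k| <= 1) ->
  `|\sum_(m <= k < n) d k * (E k - E k.+1)| <= 2 * d m.
Proof.
move=> mn dd d0 hE.
have dn n' : (m <= n')%N -> 0 <= d n'.
  by case: n' => [|n']; [rewrite leqn0 => /eqP <- | rewrite leq_eqVlt => /orP[/eqP <-//|h]; have /andP[] := dd _ h].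
(* The boundary term is kept inside the norm, so that one step of the induction costs exactly one
   decrement of [d]. *)
have H i : `|\sum_(m <= k < m + i) d k * (E k - E k.+1) + d (m + i)%N * E (m + i)%N| <= 2 * d m - d (m + i)%N.
  elim: i => [|i IH].
    rewrite addn0 big_geq// add0r normrM (ger0_norm d0).
    by have := hE m; nra.
  rewrite addnS big_nat_recr ?leq_addr//=.
  have /andP[h1 h2] := dd (m + i)%N (leq_addr _ _).
  set Q := \sum_(_ <= _ < _) _ in IH *.
  have -> : Q + d (m + i)%N * (E (m + i)%N - E (m + i).+1) + d (m + i).+1 * E (m + i).+1
    = (Q + d (m + i)%N * E (m + i)%N) - (d (m + i)%N - d (m + i).+1) * E (m + i).+1 by ring.
  apply: (le_trans (ler_normB _ _)).
  have : `|(d (m + i)%N - d (m + i).+1) * E (m + i).+1| <= d (m + i)%N - d (m + i).+1.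
    by rewrite normrM ger0_norm ?subr_ge0// ler_piMr ?subr_ge0.
  by move: IH; lra.
have := H (n - m)%N; rewrite subnKC//.
set Q := \sum_(_ <= _ < _) _ => HQ.
have : `|Q| <= `|Q + d n * E n| + `|d n * E n|.
  by have := ler_normB (Q + d n * E n) (d n * E n); rewrite addrK.
rewrite [`|d n * E n|]normrM (ger0_norm (dn _ mn)).
by have := hE n; have := dn _ mn; nra.
Qed.

End fejer.

(* [field] unfolds [pi], so it is generalized first. *)
Ltac pifield :=
  match goal with |- context [@pi ?R] =>
    generalize (lt0r_neq0 (pi_gt0 R)); generalize (@pi R) end;
  let p := fresh in let hp := fresh in intros p hp; field;
  repeat (apply/andP; split);
  first [exact: hp | apply: lt0r_neq0; first [assumption | by rewrite ltr0n]].

(** * The test functions *)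

Section testfun.
Context {R : realType}.
Variable alpha : R.
Hypothesis halpha : 0 < alpha < 1 / 2.
Implicit Types (x y z th : R) (i j k m n N J : nat).

Let a0 : 0 < alpha. Proof. by case/andP: halpha. Qed.
Let a2 : 2 * alpha < 1.
Proof. by case/andP: halpha => _; lra. Qed.

Definition lam k : R := (2 * pi * k%:R) `^ (2 * alpha).

Lemma lam_ge0 k : 0 <= lam k. Proof. exact: powR_ge0. Qed.

Lemma le_lam m n : (m <= n)%N -> lam m <= lam n.
Proof.
move=> mn; apply: ge0_ler_powR; rewrite ?nnegrE ?mulr_ge0 ?pi_ge0//.
  by rewrite ltW.
by rewrite ler_pM2l ?pi2_gt0// ler_nat.
Qed.

(** Mean value theorem for x^(2 alpha). The intermediate point is at most 2 pi (k + 1) <= 4 pi k,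
    which turns the factor 2 alpha into alpha. *)
Lemma lam_step k : (0 < k)%N -> alpha * (lam k / k%:R) <= lam k.+1 - lam k.
Proof.
move=> k0; have p0 := pi2k_gt0 (R:=R) k0.
have k0' : 0 < k%:R :> R by rewrite ltr0n.
have k1' : 1 <= k%:R :> R by rewrite ler1n.
pose u : R := 2 * pi * k%:R; pose v : R := 2 * pi * k.+1%:R.
have uv : u <= v by rewrite /u /v ler_pM2l ?pi2_gt0// ler_nat.
have [] := @MVT_segment R (fun x => x `^ (2 * alpha)) (fun x => 2 * alpha * x `^ (2 * alpha - 1)) u v uv.
- move=> x; rewrite in_itv /= => /andP[ux xv]; apply: is_derive1_powR.
  exact: lt_trans ux.
- apply: derivable_within_continuous => x; rewrite in_itv /= => /andP[ux xv].
  by case: (@is_derive1_powR R (2 * alpha) x (lt_le_trans p0 ux)).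
move=> c; rewrite in_itv /= => /andP[uc cv].
rewrite -/(lam k) -/(lam k.+1) => ->.
have c0 : 0 < c by exact: lt_le_trans uc.
rewrite powRB; last by rewrite (gt_eqF c0) implybT.
rewrite powRr1 ?(ltW c0)//.
have lk : lam k <= c `^ (2 * alpha).
  by apply: ge0_ler_powR; rewrite ?nnegrE ?(ltW c0) ?(ltW p0)// ltW// mulr_gt0.
have vu : v - u = 2 * pi by rewrite /u /v -natr1; ring.
rewrite vu.
have cle : c <= 2 * pi * (2 * k%:R).
  apply: (le_trans cv); rewrite /v -natr1; apply: ler_wpM2l.
    by rewrite mulr_ge0// pi_ge0.
  by move: k1'; lra.
have -> : 2 * alpha * (c `^ (2 * alpha) / c) * (2 * pi) = (2 * alpha * (2 * pi)) * (c `^ (2 * alpha) / c) by ring.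
have H : lam k / (2 * pi * (2 * k%:R)) <= c `^ (2 * alpha) / c.
  apply: ler_pM => //; first exact: lam_ge0.
    by rewrite invr_ge0 !mulr_ge0 ?pi_ge0.
  by rewrite lef_pV2 ?posrE// !mulr_gt0// pi_gt0.
have -> : alpha * (lam k / k%:R) = (2 * alpha * (2 * pi)) * (lam k / (2 * pi * (2 * k%:R))).
  by pifield.
by apply: ler_wpM2l => //; rewrite !mulr_ge0 ?pi_ge0// ltW.
Qed.

(** The discrete integral of x^(2 alpha - 1), made telescopic by [lam_step]. *)
Lemma sum_lam m : (0 < m)%N -> \sum_(1 <= k < m) lam k / k%:R <= lam m / alpha.
Proof.
move=> m0; rewrite ler_pdivlMr// mulrC mulr_sumr.
apply: (@le_trans _ _ (lam m - lam 1)); last by rewrite gerBl lam_ge0.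
rewrite -(telescope_sumr lam m0); apply: ler_sum_nat => k /andP[k0 _].
exact: lam_step.
Qed.

(** The ratio is the power 2 alpha - 1 < 0 of the frequency. This monotonicity is what Abel
    summation requires of [gco]. *)
Lemma lam_ratio k : (0 < k)%N -> lam k.+1 / (2 * pi * k.+1%:R) <= lam k / (2 * pi * k%:R).
Proof.
move=> k0; have p0 := pi2k_gt0 (R:=R) k0; have p1 := pi2k_gt0 (R:=R) (ltn0Sn k).
have E n : (0 < n)%N -> lam n / (2 * pi * n%:R) = ((2 * pi * n%:R) `^ (1 - 2 * alpha))^-1.
  move=> n0; have pn := pi2k_gt0 (R:=R) n0.
  rewrite -powRN opprB powRB; last by rewrite (gt_eqF pn) implybT.
  by rewrite powRr1// ltW.
rewrite !E// lef_pV2 ?posrE ?powR_gt0//.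
apply: ge0_ler_powR; rewrite ?nnegrE ?(ltW p0) ?(ltW p1)//.
  by rewrite subr_ge0 ltW.
by rewrite ler_pM2l ?pi2_gt0// ler_nat.
Qed.

(** Sine coefficients of (-Delta)^alpha applied to the periodic part of the primitive of [fejer n],
    that is, to a smoothed sawtooth. *)
Definition gco n k : R := fcoef n k / (2 * pi * k%:R) * lam k.

Lemma fcoef_ge0 n k : 0 <= fcoef n k :> R.
Proof. by rewrite /fcoef mulr_ge0// divr_ge0. Qed.

Lemma fcoef_le2 n k : fcoef n k <= 2 :> R.
Proof.
rewrite /fcoef ler_piMr//; have [->|n0] := posnP n.
  by rewrite sub0n mul0r.
by rewrite ler_pdivrMr ?ltr0n// mul1r ler_nat leq_subr.
Qed.

Lemma fcoef_antitone n k : fcoef n k.+1 <= fcoef n k :> R.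
Proof. by rewrite /fcoef ler_wpM2l// ler_wpM2r// ler_nat leq_sub2l. Qed.

Lemma gco_ge0 n k : 0 <= gco n k.
Proof. by rewrite /gco mulr_ge0 ?lam_ge0// divr_ge0 ?fcoef_ge0// !mulr_ge0// pi_ge0. Qed.

Lemma gco_le n k : (0 < k)%N -> gco n k <= lam k / k%:R.
Proof.
move=> k0; have k0' : 0 < k%:R :> R by rewrite ltr0n.
rewrite /gco mulrAC mulrC [lam k / _]mulrC.
have -> : (2 * pi * k%:R : R)^-1 * (fcoef n k * lam k) = (fcoef n k / (2 * pi)) * (k%:R^-1 * lam k).
  by pifield.
apply: ler_piMl; first by rewrite mulr_ge0 ?lam_ge0.
rewrite ler_pdivrMr ?pi2_gt0//.
by have := fcoef_le2 n k; have := @pi_ge2 R; lra.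
Qed.

Lemma gco_antitone n k : (0 < k)%N -> gco n k.+1 <= gco n k.
Proof.
move=> k0.
have E m : gco n m = fcoef n m * (lam m / (2 * pi * m%:R)) by rewrite /gco mulrAC mulrA.
rewrite !E.
apply: ler_pM; rewrite ?fcoef_ge0 ?fcoef_antitone ?lam_ratio//.
by rewrite divr_ge0 ?lam_ge0// !mulr_ge0// pi_ge0.
Qed.

Definition gsum n z : R := ssum (gco n) n (- (pi / 2)) z.

Lemma gsum_head n m z : (0 < m)%N -> \sum_(1 <= k < m) `|gco n k| <= lam m / alpha.
Proof.
move=> m0; apply: le_trans (sum_lam m0); apply: ler_sum_nat.
by move=> k /andP[k0 _]; rewrite ger0_norm ?gco_ge0// gco_le.
Qed.

Lemma gsum_near n z : (0 < n)%N -> `|gsum n z| <= lam n / alpha.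
Proof. by move=> n0; apply: le_trans (gsum_head n z n0); exact: ssum_abs. Qed.

(** In [gsum_far], [alpha^-1] pays for the low frequencies and 32 for the oscillating tail. *)
Definition Kg : R := alpha^-1 + 32.

(** This is the decay |z|^(-2 alpha), with [m] of the order of 1 / |z|. Frequencies below [m] are
    summed in absolute value by [sum_lam]; above [m], Abel summation leaves one coefficient divided
    by [sin (pi * z)], which is at least [(32 * m)^-1] in absolute value. *)
Lemma gsum_far n m z : (0 < n)%N -> (0 < m)%N -> `|z| <= 2^-1 -> (16 * m%:R)^-1 <= `|z| ->
  `|gsum n z| <= Kg * lam m.
Proof.
move=> n0 m0 z2 zm; rewrite /Kg mulrDl [alpha^-1 * _]mulrC.
have [nm|mn] := leqP n m.
  apply: (le_trans (gsum_near z n0)).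
  apply: (@le_trans _ _ (lam m / alpha)).
    by rewrite ler_wpM2r ?le_lam// invr_ge0 ltW.
  by rewrite lerDl mulr_ge0 ?lam_ge0.
rewrite /gsum /ssum (big_cat_nat (n := m)) ?(ltnW mn)//=.
apply: (le_trans (ler_normD _ _)); apply: lerD.
  exact: le_trans (ssum_abs _ _ _ _) (gsum_head n z m0).
set T := \sum_(_ <= _ < _) _.
have m0' : 0 < m%:R :> R by rewrite ltr0n.
(* [2 * sin (pi * z) * sin (2 * pi * k * z)] is [E k - E k.+1]. *)
pose E k : R := cos ((2 * k%:R - 1) * pi * z).
have ET : 2 * sin (pi * z) * T = \sum_(m <= k < n) gco n k * (E k - E k.+1).
  rewrite /T mulr_sumr; apply: eq_bigr => k _.
  rewrite mulrCA; congr (_ * _); rewrite /wave /E cosBpihalf.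
  set u := 2 * pi * k%:R * z; set v := pi * z.
  have -> : (2 * k%:R - 1) * pi * z = u - v by rewrite /u /v; ring.
  have -> : (2 * k.+1%:R - 1) * pi * z = u + v by rewrite /u /v -natr1; ring.
  rewrite (cosB u v) (cosD u v); ring.
have H : `|2 * sin (pi * z) * T| <= 2 * gco n m.
  rewrite ET; apply: abel (ltnW mn) _ (gco_ge0 _ _) _.
    by move=> k mk; rewrite gco_ge0 gco_antitone// (leq_trans m0).
  by move=> k; rewrite ler_norml cos_geN1 cos_le1.
have hs := abs_sin_pi_ge z2.
have hs' : (32 * m%:R)^-1 <= `|sin (pi * z)|.
  apply: le_trans hs; rewrite (_ : (32 * m%:R)^-1 = (16 * m%:R)^-1 / 2).
    by rewrite ler_wpM2r.
  by field; exact: lt0r_neq0.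
move: H; rewrite !normrM ger0_norm// -mulrA ler_pM2l// => H.
have H2 : (32 * m%:R)^-1 * `|T| <= lam m / m%:R.
  apply: le_trans (gco_le n m0); apply: le_trans H; exact: ler_wpM2r.
move: H2; rewrite ler_pdivrMl ?mulr_gt0//.
by rewrite -mulrA [m%:R * _]mulrC divfK// gt_eqF.
Qed.

(* [2 ^ j * theta ^ j] grows like [lam (2 ^ j)], which is the size of the
   multiplier on the frequencies of [fejer (2 ^ j)]. *)
Definition theta : R := 2 `^ (2 * alpha - 1).

Lemma theta_gt0 : 0 < theta. Proof. by rewrite powR_gt0. Qed.

Lemma theta_lt1 : theta < 1.
Proof.
rewrite /theta -[ltRHS](powRr0 2) /powR !gt_eqF// ltr_expR mul0r.
by rewrite pmulr_llt0 ?subr_lt0// ln_gt0// ltr1n.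
Qed.

Lemma lam_dyadic i : lam (2 ^ i) = lam 1 * (2 * theta) ^+ i.
Proof.
have E : 2 * theta = 2 `^ (2 * alpha).
  rewrite /theta powRB ?powRr1 ?pnatr_eq0 ?implybT//.
  by rewrite mulrC divfK.
rewrite E; elim: i => [|i IH]; first by rewrite expn0 expr0 mulr1.
rewrite exprSr mulrA -IH /lam -powRM//; last by rewrite !mulr_ge0// pi_ge0.
by rewrite expnSr natrM mulrA.
Qed.

Definition psi J z : R := \sum_(j < J.+1) theta ^+ j * fejer (2 ^ j) z.

Definition mass J : R := \sum_(j < J.+1) theta ^+ j.

Lemma psi_term J j z : (j <= J)%N -> theta ^+ j * fejer (2 ^ j) z <= psi J z.
Proof.
rewrite -ltnS => jJ; rewrite /psi (bigD1 (Ordinal jJ))//= lerDl.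
apply: sumr_ge0 => k _; rewrite mulr_ge0 ?fejer_ge0 ?expn_gt0//.
by rewrite exprn_ge0// ltW// theta_gt0.
Qed.

Lemma psi_ge1 J z : 1 <= psi J z.
Proof. by have := @psi_term J 0 z (leq0n _); rewrite expn0 fejer1 expr0 mulr1. Qed.

Lemma mass_ge1 J : 1 <= mass J.
Proof.
rewrite /mass big_ord_recl expr0 lerDl; apply: sumr_ge0 => i _.
by rewrite exprn_ge0// ltW// theta_gt0.
Qed.

Lemma mass_le J : mass J <= (1 - theta)^-1.
Proof.
rewrite -[leRHS]mul1r ler_pdivlMr ?subr_gt0 ?theta_lt1// mulrC /mass.
rewrite -opprB mulNr -subrX1 opprB gerBl.
by rewrite exprn_ge0// ltW// theta_gt0.
Qed.

Lemma fejer_periodic n : periodic (fejer n : R -> R) 1.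
Proof. by move=> z; rewrite /fejer ssum_periodic. Qed.

Lemma psi_periodic J : periodic (psi J) 1.
Proof. by move=> z; apply: eq_bigr => j _; rewrite fejer_periodic. Qed.

Lemma periodic_reduce z : exists2 w : R, `|w| <= 2^-1 &
  forall f : R -> R, periodic f 1 -> f z = f w.
Proof.
have P (f : R -> R) (m : int) (u : R) : periodic f 1 -> f (u + m%:~R) = f u.
  move=> pf; case: m => n.
    have := periodicn pf n u; by rewrite -pmulrn.
  have := periodicn pf n.+1 (u - n.+1%:R).
  by rewrite subrK NegzE mulrNz -pmulrn => ->.
pose m := Num.floor (z + 2^-1).
exists (z - m%:~R) => [|f pf]; last by rewrite -(P f m (z - m%:~R) pf) subrK.
have /andP[h1 h2] := real_floor_itv (num_real (z + 2^-1)).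
rewrite -/m in h1 h2; rewrite intrD in h2.
by rewrite ler_norml; move: h1 h2; lra.
Qed.

(** The factor 4 is lost in [psi_near], and [lam 1] is the prefactor of [lam_dyadic]. *)
Definition Kpsi : R := 4 * Kg * lam 1.

Lemma Kg_gt0 : 0 < Kg. Proof. by rewrite addr_gt0 ?invr_gt0. Qed.

Lemma psi_near J i z : (i <= J)%N -> `|z| <= (8 * (2 ^ i)%:R)^-1 ->
  (2 * theta) ^+ i / 4 <= psi J z.
Proof.
move=> iJ hz; apply: le_trans (psi_term z iJ).
have := fejer_near (R:=R) (expn_gt0 2 i) hz; rewrite natrX => h.
have -> : (2 * theta) ^+ i / 4 = theta ^+ i * (2 ^+ i / 4) by rewrite exprMn; ring.
by rewrite ler_wpM2l// exprn_ge0// ltW// theta_gt0.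
Qed.

Lemma dyadic_scale J (r : R) : r <= (8 * (2 ^ J)%:R)^-1 \/ 8^-1 < r \/
  exists2 i, (i < J)%N & (8 * (2 ^ i.+1)%:R)^-1 < r <= (8 * (2 ^ i)%:R)^-1.
Proof.
elim: J => [|J [IH|[IH|[i iJ hi]]]].
- by rewrite expn0 mulr1; case: (leP r 8^-1); auto.
- have [h|h] := leP r (8 * (2 ^ J.+1)%:R)^-1; first by left.
  by right; right; exists J => //; rewrite h IH.
- by right; left.
- by right; right; exists i => //; exact: ltnW.
Qed.

(** If [|z|] lies between consecutive scales near [2 ^- i / 8], the left side is of order
    [lam (2 ^ i)], and the single term [j = i] of [psi] already has this height. Below the smallest
    scale the order [n <= 2 ^ J] bounds the left side; above 1/8, [psi >= 1] suffices. *)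
Lemma gsum_le_psi J n z : (0 < n)%N -> (n <= 2 ^ J)%N -> `|gsum n z| <= Kpsi * psi J z.
Proof.
move=> n0 nJ; have [w hw per] := periodic_reduce z.
have -> : gsum n z = gsum n w by apply: per => x; rewrite /gsum ssum_periodic.
rewrite (per _ (@psi_periodic J)).
have K0 := ltW Kg_gt0; have l0 := lam_ge0 1.
have D i : (i <= J)%N -> `|w| <= (8 * (2 ^ i)%:R)^-1 -> Kg * lam (2 ^ i) <= Kpsi * psi J w.
  move=> iJ h; have := psi_near iJ h; rewrite lam_dyadic /Kpsi => h1.
  have -> : Kg * (lam 1 * (2 * theta) ^+ i) = 4 * Kg * lam 1 * ((2 * theta) ^+ i / 4) by field.
  by rewrite ler_wpM2l// !mulr_ge0.
have [h|[h|[i iJ /andP[h1 h2]]]] := dyadic_scale J `|w|.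
- apply: le_trans (D J (leqnn _) h).
  apply: (le_trans (gsum_near w n0)).
  apply: (@le_trans _ _ (lam (2 ^ J) / alpha)).
    by rewrite ler_wpM2r ?le_lam// invr_ge0 ltW.
  by rewrite mulrC ler_wpM2r ?lam_ge0// /Kg lerDl.
- apply: (le_trans (gsum_far n0 (ltnSn 0) hw _)).
    by rewrite mulr1; apply: le_trans (ltW h); lra.
  have := psi_ge1 J w; rewrite /Kpsi; move: (mulr_ge0 K0 l0).
  rewrite (_ : 4 * Kg * lam 1 = 4 * (Kg * lam 1)); last ring.
  by set X := Kg * _; set Y := psi _ _; clear; nra.
- apply: le_trans (D i (ltnW iJ) h2).
  apply: gsum_far => //; first by rewrite expn_gt0.
  apply: le_trans (ltW h1); rewrite expnS natrM.
  by rewrite mulrA; have -> : 16 = 8 * 2 :> R by ring.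
Qed.

Lemma ssum_lin J (f : nat -> R) (g : nat -> nat -> R) N th z :
  ssum (fun k => \sum_(j < J.+1) theta ^+ j * (f k - g j k)) N th z =
  \sum_(j < J.+1) theta ^+ j * (ssum f N th z - ssum (g j) N th z).
Proof.
rewrite /ssum.
under eq_bigr => k _ do rewrite mulr_suml.
rewrite exchange_big /=; apply: eq_bigr => j _.
rewrite -sumrB mulr_sumr; apply: eq_bigr => k _; ring.
Qed.

Definition hco n k : R := fcoef n k / (2 * pi * k%:R).

(** Coefficients of the weighted differences of primitives of Fejer kernels. The linear parts of the
    two primitives cancel in each difference, so the result is periodic. *)
Definition pco J k : R := \sum_(j < J.+1) theta ^+ j * (hco (2 ^ J) k - hco (2 ^ j) k).

Definition phi J z : R := ssum (pco J) (2 ^ J) (- (pi / 2)) z.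

Definition dphi J z : R := mass J * fejer (2 ^ J) z - psi J z.

Definition lphi J z : R := \sum_(j < J.+1) theta ^+ j * (gsum (2 ^ J) z - gsum (2 ^ j) z).

Lemma pow_le_ord J (j : 'I_J.+1) : (2 ^ j <= 2 ^ J)%N.
Proof. by rewrite leq_exp2l// -ltnS ltn_ord. Qed.

Lemma phi_dterm J y x :
  tp (map dterm (ts (pco J) (2 ^ J) (- (pi / 2)) y)) x = dphi J (x - y).
Proof.
rewrite dterm_ts tp_ts addNr /dphi /psi /mass mulr_suml -sumrB.
transitivity (ssum (fun k => \sum_(j < J.+1) theta ^+ j * (fcoef (2 ^ J) k - fcoef (2 ^ j) k)) (2 ^ J) 0 (x - y)).
  apply: eq_ssum => k /andP[k0 _]; rewrite /pco mulr_suml; apply: eq_bigr => j _.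
  by rewrite /hco; pifield.
rewrite (ssum_lin J (fcoef (2 ^ J)) (fun j => fcoef (2 ^ j))); apply: eq_bigr => j _.
rewrite [fejer (2 ^ j) _](fejer_widen _ (pow_le_ord j)) /fejer; ring.
Qed.

Lemma phi_lterm J y x :
  tp (map (lterm alpha) (ts (pco J) (2 ^ J) (- (pi / 2)) y)) x = lphi J (x - y).
Proof.
rewrite lterm_ts tp_ts /lphi.
transitivity (ssum (fun k => \sum_(j < J.+1) theta ^+ j * (gco (2 ^ J) k - gco (2 ^ j) k)) (2 ^ J) (- (pi / 2)) (x - y)).
  apply: eq_ssum => k /andP[k0 _]; rewrite /pco mulr_suml; apply: eq_bigr => j _.
  by rewrite /hco /gco /lam; ring.
rewrite (ssum_lin J (gco (2 ^ J)) (fun j => gco (2 ^ j))); apply: eq_bigr => j _.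
rewrite /gsum (@ssum_widen _ (gco (2 ^ j)) _ _ _ _ (pow_le_ord j))// => k h.
by rewrite /gco fcoef_ge// !mul0r.
Qed.

Lemma lphi_le J z : `|lphi J z| <= 2 * mass J * Kpsi * psi J z.
Proof.
apply: (le_trans (ler_norm_sum _ _ _)).
have -> : 2 * mass J * Kpsi * psi J z = \sum_(j < J.+1) theta ^+ j * (2 * Kpsi * psi J z).
  by rewrite -mulr_suml -/(mass J); ring.
apply: ler_sum => j _; have t0 := exprn_ge0 j (ltW theta_gt0).
rewrite normrM (ger0_norm t0) ler_wpM2l//.
apply: (le_trans (ler_normB _ _)).
have h1 := gsum_le_psi z (expn_gt0 2 J) (leqnn _).
have h2 := gsum_le_psi z (expn_gt0 2 j) (pow_le_ord j).
by move: h1 h2; lra.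
Qed.

(* The primitive of [fejer n] vanishing at 0; it increases from 0 to 1 on a
   period, which is what bounds [phi]. *)
Definition Fprim n z : R := z + ssum (hco n) n (- (pi / 2)) z.

Lemma Fprim_deriv n z : is_derive z 1 (Fprim n) (fejer n z).
Proof. exact: fejer_deriv. Qed.

Lemma Fprim0 n : Fprim n 0 = 0.
Proof.
rewrite /Fprim add0r /ssum big1// => k _.
by rewrite /wave mulr0 cosBpihalf sin0 mulr0.
Qed.

Lemma FprimD1 n z : Fprim n (z + 1) = Fprim n z + 1.
Proof. by rewrite /Fprim ssum_periodic addrAC. Qed.

Lemma Fprim_homo n : (0 < n)%N -> {homo Fprim n : x y / x <= y}.
Proof.
move=> n0 x y xy.
have [c _ E] := MVT_segment xy (fun z _ => Fprim_deriv n z)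
  (continuous_subspaceT (derive_continuous (Fprim_deriv n))).
by rewrite -subr_ge0 E mulr_ge0 ?fejer_ge0// subr_ge0.
Qed.

Lemma phi_le J z : `|phi J z| <= mass J.
Proof.
have [w hw per] := periodic_reduce (z - 2^-1).
pose u := w + 2^-1.
have -> : phi J z = phi J u.
  have := per (fun x => phi J (x + 2^-1)); rewrite subrK; apply.
  by move=> x; rewrite addrAC /phi ssum_periodic.
have u01 : 0 <= u <= 1 by move: hw; rewrite ler_norml /u; lra.
have H n : (0 < n)%N -> 0 <= Fprim n u <= 1.
  move=> n0; case/andP: u01 => u0 u1.
  rewrite -{1}(Fprim0 n) Fprim_homo//=.
  by rewrite -[X in _ <= X]add0r -{1}(Fprim0 n) -FprimD1 add0r Fprim_homo.
have -> : phi J u = \sum_(j < J.+1) theta ^+ j * (Fprim (2 ^ J) u - Fprim (2 ^ j) u).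
  rewrite /phi (ssum_lin J (hco (2 ^ J)) (fun j => hco (2 ^ j))); apply: eq_bigr => j _.
  rewrite /Fprim (@ssum_widen _ (hco (2 ^ j)) _ _ _ _ (pow_le_ord j)); first ring.
  by move=> k h; rewrite /hco fcoef_ge// mul0r.
apply: (le_trans (ler_norm_sum _ _ _)); apply: ler_sum => j _.
have t0 := exprn_ge0 j (ltW theta_gt0).
rewrite normrM (ger0_norm t0) ler_piMr//.
have := H _ (expn_gt0 2 J); have := H _ (expn_gt0 2 j).
by rewrite ler_norml; lra.
Qed.

Lemma I01_psi J y : I01 (fun x => psi J (x - y)) = mass J.
Proof.
rewrite /psi I01_sum; last by move=> j; exact/ok01Z/ok01_fejer.
apply: eq_bigr => j _; rewrite I01Z; last exact: ok01_fejer.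
by rewrite I01_fejer mulr1.
Qed.

(** Keeps the initial pairing with A sin(2 pi x) large uniformly in [J]. All terms are nonnegative,
    and [j = 0] alone gives (1 - 2^-J) / pi. *)
Lemma pco1 J : (0 < J)%N -> (2 * pi)^-1 <= pco J 1.
Proof.
move=> J0.
have F1 n : (0 < n)%N -> hco n 1 = (1 - n%:R^-1) / pi.
  move=> n0; rewrite /hco /fcoef natrB// mulr1.
  by pifield.
have dj (j : 'I_J.+1) : 0 <= theta ^+ j * (hco (2 ^ J) 1 - hco (2 ^ j) 1).
  rewrite mulr_ge0 ?exprn_ge0 ?(ltW theta_gt0)//.
  rewrite !F1 ?expn_gt0// -mulrBl divr_ge0 ?pi_ge0//.
  have : ((2 ^ J)%:R)^-1 <= ((2 ^ j)%:R)^-1 :> R.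
    by rewrite lef_pV2 ?posrE ?ltr0n ?expn_gt0// ler_nat pow_le_ord.
  by lra.
rewrite /pco big_ord_recl expr0 mul1r.
apply: (@le_trans _ _ (hco (2 ^ J) 1 - hco (2 ^ 0) 1)); last first.
  by rewrite lerDl; apply: sumr_ge0 => i _; exact: (dj (lift ord0 i)).
rewrite !F1 ?expn_gt0// expn0 invr1 subrr mul0r subr0 invfM mulrC.
rewrite [leRHS]mulrC ler_wpM2l ?invr_ge0 ?pi_ge0//.
have : ((2 ^ J)%:R)^-1 <= 2^-1 :> R.
  rewrite lef_pV2 ?posrE ?ltr0n ?expn_gt0// ler_nat.
  by rewrite -{1}(expn1 2) leq_exp2l.
by lra.
Qed.

End testfun.

(** * Normally convergent series *)

Section normal_series.
Context {R : realType}.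
Implicit Types (u M : R^nat) (f : nat -> R -> R) (x y : R).

Definition summable_seq M := cvgn (series M).

Definition rest M n : R := limn (series M) - series M n.

Lemma summable_ge0_rest M : (forall k, 0 <= M k) -> summable_seq M ->
  forall n, 0 <= rest M n.
Proof.
move=> M0 cM n; rewrite subr_ge0; apply: nondecreasing_cvgn_le => //.
by apply: nondecreasing_series => k _ _.
Qed.

Lemma rest_cvg0 M : summable_seq M -> rest M @ \oo --> 0.
Proof.
move=> cM; rewrite -[0](subrr (limn (series M))).
by apply: cvgB => //; exact: cvg_cst.
Qed.

Lemma normal_cvg u M : (forall k, `|u k| <= M k) -> summable_seq M -> summable_seq u.
Proof.
move=> uM cM; apply: normed_cvg.
apply: (series_le_cvg _ _ _ cM) => k /=; [exact: normr_ge0 | | exact: uM].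
exact: le_trans (normr_ge0 _) (uM k).
Qed.

Lemma normal_rest u M : (forall k, `|u k| <= M k) -> summable_seq M ->
  forall n, `|rest u n| <= rest M n.
Proof.
move=> uM cM n; have cu := normal_cvg uM cM.
have H m : (n <= m)%N -> `|series u m - series u n| <= series M m - series M n.
  move=> nm; rewrite !sub_series_geq// .
  by apply: (le_trans (ler_norm_sum _ _ _)); apply: ler_sum.
have c1 : (fun m => `|series u m - series u n|) @ \oo --> `|rest u n|.
  by apply: cvg_norm; apply: cvgB => //; exact: cvg_cst.
have c2 : (fun m => series M m - series M n) @ \oo --> rest M n.
  by apply: cvgB => //; exact: cvg_cst.
apply: ler_cvg_to c1 c2 _.
by exists n => // m /= /H.
Qed.

Lemma normal_bound u M : (forall k, `|u k| <= M k) -> summable_seq M ->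
  `|limn (series u)| <= limn (series M).
Proof.
move=> uM cM; have := normal_rest uM cM 0.
by rewrite /rest /series /= !big_geq// !subr0.
Qed.

Lemma lim_series_unique u (l : R) : series u @ \oo --> l -> limn (series u) = l.
Proof. by move=> h; apply: cvg_lim. Qed.

Definition nser f x : R := limn (series (fun k => f k x)).

Lemma nser_cont f M : (forall k x, `|f k x| <= M k) -> summable_seq M ->
  (forall k, continuous (f k)) -> continuous (nser f).
Proof.
move=> fM cM cf x; apply/cvgrPdist_le => e e0.
have /cvgrPdist_le/(_ (e / 3)) := rest_cvg0 cM.
rewrite divr_gt0// => /(_ isT) [n _ /(_ n (leqnn n))].
rewrite /= sub0r normrN => hn.
have cS : continuous (fun y => series (fun k => f k y) n).
  elim: n {hn} => [|n IH].
    rewrite (_ : (fun y => _) = cst 0); first by move=> y; exact: cvg_cst.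
    by apply/funext => y; rewrite /series /= big_geq.
  rewrite (_ : (fun y => _) = (fun y => series (fun k => f k y) n + f n y)).
    by move=> y; apply: cvgD; [exact: IH | exact: cf].
  by apply/funext => y; rewrite seriesSr.
have := cS x => /cvgrPdist_le/(_ (e / 3)); rewrite divr_gt0// => /(_ isT).
apply: filterS => y hy.
have B z : `|nser f z - series (fun k => f k z) n| <= e / 3.
  apply: le_trans hn; apply: le_trans (ler_norm _).
  exact: (normal_rest (fM^~ z) cM).
move: (B x) (B y).
by move: hy; rewrite !ler_norml; lra.
Qed.

Lemma nser_deriv f (f1 : nat -> R -> R) M M1 M2 :
  (forall k x y, `|f k y - f k x - (y - x) * f1 k x| <= M2 k * (y - x) ^+ 2) ->
  (forall k x, `|f k x| <= M k) -> (forall k x, `|f1 k x| <= M1 k) ->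
  summable_seq M -> summable_seq M1 -> summable_seq M2 ->
  forall x, is_derive x 1 (nser f) (nser f1 x).
Proof.
move=> q fM f1M cM cM1 cM2 x.
apply: (@is_derive_quad _ _ _ _ (limn (series M2))) => y.
have c0 z : series (fun k => f k z) @ \oo --> nser f z by exact: (normal_cvg (fM^~ z) cM).
have c1 : series (fun k => f1 k x) @ \oo --> nser f1 x by exact: (normal_cvg (f1M^~ x) cM1).
have L : (fun n => `|series (fun k => f k y) n - series (fun k => f k x) n - (y - x) * series (fun k => f1 k x) n|) @ \oo
   --> `|nser f y - nser f x - (y - x) * nser f1 x|.
  apply: cvg_norm; apply: cvgB; first by apply: cvgB; exact: c0.
  by apply: cvgM => //; exact: cvg_cst.
have L2 : (fun n => series M2 n * (y - x) ^+ 2) @ \oo --> limn (series M2) * (y - x) ^+ 2.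
  by apply: cvgM => //; exact: cvg_cst.
apply: ler_cvg_to L L2 _; apply: nearW => n.
rewrite /series /= mulr_sumr -!sumrB mulr_suml.
by apply: (le_trans (ler_norm_sum _ _ _)); apply: ler_sum => k _; exact: q.
Qed.

Lemma nser_I01 f M (g : R -> R) : (forall k x, `|f k x| <= M k) -> summable_seq M ->
  (forall k, continuous (f k)) -> continuous g ->
  series (fun k => I01 (fun x => f k x * g x)) @ \oo --> I01 (fun x => nser f x * g x).
Proof.
move=> fM cM cf cg.
have [C hC] := cont_bounded01 cg.
have cn := nser_cont fM cM cf.
have okk k : ok01 (fun x => f k x * g x) by apply: ok01M_cont => //; exact: ok01_cont.
rewrite (_ : series _ = (fun n => I01 (fun x => series (fun k => f k x) n * g x))); last first.
  apply/funext => n; rewrite /series /= -I01_sum//; apply: eq_I01 => x _.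
  by rewrite mulr_suml.
apply: (@I01_lim _ _ _ (fun n => rest M n * C)).
- move=> n; apply: (@ok01_ext _ (fun x => \sum_(0 <= k < n) f k x * g x)).
    by move=> x; rewrite /series /= mulr_suml.
  exact: ok01_sum.
- by apply: ok01M_cont => //; exact: ok01_cont.
- move=> n x hx; rewrite -mulrBl normrM; apply: ler_pM => //; last exact: hC.
  by rewrite distrC; exact: (normal_rest (fM^~ x) cM).
- by rewrite -[0](mul0r C); apply: cvgM; [exact: rest_cvg0 | exact: cvg_cst].
Qed.

End normal_series.

(** * Uniqueness of Fourier coefficients *)

Section fourier_uniqueness.
Context {R : realType}.
Implicit Types (f : R -> R) (x z c : R).

Lemma Fprim_half n : Fprim n 2^-1 = 2^-1 :> R.
Proof.
rewrite /Fprim /ssum big1 ?addr0// => k _.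
have -> : wave k (- (pi / 2)) 2^-1 = sin (pi *+ k) :> R.
  rewrite /wave cosBpihalf; congr sin; rewrite -[RHS]mulr_natr.
  by field.
have -> : sin (pi *+ k) = 0 :> R.
  elim: k => [|k IH]; first by rewrite mulr0n sin0.
  by rewrite mulrSr sinD IH sinpi mul0r mulr0 addr0.
by rewrite mulr0.
Qed.

Lemma fejer_interior n z (d : R) : (0 < n)%N -> 0 < d -> d <= z <= 1 - d ->
  fejer n z <= (d / 2) ^- 2 / n%:R.
Proof.
move=> n0 d0 dz.
have H : d / 2 <= `|sin (pi * z)|.
  have [z2|z2] := leP z 2^-1.
    have z0 : 0 <= z by move: dz d0; clear; lra.
    apply: le_trans (abs_sin_pi_ge _); rewrite ger0_norm//; move: dz; clear; lra.
  have -> : `|sin (pi * z)| = `|sin (pi * (z - 1))|.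
    rewrite mulrBr mulr1 -[pi * z in LHS](subrK pi) sinD cospi sinpi mulr0 addr0.
    by rewrite mulrN1 normrN.
  have h : z - 1 <= 0 by move: dz d0; clear; lra.
  by apply: le_trans (abs_sin_pi_ge _); rewrite ler0_norm//; move: dz z2; clear; lra.
have h := fejer_tail z n0.
have H2 : (d / 2) ^+ 2 <= sin (pi * z) ^+ 2.
  by rewrite -(real_normK (num_real (sin (pi * z)))) lerXn2r// nnegrE ltW// divr_gt0.
have F0 := fejer_ge0 z n0.
rewrite mulrC ler_pdivlMr ?exprn_gt0 ?divr_gt0//.
by apply: le_trans h; rewrite ler_wpM2l.
Qed.

(** The kernels tend to 0 uniformly away from the integers, so the primitives flatten inside the
    period, and their value at 1/2 is fixed by [Fprim_half]. *)
Lemma Fprim_cvg z : 0 < z < 1 -> (fun n => Fprim n.+1 z) @ \oo --> (2^-1 : R).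
Proof.
move=> /andP[z0 z1].
pose d := Num.min z (1 - z).
have d0 : 0 < d by rewrite lt_min z0 subr_gt0.
have dz : d <= z <= 1 - d.
  have h1 : d <= z by rewrite ge_min lexx.
  have h2 : d <= 1 - z by rewrite ge_min lexx orbT.
  by rewrite h1/=; move: h2; clear; lra.
have d2 : d <= 2^-1 <= 1 - d by move: dz; clear; lra.
have B n : `|Fprim n.+1 z - 2^-1| <= (d / 2) ^- 2 * n.+1%:R^-1.
  have key u v : u <= v -> d <= u -> v <= 1 - d ->
      `|Fprim n.+1 v - Fprim n.+1 u| <= (d / 2) ^- 2 * n.+1%:R^-1.
    move=> uv du vd.
    have [c] := MVT_segment uv (fun z _ => Fprim_deriv n.+1 z)
      (continuous_subspaceT (derive_continuous (Fprim_deriv n.+1))).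
    rewrite in_itv /= => /andP[uc cv] ->.
    have hc : fejer n.+1 c <= (d / 2) ^- 2 / n.+1%:R.
      by apply: fejer_interior => //; rewrite (le_trans du uc) (le_trans cv vd).
    have c0 := fejer_ge0 c (ltn0Sn n).
    rewrite normrM ger0_norm// ger0_norm ?subr_ge0//.
    apply: le_trans hc; apply: ler_piMr => //.
    by move: du vd d0; clear; lra.
  case/andP: dz => dz1 dz2; case/andP: d2 => d21 d22.
  rewrite -{1}(Fprim_half n.+1).
  have [h|h] := leP z 2^-1; first by rewrite distrC; exact: key.
  by apply: key => //; exact: ltW.
have L : (fun n => (d / 2) ^- 2 * n.+1%:R^-1) @ \oo --> (0 : R).
  rewrite -[0](mulr0 ((d / 2) ^- 2)); apply: cvgM; first exact: cvg_cst.
  exact: cvg_harmonic.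
apply/subr_cvg0; apply/norm_cvg0P.
apply: (squeeze_cvgr _ (cvg_cst 0) L).
by apply: nearW => n; rewrite normr_ge0 /= B.
Qed.

Lemma I01_tp_orth f s : ok01 f -> I01 f = 0 ->
  (forall k, (0 < k)%N -> fcos f k = 0 /\ fsin f k = 0) ->
  I01 (fun x => f x * tp s x) = 0.
Proof.
move=> okf f0 fk.
under eq_fun => x do rewrite /tp mulr_sumr.
rewrite I01_sum; last first.
  move=> p; apply: ok01M_cont => // x.
  by apply: cvgM; [exact: cvg_cst | exact: wave_cont].
rewrite big1// => p _.
have E x : f x * (p.1 * wave p.2.1 p.2.2 x) =
   p.1 * (cos p.2.2 * (f x * wave p.2.1 0 x) - sin p.2.2 * (f x * wave p.2.1 (- (pi / 2)) x)).
  by rewrite /wave addr0 cosBpihalf cosD; ring.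
rewrite (eq_I01 (fun x _ => E x)).
have okw a : ok01 (fun x => f x * wave p.2.1 a x) by apply: ok01M_cont => //; exact: wave_cont.
rewrite I01Z; last by apply: ok01B; exact: ok01Z.
rewrite I01B; [|exact: ok01Z|exact: ok01Z].
rewrite !I01Z//.
have [p0|p0] := posnP p.2.1.
  have W a : I01 (fun x => f x * wave p.2.1 a x) = 0.
    transitivity (I01 (fun x => cos a * f x)).
      by apply: eq_I01 => x _; rewrite p0 wave0 mulrC.
    by rewrite I01Z// f0 mulr0.
  by rewrite !W !mulr0 subrr mulr0.
by have [h1 h2] := fk _ p0; rewrite -fcosE -fsinE h1 h2 !mulr0 subrr mulr0.
Qed.

(** [T n] is the constant [c] plus a trigonometric polynomial, hence orthogonal to [f]; it is
    bounded by 2 and converges to the indicator of [0, c] except at 0, c and 1. Dominated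
    convergence concludes. *)
Lemma fourier_uniqueness_prim f c : ok01 f -> I01 f = 0 ->
  (forall k, (0 < k)%N -> fcos f k = 0 /\ fsin f k = 0) -> 0 < c < 1 ->
  \int[lebesgue_measure]_(x in `[0%R, c]) f x = 0.
Proof.
move=> okf f0 fk c01; have /andP[c0 c1] := c01.
pose T n x : R := Fprim n.+1 x - Fprim n.+1 (x - c).
pose s n := ts (hco n.+1) n.+1 (- (pi / 2)) 0 ++
     ts (fun k => - hco n.+1 k) n.+1 (- (pi / 2)) c.
have TE n x : T n x = c + tp (s n) x.
  rewrite /s tp_cat !tp_ts subr0 /T /Fprim.
  have -> : ssum (fun k => - hco n.+1 k) n.+1 (- (pi / 2)) (x - c) = - ssum (hco n.+1) n.+1 (- (pi / 2)) (x - c).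
    by rewrite /ssum -sumrN; apply: eq_bigr => k _; rewrite mulNr.
  by ring.
have cT n : continuous (T n).
  rewrite (_ : T n = (fun x => c + tp (s n) x)); last by apply/funext => x; exact: TE.
  by move=> x; apply: cvgD; [exact: cvg_cst | exact: tp_cont].
have IT n : I01 (fun x => f x * T n x) = 0.
  transitivity (I01 (fun x => c * f x + f x * tp (s n) x)).
    by apply: eq_I01 => x _; rewrite TE; ring.
  rewrite I01D; last 2 first.
    exact: ok01Z.
    by apply: ok01M_cont => //; exact: tp_cont.
  by rewrite I01Z// f0 mulr0 I01_tp_orth// addr0.
have bT n x : 0 <= x <= 1 -> `|T n x| <= 2.
  move=> /andP[x0 x1]; have H := Fprim_homo (ltn0Sn n).
  have h1 : 0 <= Fprim n.+1 x by rewrite -(Fprim0 n.+1); exact: H.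
  have h2 : Fprim n.+1 x <= 1.
    by rewrite -[leRHS]add0r -(Fprim0 n.+1) -FprimD1 add0r; exact: H.
  have h3 : Fprim n.+1 (x - c) <= 1.
    rewrite -[leRHS]add0r -(Fprim0 n.+1) -FprimD1 add0r; apply: H.
    by move: x1 c0; clear; lra.
  have h4 : -1 <= Fprim n.+1 (x - c).
    rewrite -[leLHS]add0r -(Fprim0 n.+1) -[0](subrK 1) sub0r FprimD1 addrK.
    by apply: H; move: x0 c1; clear; lra.
  by rewrite ler_norml /T; move: h1 h2 h3 h4; clear; lra.
have lT x : 0 <= x <= 1 -> x != 0 -> x != c -> x != 1 ->
   (fun n => T n x) @ \oo --> (if x <= c then 1 else 0 : R).
  move=> /andP[x0 x1] xn0 xnc xn1.
  have L1 : (fun n => Fprim n.+1 x) @ \oo --> (2^-1 : R).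
    by apply: Fprim_cvg; rewrite !lt_def xn0 x0 eq_sym xn1.
  case: leP => xc.
    have -> : 1 = 2^-1 - (2^-1 - 1) :> R by ring.
    apply: cvgB => //.
    rewrite (_ : (fun n => _) = (fun n => Fprim n.+1 (x - c + 1) - 1)).
      apply: cvgB; last exact: cvg_cst.
      apply: Fprim_cvg; have : x < c by rewrite lt_neqAle xnc.
      by move: x0 c1; clear; lra.
    by apply/funext => n; rewrite FprimD1 addrK.
  rewrite -[0](subrr 2^-1); apply: cvgB => //; apply: Fprim_cvg.
  by move: xc x1 c0; clear; lra.
have m01 : measurable (`[0%R, 1%R] : set (measurableTypeR R)) by exact: measurable_itv.
have mc : measurable (`[0%R, c] : set (measurableTypeR R)) by exact: measurable_itv.
have mf := ok01_mfun okf.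
have -> : \int[lebesgue_measure]_(x in `[0%R, c]) f x = I01 (f \_ `[0%R, c]).
  rewrite /I01 -Rintegral_mkcondr; congr (Rintegral _ _ _).
  apply/seteqP; split => x /=; rewrite !in_itv /=; last by case.
  by move=> /andP[h1 h2]; rewrite h1 h2 (le_trans h2 (ltW c1)).
have mfc : measurable_fun (`[0%R, 1%R] : set (measurableTypeR R)) (f \_ `[0%R, c]).
  apply/measurable_restrict => //.
  by apply: measurable_funS mf => // x [].
have Hm n : measurable_fun (`[0%R, 1%R] : set (measurableTypeR R)) (fun x => (f x * T n x)%:E).
  apply/measurable_EFinP; apply: ok01_mfun; apply: ok01M_cont => //; exact: cT.
have Hf : measurable_fun (`[0%R, 1%R] : set (measurableTypeR R)) (EFin \o (f \_ `[0%R, c])).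
  exact/measurable_EFinP.
have Hb : {ae lebesgue_measure, forall x n, `[0%R, 1%R]%classic x ->
    (`|(f x * T n x)%:E| <= (2 * `|f x|)%:E)%E}.
  apply: aeW => x n /=; rewrite in_itv /= => hx.
  by rewrite lee_fin normrM mulrC ler_wpM2r// bT.
have Hc : {ae lebesgue_measure, forall x, `[0%R, 1%R]%classic x ->
    (fun n => (f x * T n x)%:E) @ \oo --> (EFin \o (f \_ `[0%R, c])) x}.
  have n1 (z : R) : lebesgue_measure.-negligible ([set z] : set (measurableTypeR R)).
    by exists [set z]; split => //; exact: lebesgue_measure_set1.
  have N3 := negligibleU (n1 0) (negligibleU (n1 c) (n1 1)).
  apply: negligibleS N3 => x /= h; apply: contrapT => hx; apply: h; rewrite in_itv /= => x01.
  have [h1 h2 h3] : [/\ x != 0, x != c & x != 1].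
    by split; apply/eqP => E; apply: hx; [left|right; left|right; right].
  apply: cvg_EFin; first exact: nearW.
  rewrite /= patchE mem_setE in_itv /=; have /andP[-> _] /= := x01.
  have := lT x x01 h1 h2 h3.
  case: ifP => _ H.
    rewrite -[X in _ --> X]mulr1; apply: cvgM => //; exact: cvg_cst.
  rewrite -[X in _ --> X](mulr0 (f x)); apply: cvgM => //; exact: cvg_cst.
have [_ _ L] := @dominated_convergence _ _ R lebesgue_measure _ m01
   (fun n x => (f x * T n x)%:E) (EFin \o (f \_ `[0%R, c])) (fun x => (2 * `|f x|)%:E)
   Hm Hf Hc (ok01Z 2 (ok01_abs okf)) Hb.
rewrite /I01 /Rintegral.
suff -> : (\int[lebesgue_measure]_(x in `[0%R, 1%R]) ((f \_ `[0%R, c]) x)%:E = 0)%E by [].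
move: L; rewrite (_ : (fun n => _) = cst 0%E); last first.
  apply/funext => n /=.
  have okT : ok01 (fun x => f x * T n x) by apply: ok01M_cont => //; exact: cT.
  rewrite -[LHS]fineK ?integrable_fin_num//.
  by have := IT n; rewrite /I01 /Rintegral => ->.
by move=> /cvg_lim <- //; rewrite lim_cst.
Qed.

(** The primitive of [f] vanishes on (0, 1), and Lebesgue differentiation recovers [f] from it at
    almost every point. *)
Lemma fourier_uniqueness f : ok01 f -> I01 f = 0 ->
  (forall k, (0 < k)%N -> fcos f k = 0 /\ fsin f k = 0) ->
  {ae lebesgue_measure, forall x, 0 <= x <= 1 -> f x = 0}.
Proof.
move=> okf f0 fk.
pose fr := f \_ `[0%R, 1%R].
have m01 : measurable (`[0%R, 1%R] : set (measurableTypeR R)) by exact: measurable_itv.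
have locf : locally_integrable [set: R] fr by exact: integrable_locally_restrict.
have n1 (z : R) : lebesgue_measure.-negligible ([set z] : set (measurableTypeR R)).
  by exists [set z]; split => //; exact: lebesgue_measure_set1.
have N3 := negligibleU (lebesgue_differentiation locf) (negligibleU (n1 0) (n1 1)).
apply: negligibleS N3 => x /= h; apply: contrapT => hx; apply: h => /andP[x0 x1].
have xn0 : x != 0 by apply/eqP => E; apply: hx; right; left.
have xn1 : x != 1 by apply/eqP => E; apply: hx; right; right.
have {hx} lx : lebesgue_pt fr x by apply: contrapT => h; apply: hx; left.
have {}x0 : 0 < x by rewrite lt_def xn0.
have {}x1 : x < 1 by rewrite lt_def eq_sym xn1.
have okfr : lebesgue_measure.-integrable [set` Interval (BLeft 0) (BRight 1)] (EFin \o fr).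
  apply: eq_integrable okf => // y /=; rewrite inE /= => hy.
  by rewrite /fr patchE mem_set.
have [|dF F1] := FTC1_lebesgue_pt x1 okfr _ lx.
  by rewrite /= lte_fin.
set F := (fun y : R => _) in dF F1.
have F0 y : 0 < y < 1 -> F y = 0.
  move=> y01; rewrite -(fourier_uniqueness_prim okf f0 fk y01) /F.
  apply: eq_Rintegral => z; rewrite inE /= in_itv /= => /andP[z0 zy].
  rewrite /fr patchE mem_set//= in_itv /= z0 (le_trans zy)//.
  by apply: ltW; case/andP: y01.
have D : is_derive x 1 F (fr x) by split => //; rewrite -derive1E.
have -> : f x = fr x by rewrite /fr patchE mem_set//= in_itv /= !ltW.
apply/eqP; rewrite -normr_le0; apply/ler_addgt0Pl => e e0; rewrite addr0.
have [r r0 hr] := is_derive_eps D e0.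
pose d := Num.min (r / 2) ((1 - x) / 2).
have d0 : 0 < d by rewrite lt_min !divr_gt0// subr_gt0.
have dr : d < r by rewrite gt_min; apply/orP; left; move: r0; clear; lra.
have dx : d < 1 - x by rewrite gt_min; apply/orP; right; move: x1; clear; lra.
have := hr d; rewrite (gtr0_norm d0) => /(_ dr).
rewrite !F0; last 2 first.
  by rewrite x0.
  by move: x0 d0 dx; clear; lra.
by rewrite subrr sub0r normrN normrM (gtr0_norm d0) mulrC ler_pM2r.
Qed.

End fourier_uniqueness.

(** * Continuous representatives of Sobolev functions *)

Section energy.
Context {R : realType}.
Implicit Types (f g : R -> R) (s x y e E : R) (k n : nat).

Definition eterm s f k : R :=
  2 * (2 * pi * k%:R) `^ (2 * s) * (fcos f k ^+ 2 + fsin f k ^+ 2).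

Definition energy_le s E f : Prop := forall n, \sum_(1 <= k < n) eterm s f k <= E.

Lemma eterm_ge0 s f k : 0 <= eterm s f k.
Proof. by rewrite /eterm !mulr_ge0 ?powR_ge0// addr_ge0// sqr_ge0. Qed.

Let X s f : \bar R := (\sum_(1 <= k <oo) (eterm s f k)%:E)%E.

Let X_ge0 s f : (0 <= X s f)%E.
Proof. by apply: nneseries_ge0 => n _ _; rewrite lee_fin eterm_ge0. Qed.

Lemma energy_of_sobolev s f e : 0 <= e -> (sobolev_norm s f <= e%:E)%E ->
  energy_le s (e ^+ 2) f.
Proof.
move=> e0; rewrite /sobolev_norm -/(X s f) => h n.
have hn : ((\sum_(1 <= k < n) eterm s f k)%:E <= X s f)%E.
  rewrite -sumEFin; apply: nneseries_lim_ge => k _ _; rewrite lee_fin eterm_ge0 //.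
move: (X_ge0 s f) h hn; case: (X s f) => [r| |] //.
- rewrite !lee_fin => r0 h hn; apply: (le_trans hn).
  have : r `^ 2^-1 <= e by rewrite -lee_fin -poweR_EFin.
  rewrite powR12_sqrt// => h2.
  by rewrite -(sqr_sqrtr r0) lerXn2r ?nnegrE ?sqrtr_ge0.
- by move=> _; rewrite poweRyr ?invr_eq0// leye_eq.
Qed.

Lemma sobolev_of_energy s f E : 0 <= E -> energy_le s E f ->
  (sobolev_norm s f <= (Num.sqrt E)%:E)%E.
Proof.
move=> E0 hE; rewrite /sobolev_norm -/(X s f).
have : (X s f <= E%:E)%E.
  apply: lime_le; first by apply: is_cvg_nneseries => n _ _; rewrite lee_fin eterm_ge0.
  by apply: nearW => n; rewrite sumEFin lee_fin.
move: (X_ge0 s f); case: (X s f) => [r| |] //; rewrite !lee_fin => r0 h.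
by rewrite powR12_sqrt// ler_wsqrtr.
Qed.

Lemma summable_bounded (u : R^nat) C : (forall k, 0 <= u k) ->
  (forall n, series u n <= C) -> summable_seq u.
Proof.
move=> u0 uC; apply: nondecreasing_is_cvgn.
  by apply: nondecreasing_series => k _ _.
by exists C => _ [n _ <-].
Qed.

Lemma lim_bounded (u : R^nat) C : summable_seq u -> (forall n, series u n <= C) ->
  limn (series u) <= C.
Proof. by move=> cu uC; apply: limr_le => //; exact: nearW. Qed.

(** Integral test in telescopic form: each term is dominated by a decrement of x^(- d) / d with d =
    p - 1. *)
Lemma summable_powR (p : R) : 1 < p ->
  summable_seq (fun k => (2 * pi * k.+1%:R) `^ (- p)).
Proof.
move=> p1; pose d := p - 1; have d0 : 0 < d by rewrite subr_gt0.
have S1 : summable_seq (fun k => k.+1%:R `^ (- p)).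
  apply: (@summable_bounded _ (1 + d^-1)) => [k|]; first exact: powR_ge0.
  have step k : k.+2%:R `^ (- p) <= d^-1 * (k.+1%:R `^ (- d) - k.+2%:R `^ (- d)).
    have k1 : 0 < k.+1%:R :> R by rewrite ltr0n.
    have k2 : k.+1%:R <= k.+2%:R :> R by rewrite ler_nat.
    have [] := @MVT_segment R (fun x => x `^ (- d)) (fun x => - d * x `^ (- d - 1)) _ _ k2.
    - move=> x; rewrite in_itv /= => /andP[ux xv]; apply: is_derive1_powR.
      exact: lt_trans ux.
    - apply: derivable_within_continuous => x; rewrite in_itv /= => /andP[ux xv].
      by case: (@is_derive1_powR R (- d) x (lt_le_trans k1 ux)).
    move=> c; rewrite in_itv /= => /andP[c1 c2] E.
    have -> : k.+1%:R `^ (- d) - k.+2%:R `^ (- d) = d * c `^ (- d - 1) :> R.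
      rewrite -opprB E -[k.+2%:R]natr1 [_ + 1]addrC addrK mulr1; ring.
    rewrite mulrA mulVf ?gt_eqF// mul1r.
    have -> : - d - 1 = - p by rewrite /d; ring.
    rewrite !powRN lef_pV2 ?posrE ?powR_gt0//; last exact: lt_le_trans c1.
    apply: ge0_ler_powR; rewrite ?nnegrE//; last exact: (le_trans (ltW k1)).
    by apply: ltW; apply: lt_trans p1.
  have H n : series (fun k => k.+1%:R `^ (- p)) n.+1 <= 1 + d^-1 * (1 - n.+1%:R `^ (- d)) :> R.
    elim: n => [|n IH].
      by rewrite seriesSr /series /= big_geq// add0r !powR1 subrr mulr0 addr0.
    rewrite seriesSr; have := step n; move: IH; lra.
  case=> [|n].
    by rewrite /series /= big_geq// addr_ge0// invr_ge0 ltW.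
  apply: (le_trans (H n)); rewrite lerD2l.
  apply: ler_piMr; first by rewrite invr_ge0 ltW.
  by rewrite gerBl powR_ge0.
apply: (normal_cvg _ S1) => k.
rewrite ger0_norm ?powR_ge0// !powRN lef_pV2 ?posrE ?powR_gt0 ?pi2k_gt0//.
apply: ge0_ler_powR; rewrite ?nnegrE//; first by apply: ltW; apply: lt_trans p1.
  by apply: ltW; exact: pi2k_gt0.
by apply: ler_peMl => //; have := @pi_ge2 R; lra.
Qed.

Definition fabs f k : R := 2 * (`|fcos f k| + `|fsin f k|).

Lemma fabs_ge0 f k : 0 <= fabs f k.
Proof. by rewrite /fabs mulr_ge0// addr_ge0. Qed.

(** From |c| <= T c^2 + 1 / T with T = tau (2 pi k)^(2 s0). A small [tau] makes the energy part
    small for all [f] of bounded energy at once, and the other part is a fixed convergent series if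
    s0 > 1/2: the Sobolev embedding and the equicontinuity both come from here. *)
Lemma fabs_le (s0 s tau : R) f k : 0 <= s0 <= s -> 0 < tau -> (0 < k)%N ->
  fabs f k <= tau * eterm s f k + 4 * tau^-1 * (2 * pi * k%:R) `^ (- (2 * s0)).
Proof.
move=> /andP[s00 s0s] t0 k0; have p1 := pi2k_ge1 (R:=R) k0.
have p0 := pi2k_gt0 (R:=R) k0.
pose w := (2 * pi * k%:R) `^ (2 * s0); have w0 : 0 < w by exact: powR_gt0.
have ws : w <= (2 * pi * k%:R) `^ (2 * s).
  by apply: ler_powR => //; rewrite ler_pM2l.
rewrite powRN -/w /eterm /fabs.
set a := fcos f k; set b := fsin f k.
have Q c : `|c| <= tau * w * c ^+ 2 + (tau * w)^-1.
  set T := tau * w; have T0 : 0 < T by exact: mulr_gt0.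
  have TV : T * T^-1 = 1 by rewrite divff ?gt_eqF.
  have V0 : 0 < T^-1 by rewrite invr_gt0.
  rewrite -(real_normK (num_real c)); have := normr_ge0 c; set m := `|c| => m0.
  have := sqr_ge0 (T * m - 1); move: TV V0 T0; clear -m0; move: (T^-1) => V TV V0 T0 h.
  rewrite -(ler_pM2l T0); rewrite mulrDr TV; nra.
have := Q a; have := Q b.
have -> : (tau * w)^-1 = tau^-1 * w^-1 by rewrite invfM.
have h : w * (a ^+ 2 + b ^+ 2) <= (2 * pi * k%:R) `^ (2 * s) * (a ^+ 2 + b ^+ 2).
  by rewrite ler_wpM2r// addr_ge0// sqr_ge0.
have := ler_wpM2l (ltW t0) h.
set P := _ `^ _; set V := tau^-1 * w^-1; move: (a ^+ 2) (b ^+ 2) => A B.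
have -> : 4 * tau^-1 * w^-1 = 4 * V by rewrite /V mulrA.
have -> : tau * w * A = tau * (w * A) by rewrite mulrA.
have -> : tau * w * B = tau * (w * B) by rewrite mulrA.
have -> : tau * (2 * P * (A + B)) = 2 * (tau * (P * (A + B))) by ring.
have -> : tau * (w * (A + B)) = tau * (w * A) + tau * (w * B) by ring.
lra.
Qed.

Definition vterm f k : seq term :=
  [:: (2 * fcos f k, (k, 0)); (2 * fsin f k, (k, - (pi / 2)))].

(** The sum of the Fourier series without its constant term. For s > 1/2 it is the continuous
    representative of a mean-zero [f] in H^s. *)
Definition rep f x : R := nser (fun k => tp (vterm f k.+1)) x.

Lemma tp_vterm f k x : tp (vterm f k) x =
  2 * fcos f k * wave k 0 x + 2 * fsin f k * wave k (- (pi / 2)) x.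
Proof. by rewrite /vterm !tp_cons tp_nil addr0. Qed.

Lemma tp_vterm_le f k x : `|tp (vterm f k) x| <= fabs f k.
Proof.
rewrite tp_vterm /fabs (mulrDr 2); apply: (le_trans (ler_normD _ _)).
by rewrite !normrM [`|2|]ger0_norm//; apply: lerD; apply: ler_piMr; rewrite ?wave_le1// mulr_ge0.
Qed.

Lemma sin_mul_le k (z : R) : `|sin (k%:R * z)| <= k%:R * `|sin z|.
Proof.
elim: k => [|k IH]; first by rewrite !mul0r sin0 normr0.
rewrite -natr1 !mulrDl !mul1r sinD; apply: (le_trans (ler_normD _ _)).
rewrite !normrM; apply: lerD.
  apply: le_trans IH; apply: ler_piMr => //.
  by rewrite ler_norml cos_geN1 cos_le1.
by apply: ler_piMl => //; rewrite ler_norml cos_geN1 cos_le1.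
Qed.

(** Distances on the circle are measured by [sin (pi * (x - y))], the quantity that [fejer_tail]
    controls. *)
Lemma wave_diff k a x y : `|wave k a x - wave k a y| <= 2 * (k%:R * `|sin (pi * (x - y))|).
Proof.
set u := pi * k%:R * (x + y) + a; set v := k%:R * (pi * (x - y)).
have -> : wave k a x - wave k a y = - (2 * (sin u * sin v)).
  rewrite /wave (_ : 2 * pi * k%:R * x + a = u + v); last by rewrite /u /v; ring.
  rewrite (_ : 2 * pi * k%:R * y + a = u - v); last by rewrite /u /v; ring.
  by rewrite (cosD u v) (cosB u v); ring.
rewrite normrN !normrM ger0_norm// ler_pM2l//.
apply: le_trans (sin_mul_le _ _); rewrite -/v; apply: ler_piMl => //.
by rewrite sin_max.
Qed.

Lemma tp_vterm_diff f k x y :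
  `|tp (vterm f k) x - tp (vterm f k) y| <= fabs f k * (2 * (k%:R * `|sin (pi * (x - y))|)).
Proof.
rewrite !tp_vterm /fabs.
have -> : 2 * fcos f k * wave k 0 x + 2 * fsin f k * wave k (- (pi / 2)) x -
  (2 * fcos f k * wave k 0 y + 2 * fsin f k * wave k (- (pi / 2)) y) =
  2 * fcos f k * (wave k 0 x - wave k 0 y) +
  2 * fsin f k * (wave k (- (pi / 2)) x - wave k (- (pi / 2)) y) by ring.
set W := 2 * (_ * _) in |- *.
have -> : 2 * (`|fcos f k| + `|fsin f k|) * W = 2 * `|fcos f k| * W + 2 * `|fsin f k| * W by ring.
apply: (le_trans (ler_normD _ _)).
by rewrite !normrM [`|2|]ger0_norm//; apply: lerD; apply: ler_wpM2l; rewrite ?mulr_ge0// wave_diff.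
Qed.

End energy.

Section representation.
Context {R : realType}.
Variable s : R.
Hypothesis hs : 2^-1 < s.
Implicit Types (f g : R -> R) (x y e E tau : R) (k n : nat).

Definition wgt k : R := (2 * pi * k.+1%:R) `^ (- (2 * s)).

Lemma wgt_ge0 k : 0 <= wgt k. Proof. exact: powR_ge0. Qed.

Lemma rest0 (M : R^nat) : rest M 0 = limn (series M).
Proof. by rewrite /rest (_ : series M 0 = 0) ?subr0// /series /= big_geq. Qed.

Lemma summable_wgt : summable_seq wgt.
Proof. by apply: summable_powR; move: hs; lra. Qed.

Lemma energy_series f E : energy_le s E f ->
  summable_seq (fun k => eterm s f k.+1) /\
  forall n, 0 <= rest (fun k => eterm s f k.+1) n <= E.
Proof.
move=> hE; have B n : series (fun k => eterm s f k.+1) n <= E.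
  by have := hE n.+1; rewrite big_add1.
have p k : 0 <= eterm s f k.+1 by exact: eterm_ge0.
have cS := summable_bounded p B.
split => // n; rewrite summable_ge0_rest//=.
rewrite /rest; apply: le_trans (lim_bounded cS B).
by rewrite gerBl sumr_ge0.
Qed.

Lemma summable_comb tau f E : energy_le s E f ->
  summable_seq (fun k => tau * eterm s f k.+1 + 4 * tau^-1 * wgt k) /\
  forall n, rest (fun k => tau * eterm s f k.+1 + 4 * tau^-1 * wgt k) n =
   tau * rest (fun k => eterm s f k.+1) n + 4 * tau^-1 * rest wgt n.
Proof.
move=> hE; have [cS _] := energy_series hE; have cW := summable_wgt.
have sE : series (fun k => tau * eterm s f k.+1 + 4 * tau^-1 * wgt k) =
  (fun n => tau * series (fun k => eterm s f k.+1) n + 4 * tau^-1 * series wgt n).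
  by apply/funext => n; rewrite /series /= !mulr_sumr -big_split.
have L : series (fun k => tau * eterm s f k.+1 + 4 * tau^-1 * wgt k) @ \oo -->
   tau * limn (series (fun k => eterm s f k.+1)) + 4 * tau^-1 * limn (series wgt).
  by rewrite sE; apply: cvgD; apply: cvgM => //; exact: cvg_cst.
split; first by apply/cvg_ex; eexists; exact: L.
move=> n; rewrite /rest (cvg_lim _ L)// sE /rest; ring.
Qed.

Lemma fabs_dom tau f k : 0 < tau ->
  `|fabs f k.+1| <= tau * eterm s f k.+1 + 4 * tau^-1 * wgt k.
Proof.
move=> t0; rewrite ger0_norm ?fabs_ge0//; apply: (fabs_le (s0 := s)) => //.
by rewrite lexx andbT; move: hs; lra.
Qed.

Lemma summable_fabs f E : energy_le s E f -> summable_seq (fun k => fabs f k.+1).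
Proof.
move=> hE; have [c _] := summable_comb 1 hE.
by apply: normal_cvg c => k; exact: fabs_dom.
Qed.

Lemma rest_fabs tau f E n : 0 < tau -> energy_le s E f ->
  rest (fun k => fabs f k.+1) n <= tau * E + 4 * tau^-1 * rest wgt n.
Proof.
move=> t0 hE; have [c cE] := summable_comb tau hE.
apply: le_trans (ler_norm _) _.
apply: le_trans (normal_rest (fun k => fabs_dom f k t0) c n) _.
rewrite cE lerD2r ler_pM2l//.
by have [_ /(_ n) /andP[]] := energy_series hE.
Qed.

Lemma vterm_le f k x : `|tp (vterm f k.+1) x| <= fabs f k.+1.
Proof. exact: tp_vterm_le. Qed.

Lemma rep_cont f E : energy_le s E f -> continuous (rep f).
Proof.
move=> hE; apply: (nser_cont (M := fun k => fabs f k.+1)).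
- by move=> k x; exact: tp_vterm_le.
- exact: summable_fabs hE.
- by move=> k; exact: tp_cont.
Qed.

Lemma rep_sup tau f E x : 0 < tau -> energy_le s E f ->
  `|rep f x| <= tau * E + 4 * tau^-1 * rest wgt 0.
Proof.
move=> t0 hE; apply: le_trans (rest_fabs 0 t0 hE).
rewrite rest0.
by apply: normal_bound; [move=> k; exact: tp_vterm_le | exact: summable_fabs hE].
Qed.

(** The first [n] frequencies are Lipschitz, with the sum of their coefficients bounded through
    [tau = 1]; the others are bounded by the tail. *)
Lemma rep_diff f E n x y : energy_le s E f ->
  `|rep f x - rep f y| <= 2 * n%:R * (E + 4 * rest wgt 0) * `|sin (pi * (x - y))|
     + 2 * rest (fun k => fabs f k.+1) n.
Proof.
move=> hE.
have cF := summable_fabs hE.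
set u := fun k => tp (vterm f k.+1) x; set v := fun k => tp (vterm f k.+1) y.
have hu := normal_rest (fun k => vterm_le f k x) cF n.
have hv := normal_rest (fun k => vterm_le f k y) cF n.
have hd : `|series u n - series v n| <= 2 * n%:R * (E + 4 * rest wgt 0) * `|sin (pi * (x - y))|.
  rewrite /series /= -sumrB; apply: (le_trans (ler_norm_sum _ _ _)).
  apply: (@le_trans _ _ (\sum_(0 <= k < n) fabs f k.+1 * (2 * (n%:R * `|sin (pi * (x - y))|)))).
    apply: ler_sum_nat => k /andP[_ kn]; apply: le_trans (tp_vterm_diff _ _ _ _) _.
    by rewrite ler_wpM2l ?fabs_ge0// ler_pM2l// ler_wpM2r// ler_nat.
  rewrite -mulr_suml.
  have h1 : \sum_(0 <= k < n) fabs f k.+1 <= E + 4 * rest wgt 0.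
    have := rest_fabs 0 ltr01 hE; rewrite invr1 mulr1 mul1r => h.
    apply: le_trans h; rewrite rest0.
    apply: nondecreasing_cvgn_le => //.
    by apply: nondecreasing_series => k _ _; exact: fabs_ge0.
  have h2 : 0 <= 2 * (n%:R * `|sin (pi * (x - y))|) by rewrite !mulr_ge0.
  have := ler_wpM2r h2 h1; set A := n%:R; set B := `|_|; lra.
have -> : rep f x - rep f y = (series u n - series v n) + (rest u n - rest v n).
  by rewrite /rep /nser /rest -/u -/v; ring.
apply: (le_trans (ler_normD _ _)); apply: lerD => //.
by apply: (le_trans (ler_normB _ _)); move: hu hv; rewrite -/u -/v; lra.
Qed.

(** [D] serves a whole energy ball, hence all times at once. The squared form is the one integrated
    in [fejer_concentration]. *)
Lemma rep_equicont E e : 0 <= E -> 0 < e -> exists2 D, 0 <= D &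
  forall f, energy_le s E f -> forall x y,
    (rep f x - rep f y) ^+ 2 <= e + D * sin (pi * (x - y)) ^+ 2.
Proof.
move=> E0 e0; pose d := Num.min 1 (e / 8).
have d0 : 0 < d by rewrite lt_min ltr01 divr_gt0.
have d1 : d <= 1 by rewrite ge_min lexx.
have de : d <= e / 8 by rewrite ge_min lexx orbT.
(* The energy then contributes at most [d / 2] to the tail; [n] is taken next so that the weights
   contribute the other [d / 2]. *)
pose tau := d / (2 * (E + 1)).
have E1 : 0 < E + 1 by move: E0; lra.
have t0 : 0 < tau by rewrite /tau divr_gt0// mulr_gt0.
have tE : tau * E <= d / 2.
  have : tau * (2 * (E + 1)) = d by rewrite divfK// mulf_neq0// gt_eqF.
  by move: t0; lra.
have dt0 : 0 < d * tau / 8 by apply: divr_gt0 => //; exact: mulr_gt0.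
have /cvgrPdist_le/(_ _ dt0) [n _ /(_ n (leqnn n))] := rest_cvg0 summable_wgt.
rewrite /= sub0r normrN => /(le_trans (ler_norm _)) hn.
pose A := 2 * n%:R * (E + 4 * rest wgt 0).
exists (2 * A ^+ 2); first by rewrite mulr_ge0// sqr_ge0.
move=> f hE x y.
have := rep_diff n x y hE; rewrite -/A.
have : rest (fun k => fabs f k.+1) n <= d.
  apply: (le_trans (rest_fabs n t0 hE)).
  have : 4 * tau^-1 * rest wgt n <= d / 2.
    have -> : d / 2 = 4 * tau^-1 * (d * tau / 8) by field; exact: lt0r_neq0.
    by rewrite ler_pM2l// mulr_gt0// invr_gt0.
  by move: tE; lra.
set r := rest _ n; set S := `|sin _| => hr hd.
have r0 : 0 <= r by apply: summable_ge0_rest (summable_fabs hE) _ => k; exact: fabs_ge0.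
rewrite -(real_normK (num_real (rep f x - rep f y))) -(real_normK (num_real (sin _))) -/S.
have h0 := normr_ge0 (rep f x - rep f y).
apply: (@le_trans _ _ ((A * S + 2 * d) ^+ 2)).
  rewrite lerXn2r ?nnegrE//; first by apply: (le_trans h0); move: hd hr; lra.
  by move: hd hr; lra.
have := sqr_ge0 (A * S - 2 * d).
have : d ^+ 2 <= d by rewrite expr2 ler_piMr// ltW.
set T := A * S; rewrite (_ : 2 * A ^+ 2 * S ^+ 2 = 2 * T ^+ 2); last by rewrite /T; ring.
by move: de; clear; nra.
Qed.

Lemma fourier_vterm f j k : (0 < k)%N ->
  fcos (tp (vterm f j)) k = (if j == k then fcos f k else 0) /\
  fsin (tp (vterm f j)) k = (if j == k then fsin f k else 0).
Proof.
move=> k0; rewrite fcosE fsinE !I01_tp_wave// /vterm !big_cons !big_nil /=.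
case: eqVneq => [->|_]; last by [].
have c1 : cos (0 - 0) = 1 :> R by rewrite subr0 cos0.
have c2 : cos (- (pi / 2) - 0) = 0 :> R by rewrite subr0 cosN cos_pihalf.
have c3 : cos (0 - - (pi / 2)) = 0 :> R by rewrite opprK add0r cos_pihalf.
have c4 : cos (- (pi / 2) - - (pi / 2)) = 1 :> R by rewrite subrr cos0.
by rewrite c1 c2 c3 c4; split; field.
Qed.

Lemma fourier_rep f E k : (0 < k)%N -> energy_le s E f ->
  fcos (rep f) k = fcos f k /\ fsin (rep f) k = fsin f k.
Proof.
move=> k0 hE.
have single (c : R) : series (fun j => if j.+1 == k then c else 0) @ \oo --> c.
  apply: cvg_near_cst; exists k => // n /= kn.
  rewrite /series /= (bigD1_seq k.-1) ?iota_uniq//=; last first.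
    by rewrite mem_index_iota prednK.
  rewrite prednK// eqxx big1 ?addr0// => j jk.
  by case: eqP => // E'; move: jk; rewrite -E' eqxx.
have main a (c : R) : (forall j, I01 (fun x => tp (vterm f j) x * wave k a x) = if j == k then c else 0) ->
    I01 (fun x => rep f x * wave k a x) = c.
  move=> H.
  have := nser_I01 (f := fun j => tp (vterm f j.+1)) (fun j x => vterm_le f j x)
    (summable_fabs hE) (fun j => @tp_cont R _) (@wave_cont R k a).
  under eq_fun => j do rewrite H.
  move=> L; have := single c; move: L; exact: (@cvg_unique _ (@Rhausdorff R)).
split; first rewrite fcosE; last rewrite fsinE; apply: main => j.
  by rewrite -fcosE; case: (fourier_vterm f j k0).
by rewrite -fsinE; case: (fourier_vterm f j k0).
Qed.

Lemma I01_rep f E : energy_le s E f -> I01 (rep f) = 0.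
Proof.
move=> hE.
have := nser_I01 (f := fun j => tp (vterm f j.+1)) (fun j x => vterm_le f j x)
    (summable_fabs hE) (fun j => @tp_cont R _) (@wave_cont R 0 0).
have -> : (fun x => nser (fun j => tp (vterm f j.+1)) x * wave 0 0 x) = rep f.
  by apply/funext => x; rewrite wave0 cos0 mulr1.
move=> L; have := L; rewrite (_ : series _ = cst 0).
  by move=> /cvg_lim <- //; rewrite lim_cst.
apply/funext => n; rewrite /series /= big1// => j _.
under eq_fun => x do rewrite wave0 cos0 mulr1.
by apply: I01_tp => p; rewrite /vterm !inE => /orP[/eqP->|/eqP->].
Qed.

Lemma fourierB f g k : ok01 f -> ok01 g ->
  fcos (fun x => f x - g x) k = fcos f k - fcos g k /\
  fsin (fun x => f x - g x) k = fsin f k - fsin g k.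
Proof.
move=> okf okg; rewrite !fcosE !fsinE.
have H a : I01 (fun x => (f x - g x) * wave k a x) =
    I01 (fun x => f x * wave k a x) - I01 (fun x => g x * wave k a x).
  rewrite -I01B; [|by apply: ok01M_cont => //; exact: wave_cont..].
  by apply: eq_I01 => x _; rewrite mulrBl.
by rewrite !H.
Qed.

Lemma rep_ae f E : ok01 f -> I01 f = 0 -> energy_le s E f ->
  {ae lebesgue_measure, forall x, 0 <= x <= 1 -> f x = rep f x}.
Proof.
move=> okf f0 hE.
have okr : ok01 (rep f) by exact/ok01_cont/rep_cont.
have : {ae lebesgue_measure, forall x, 0 <= x <= 1 -> f x - rep f x = 0}.
  apply: fourier_uniqueness; first exact: ok01B.
    by rewrite I01B// f0 (I01_rep hE) subrr.
  move=> k k0; have [-> ->] := fourierB k okf okr.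
  by have [-> ->] := fourier_rep k0 hE; rewrite !subrr.
apply: filterS; first exact: (ae_filter_ringOfSetsType lebesgue_measure).
by move=> x h /h /eqP; rewrite subr_eq0 => /eqP.
Qed.

Lemma repB f g Ef Eg x : ok01 f -> ok01 g -> energy_le s Ef f -> energy_le s Eg g ->
  rep (fun x => f x - g x) x = rep f x - rep g x.
Proof.
move=> okf okg hf hg.
have cf := normal_cvg (fun k => vterm_le f k x) (summable_fabs hf).
have cg := normal_cvg (fun k => vterm_le g k x) (summable_fabs hg).
rewrite /rep /nser; apply: cvg_lim => //.
have -> : series (fun k => tp (vterm (fun x => f x - g x) k.+1) x) =
  (fun n => series (fun k => tp (vterm f k.+1) x) n - series (fun k => tp (vterm g k.+1) x) n).
  apply/funext => n; rewrite /series /= -sumrB; apply: eq_bigr => k _.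
  by rewrite !tp_vterm; have [-> ->] := fourierB k.+1 okf okg; ring.
exact: cvgB.
Qed.

Lemma energyB f g Ef Eg : ok01 f -> ok01 g -> energy_le s Ef f -> energy_le s Eg g ->
  energy_le s (2 * Ef + 2 * Eg) (fun x => f x - g x).
Proof.
move=> okf okg hf hg n.
apply: (@le_trans _ _ (\sum_(1 <= k < n) (2 * eterm s f k + 2 * eterm s g k))).
  apply: ler_sum => k _; rewrite /eterm; have [-> ->] := fourierB k okf okg.
  rewrite -!mulrA mulrCA; set P := _ `^ _.
  have P0 : 0 <= P by exact: powR_ge0.
  set a := fcos f k; set b := fcos g k; set c := fsin f k; set d := fsin g k.
  have h : (a - b) ^+ 2 + (c - d) ^+ 2 <= 2 * (a ^+ 2 + c ^+ 2) + 2 * (b ^+ 2 + d ^+ 2).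
    by have := sqr_ge0 (a + b); have := sqr_ge0 (c + d); nra.
  by have := ler_wpM2l P0 h; lra.
by rewrite big_split /= -!mulr_sumr; apply: lerD; rewrite ler_pM2l.
Qed.

End representation.

(** * Blow-up *)

Section static.
Context {R : realType}.
Variable alpha : R.
Hypothesis halpha : 0 < alpha < 1 / 2.
Implicit Types (V : R -> R) (x y z a : R) (J : nat).

Definition phis J y : seq (@term R) := ts (pco alpha J) (2 ^ J) (- (pi / 2)) y.

Lemma tp_phis J y x : tp (phis J y) x = phi alpha J (x - y).
Proof. by rewrite /phis tp_ts. Qed.

Lemma tp_dphis J y x : tp (map dterm (phis J y)) x = dphi alpha J (x - y).
Proof. exact: phi_dterm. Qed.

Lemma tp_lphis J y x : tp (map (lterm alpha) (phis J y)) x = lphi alpha J (x - y).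
Proof. exact: phi_lterm. Qed.

Lemma psi_cont J y : continuous (fun x => psi alpha J (x - y)).
Proof.
have -> : (fun x => psi alpha J (x - y)) =
  (fun x => mass alpha J * fejer (2 ^ J) (x - y) - tp (map dterm (phis J y)) x).
  by apply/funext => x; rewrite tp_dphis /dphi; ring.
move=> x; apply: cvgB; last exact: tp_cont.
by apply: cvgM; [exact: cvg_cst | exact: fejer_cont].
Qed.

Lemma cont_sqr V : continuous V -> continuous (fun x => V x ^+ 2).
Proof.
move=> cV; under eq_fun => x do rewrite expr2.
by move=> x; apply: cvgM; exact: cV.
Qed.

(* Replacing [V] by [V - a] costs nothing against mean-zero functions, except
   for the transport term [a * I01 (V * phi')]. *)
Lemma static_ineq J V a y M K : continuous V ->
  M = mass alpha J -> K = 2 * M * Kpsi alpha ->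
  I01 (fun x => V x * tp (phis J y) x) ^+ 2 / (4 * M ^+ 2) - K ^+ 2 * M
    - M / 2 * I01 (fun x => (V x - a) ^+ 2 * fejer (2 ^ J) (x - y))
    - a * I01 (fun x => V x * tp (map dterm (phis J y)) x)
  <= - 2^-1 * I01 (fun x => V x ^+ 2 * tp (map dterm (phis J y)) x)
     - I01 (fun x => V x * tp (map (lterm alpha) (phis J y)) x).
Proof.
move=> cV ME KE.
have M1 : 1 <= M by rewrite ME mass_ge1.
have M0 : 0 < M by exact: lt_le_trans M1.
set f := tp (phis J y); set df := tp _; set lf := tp (map (lterm alpha) _).
pose W x := V x - a.
have cW : continuous W by move=> x; apply: cvgB; [exact: cV | exact: cvg_cst].
have cW2 := cont_sqr cW.
have cf : continuous f by exact: tp_cont.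
have cdf : continuous df by exact: tp_cont.
have clf : continuous lf by exact: tp_cont.
have cF : continuous (fun x => fejer (2 ^ J) (x - y) : R) by exact: fejer_cont.
have step_const := @psi_cont J y.
have okM (g h : R -> R) : continuous g -> continuous h -> ok01 (fun x => g x * h x).
  by move=> cg ch; apply: ok01M_cont => //; exact: ok01_cont.
have If : I01 f = 0 by exact: I01_ts.
have Idf : I01 df = 0 by rewrite /df /phis dterm_ts; exact: I01_ts.
have Ilf : I01 lf = 0 by rewrite /lf /phis lterm_ts; exact: I01_ts.
set IP := I01 (fun x => W x ^+ 2 * psi alpha J (x - y)).
set IF := I01 (fun x => (V x - a) ^+ 2 * _).
(* [V ^ 2 = W ^ 2 + 2 a V - a ^ 2], where the constant is invisible to the mean-zero [df], and [df]
   is [M] times the kernel minus [psi]. *)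
have E1 : I01 (fun x => V x ^+ 2 * df x) = M * IF - IP + 2 * a * I01 (fun x => V x * df x).
  transitivity (I01 (fun x => (M * (W x ^+ 2 * fejer (2 ^ J) (x - y)) - W x ^+ 2 * psi alpha J (x - y))
       + (2 * a * (V x * df x) - a ^+ 2 * df x))).
    apply: eq_I01 => x _.
    have -> : M * (W x ^+ 2 * fejer (2 ^ J) (x - y)) - W x ^+ 2 * psi alpha J (x - y) = W x ^+ 2 * df x.
      by rewrite /df tp_dphis /dphi -ME; ring.
    by rewrite /W; ring.
  rewrite I01D; [|by apply: ok01B; [exact/ok01Z/okM|exact: okM]
                 |by apply: ok01B; apply: ok01Z; [exact: okM|exact: ok01_cont]].
  rewrite I01B; [|exact/ok01Z/okM|exact: okM].
  rewrite [X in _ + X]I01B; [|exact/ok01Z/okM|exact/ok01Z/ok01_cont].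
  rewrite !I01Z; [|exact: ok01_cont|exact: okM|exact: okM].
  by rewrite Idf mulr0 subr0.
have E2 : I01 (fun x => V x * lf x) = I01 (fun x => W x * lf x).
  transitivity (I01 (fun x => W x * lf x + a * lf x)).
    by apply: eq_I01 => x _; rewrite /W; ring.
  rewrite I01D; [|exact: okM|exact/ok01Z/ok01_cont].
  by rewrite I01Z ?Ilf ?mulr0 ?addr0//; exact: ok01_cont.
have E3 : I01 (fun x => V x * f x) = I01 (fun x => W x * f x).
  transitivity (I01 (fun x => W x * f x + a * f x)).
    by apply: eq_I01 => x _; rewrite /W; ring.
  rewrite I01D; [|exact: okM|exact/ok01Z/ok01_cont].
  by rewrite I01Z ?If ?mulr0 ?addr0//; exact: ok01_cont.
have IPsi : I01 (fun x => psi alpha J (x - y)) = M by rewrite ME I01_psi.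
(* The nonlinearity yields a gain of [IP / 2]. Half of it absorbs the dissipation here, by w K <=
   w^2 / 4 + K^2; the other half becomes the square of the pairing in [H3]. *)
have H1 : I01 (fun x => W x * lf x) <= 4^-1 * IP + K ^+ 2 * M.
  have okWP := okM _ _ cW2 step_const; have okP := ok01_cont step_const.
  have <- : I01 (fun x => 4^-1 * (W x ^+ 2 * psi alpha J (x - y)) + K ^+ 2 * psi alpha J (x - y))
     = 4^-1 * IP + K ^+ 2 * M.
    by rewrite I01D ?I01Z ?IPsi//; exact: ok01Z.
  apply: le_I01; first exact: okM.
    by apply: ok01D; exact: ok01Z.
  move=> x _; have p1 := psi_ge1 alpha J (x - y).
  have := lphi_le halpha J (x - y); rewrite -ME -KE => hl.
  have hl' : `|lf x| <= K * psi alpha J (x - y) by rewrite /lf tp_lphis.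
  apply: (le_trans (ler_norm _)); rewrite normrM.
  apply: (le_trans (ler_wpM2l (normr_ge0 _) hl')).
  rewrite -(real_normK (num_real (W x))); set w := `|W x|; set P := psi _ _ _ in p1 *.
  have := sqr_ge0 (w / 2 - K) => h.
  have P0 : 0 <= P by apply: le_trans p1.
  have := mulr_ge0 h P0; rewrite -subr_ge0 => /le_trans; apply.
  by rewrite le_eqVlt; apply/orP; left; apply/eqP; field.
(* The weight enters through [psi >= 1], after an unweighted Cauchy-Schwarz inequality. *)
have H2 : I01 (fun x => W x * f x) ^+ 2 <= IP * M ^+ 2.
  apply: (le_trans (I01_CS (ok01_cont cW2) (ok01_cont (cont_sqr cf)) (okM _ _ cW cf))).
  apply: ler_pM.
  - by apply: I01_ge0 => x _; exact: sqr_ge0.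
  - by apply: I01_ge0 => x _; exact: sqr_ge0.
  - apply: le_I01; [exact: ok01_cont|exact: okM|] => x _.
    by rewrite ler_peMr ?sqr_ge0 ?psi_ge1.
  - apply: (le_trans (ler_norm _)); apply: I01_bound; first exact/ok01_cont/cont_sqr.
    move=> x _; rewrite ger0_norm ?sqr_ge0// -(real_normK (num_real (f x))).
    by rewrite lerXn2r ?nnegrE ?(ltW M0)// /f tp_phis ME; exact: phi_le.
have H3 : I01 (fun x => V x * f x) ^+ 2 / (4 * M ^+ 2) <= 4^-1 * IP.
  rewrite E3 ler_pdivrMr ?mulr_gt0 ?exprn_gt0//; move: H2; lra.
rewrite E1 E2; move: H1 H3.
set A := _ / (4 * M ^+ 2); set B := K ^+ 2 * M; set C := I01 (fun x => V x * df x).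
lra.
Qed.

(** The kernel has mass 1, which accounts for [e], and its product with the squared sine is at most
    [1 / 2 ^ J] everywhere by [fejer_tail]. *)
Lemma fejer_concentration J V a y e D : continuous V ->
  (forall x, (V x - a) ^+ 2 <= e + D * sin (pi * (x - y)) ^+ 2) -> 0 <= D ->
  I01 (fun x => (V x - a) ^+ 2 * fejer (2 ^ J) (x - y)) <= e + D / (2 ^ J)%:R.
Proof.
move=> cV hV D0.
have cW : continuous (fun x => V x - a) by move=> x; apply: cvgB; [exact: cV | exact: cvg_cst].
have okF := @ok01_fejer R (2 ^ J) y.
have n0 : (0 < 2 ^ J)%N by rewrite expn_gt0.
have -> : e + D / (2 ^ J)%:R = I01 (fun x => e * fejer (2 ^ J) (x - y) + D / (2 ^ J)%:R).
  by rewrite I01D ?I01Z ?I01_cst ?I01_fejer ?mulr1//; first [exact: ok01Z | exact: ok01_cst].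
apply: le_I01.
- by apply: ok01M_cont; [exact/ok01_cont/cont_sqr|exact: fejer_cont].
- by apply: ok01D; [exact: ok01Z|exact: ok01_cst].
- move=> x _; have F0 := fejer_ge0 (x - y) n0; have := fejer_tail (x - y) n0.
  move=> /(ler_wpM2l D0); have := ler_wpM2r F0 (hV x).
  set F := fejer _ _; set S := sin _ ^+ 2; set N := _^-1; nra.
Qed.

End static.

(** * The Riccati inequality along a moving centre *)

Section blowup.
Context {R : realType}.
Variables (alpha s T : R) (u0 : R -> R) (v : R -> R -> R).
Hypothesis halpha : 0 < alpha < 1 / 2.
Hypothesis hs : 3 / 2 - 2 * alpha <= s.
Hypothesis hT : 2 < T.
Hypothesis hv : weak_solution alpha T u0 v.
Hypothesis cv : continuous_in_sobolev s T v.
Implicit Types (x y z t u w a e E : R) (J : nat).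

(** Since alpha < 1/2, the threshold 3/2 - 2 alpha lies above 1/2, the exponent of the embedding
    into continuous functions. *)
Let hs2 : 2^-1 < s.
Proof. by case/andP: halpha; move: hs; lra. Qed.

Lemma continuous_energy t0 e : 0 <= t0 < T -> 0 < e -> exists2 d, 0 < d &
  forall t, 0 <= t < T -> `|t - t0| < d ->
    energy_le s (e ^+ 2) (fun x => v t x - v t0 x).
Proof.
move=> ht0 e0; have [_ /(_ t0 ht0) L] := cv.
have N : nbhs (0%E : \bar R) [set y | (y < e%:E)%E].
  by apply: open_nbhs_nbhs; split; [exact: open_ereal_lt_ereal | rewrite /= lte_fin].
have := L _ N; rewrite /within /= => /nbhs_ballP[d /= d0 hd].
exists d => // t ht td.
have := hd t; rewrite /ball /= distrC => /(_ td ht) h.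
by apply: energy_of_sobolev; [exact: ltW | exact: ltW].
Qed.

Lemma sobolev_energy t : 0 <= t < T ->
  [/\ ok01 (v t), I01 (v t) = 0, measurable_fun [set: measurableTypeR R] (v t) &
    exists2 E, 0 <= E & energy_le s E (v t)].
Proof.
move=> ht; have [/(_ t ht) [_ mv okv2 mz nf] _] := cv.
have mv' : measurable_fun [set: measurableTypeR R] (v t) by exact: mv.
have okv : ok01 (v t) by apply: ok01_sqr => //; exact: measurable_funTS.
split => //.
have n0 : (0 <= sobolev_norm s (v t))%E by exact: poweR_ge0.
pose e := fine (sobolev_norm s (v t)).
have eE : sobolev_norm s (v t) = e%:E.
  by rewrite /e fineK// ge0_fin_numE.
exists (e ^+ 2); first exact: sqr_ge0.
apply: energy_of_sobolev; last by rewrite eE.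
by rewrite -lee_fin -eE.
Qed.

Let inT t : 0 <= t <= 2 -> 0 <= t < T.
Proof. by move=> /andP[-> h]; exact: le_lt_trans hT. Qed.

(** Continuity in time bounds the energy near each time of the compact interval [0, 2], and Cousin's
    lemma makes the bound global. *)
Lemma energy_uniform : exists2 E, 0 <= E &
  forall t, 0 <= t <= 2 -> energy_le s E (v t).
Proof.
have [E [E0 hE]] : exists E, 0 <= E /\ forall t, 0 <= t <= 2 -> energy_le s E (v t).
  apply: (@cousin R (fun u w => exists E, 0 <= E /\ forall t, u <= t <= w -> energy_le s E (v t))).
  - by [].
  - move=> u p w _ up pw _ [E1 [E10 h1]] [E2 [E20 h2]].
    exists (E1 + E2); split; first exact: addr_ge0.
    move=> t /andP[ut tw] n; have [tp|pt] := leP t p.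
      by apply: le_trans (h1 t _ n) _; rewrite ?ut ?lerDl.
    by apply: le_trans (h2 t _ n) _; rewrite ?tw ?(ltW pt) ?lerDr.
  - move=> t0 ht0; have ht0' := inT ht0.
    have [ok0 _ _ [E0 E00 hE0]] := sobolev_energy ht0'.
    have [d d0 hd] := continuous_energy ht0' (@ltr01 R).
    exists d => // u w u0' ut tw w2 wu.
    (* [v t] is written as [v t0 - (0 - (v t - v t0))], so that [energyB] applies twice; anything
       above [2 * E0 + 4] works. *)
    exists (2 * E0 + 2 * (2 * E0 + 2 * (2 * (1 ^+ 2) + 2 * 0))); split.
      by rewrite expr1n; move: E00; lra.
    move=> t /andP[ut' tw'].
    have ht : 0 <= t < T by apply: inT; rewrite (le_trans u0' ut') (le_trans tw' w2).
    have [okt _ _ _] := sobolev_energy ht.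
    have dt : `|t - t0| < d by rewrite ltr_norml; move: wu ut tw ut' tw'; lra.
    have h := hd t ht dt.
    have okd := ok01B okt ok0.
    have e0 : energy_le s 0 (fun=> 0 : R).
      move=> n; rewrite big1// => k _; rewrite /eterm fcosE fsinE.
      have Z a : I01 (fun x => 0 * wave k a x) = 0 :> R.
        by rewrite -[RHS](I01_cst 0); apply: eq_I01 => x _; rewrite mul0r.
      by rewrite !Z expr0n /= addr0 mulr0.
    have hneg := energyB (ok01_cst 0) okd e0 h.
    have := energyB ok0 (ok01B (ok01_cst 0) okd) hE0 hneg.
    rewrite (_ : (fun x => _) = v t); last by apply/funext => x; ring.
    move=> H n; apply: (le_trans (H n)); rewrite expr1n; move: E00; lra.
by exists E.
Qed.

Definition V t x : R := rep (v t) x.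

Lemma V_cont t : 0 <= t < T -> continuous (V t).
Proof.
by move=> ht; have [_ _ _ [E _ hE]] := sobolev_energy ht; exact: rep_cont hE.
Qed.

Lemma V_ae t : 0 <= t < T ->
  {ae lebesgue_measure, forall x, 0 <= x <= 1 -> v t x = V t x}.
Proof.
by move=> ht; have [okt It _ [E _ hE]] := sobolev_energy ht; exact: rep_ae hE.
Qed.

Lemma pairing_V t (g : R -> R) : 0 <= t < T -> continuous g ->
  pairing (v t) g = I01 (fun x => V t x * g x).
Proof.
move=> ht cg; have cV := V_cont ht; have [okt _ _ _] := sobolev_energy ht.
rewrite pairingE; apply: I01_ae.
- exact: (ok01_mfun (ok01M_cont okt cg)).
- exact: (ok01_mfun (ok01M_cont (ok01_cont cV) cg)).
have := V_ae ht; apply: filterS; first exact: (ae_filter_ringOfSetsType lebesgue_measure).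
by move=> x h hx; rewrite h.
Qed.

Lemma pairing_V2 t (g : R -> R) : 0 <= t < T -> continuous g ->
  pairing (fun x => v t x ^+ 2) g = I01 (fun x => V t x ^+ 2 * g x).
Proof.
move=> ht cg; have cV := V_cont ht; have [okt _ mv _] := sobolev_energy ht.
rewrite pairingE; apply: I01_ae.
- apply: measurable_funM; last exact: cont_mfun01.
  rewrite (_ : (fun x => _) = (fun x => v t x * v t x)); last exact/funext.
  by apply: measurable_funM; exact: measurable_funTS.
- exact: (ok01_mfun (ok01M_cont (ok01_cont (cont_sqr cV)) cg)).
have := V_ae ht; apply: filterS; first exact: (ae_filter_ringOfSetsType lebesgue_measure).
by move=> x h hx; rewrite h.
Qed.

(** [rep_sup] applied to [v t - v t0]: [tau] is chosen large for the fixed series of weights, and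
    then the energy [c ^ 2] small compared with [e / tau]. The bound is uniform in [x]. *)
Lemma V_time t0 e : 0 <= t0 <= 2 -> 0 < e -> exists2 d, 0 < d &
  forall t, 0 <= t <= 2 -> `|t - t0| < d -> forall x, `|V t x - V t0 x| <= e.
Proof.
move=> ht0 e0; have W0 : 0 <= rest (wgt s) 0.
  by apply: summable_ge0_rest; [exact: wgt_ge0 | exact: summable_wgt].
pose tau := 8 * (rest (wgt s) 0 + 1) / e.
have t00 : 0 < tau by rewrite divr_gt0// mulr_gt0// ltr_wpDl.
pose c := Num.min 1 (e / (2 * tau)).
have c0 : 0 < c by rewrite lt_min ltr01 divr_gt0// mulr_gt0.
have c1 : c <= 1 by rewrite ge_min lexx.
have ce : c <= e / (2 * tau) by rewrite ge_min lexx orbT.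
have [d d0 hd] := continuous_energy (inT ht0) c0.
exists d => // t ht td x.
have [okt _ _ [Et _ hEt]] := sobolev_energy (inT ht).
have [ok0 _ _ [E0 _ hE0]] := sobolev_energy (inT ht0).
rewrite -(repB hs2 x okt ok0 hEt hE0).
apply: (le_trans (rep_sup hs2 x t00 (hd t (inT ht) td))).
have h1 : tau * c ^+ 2 <= e / 2.
  apply: (@le_trans _ _ (tau * c)).
    by rewrite ler_pM2l// expr2 ler_piMr// ltW.
  apply: (le_trans (ler_wpM2l (ltW t00) ce)); rewrite le_eqVlt; apply/orP; left; apply/eqP.
  by field; exact: lt0r_neq0.
have h2 : 4 * tau^-1 * rest (wgt s) 0 <= e / 2.
  have -> : tau^-1 = e / (8 * (rest (wgt s) 0 + 1)) by rewrite /tau invf_div.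
  have w1 : 0 < rest (wgt s) 0 + 1 by rewrite ltr_wpDl.
  have -> : 4 * (e / (8 * (rest (wgt s) 0 + 1))) * rest (wgt s) 0 = (e / 2) * (rest (wgt s) 0 / (rest (wgt s) 0 + 1)).
    by field; exact: lt0r_neq0.
  by rewrite ler_piMr ?divr_ge0 ?(ltW e0)// ler_pdivrMr// mul1r lerDl.
by move: h1 h2; lra.
Qed.

Definition ell J t y : R := I01 (fun x => V t x * tp (phis alpha J y) x).

(** [mb] and [kb] bound [mass] and the constant [K] of [static_ineq] for all [J], so the threshold
    [ellmin] is known before [J] is chosen. *)
Definition mb : R := (1 - theta alpha)^-1.

Definition kb : R := 2 * mb * Kpsi alpha.

(* Above this value the growth [kap * l ^ 2] beats all the error terms, and
   1 / l reaches 0 in time less than 2. *)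
Definition ellmin : R := 2 + 32 * mb ^+ 2 * (kb ^+ 2 * mb + 3).

(** Half of the coefficient [1 / (16 * mb ^ 2)] of [ell_growth]; the other half pays for the errors
    in [step_combine]. *)
Definition kap : R := (32 * mb ^+ 2)^-1.

Lemma mass_mb J : mass alpha J <= mb. Proof. exact: mass_le. Qed.

Lemma mb_ge1 : 1 <= mb. Proof. exact: le_trans (mass_ge1 alpha 0) (mass_mb 0). Qed.

Lemma kb_ge0 : 0 <= kb.
Proof.
rewrite /kb /Kpsi !mulr_ge0 ?lam_ge0//; first exact: le_trans ler01 mb_ge1.
exact: ltW (Kg_gt0 halpha).
Qed.

Lemma tp_bound (l : seq (@term R)) x : `|tp l x| <= \sum_(p <- l) `|p.1|.
Proof.
apply: (le_trans (ler_norm_sum _ _ _)); apply: ler_sum => p _.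
by rewrite normrM ler_piMr// wave_le1.
Qed.

Lemma phi_tp0 J z : phi alpha J z = tp (phis alpha J 0) z.
Proof. by rewrite tp_phis subr0. Qed.

Lemma dphi_tp0 J z : dphi alpha J z = tp (map dterm (phis alpha J 0)) z.
Proof. by rewrite tp_dphis subr0. Qed.

Lemma dphi_bound J : exists2 C, 0 <= C & forall z, `|dphi alpha J z| <= C.
Proof.
exists (\sum_(p <- map dterm (phis alpha J 0)) `|p.1|); first exact: sumr_ge0.
by move=> z; rewrite dphi_tp0; exact: tp_bound.
Qed.

Lemma phi_taylor J : exists2 C, 0 <= C & forall z z',
  `|phi alpha J z' - phi alpha J z - (z' - z) * dphi alpha J z| <= C * (z' - z) ^+ 2.
Proof.
exists (\sum_(p <- map dterm (map dterm (phis alpha J 0))) `|p.1|); first exact: sumr_ge0.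
move=> z z'; rewrite !phi_tp0 dphi_tp0.
exact: (taylor1_bound (tp_deriv (phis alpha J 0))
  (tp_deriv (map dterm (phis alpha J 0))) (tp_bound _)).
Qed.

Lemma ell_shift J (Vm : R) : 0 <= Vm -> exists2 C, 0 <= C &
  forall w y d, 0 <= w <= 2 -> (forall x, `|V w x| <= Vm) ->
   ell J w y + d * I01 (fun x => V w x * tp (map dterm (phis alpha J y)) x) - C * d ^+ 2
     <= ell J w (y - d).
Proof.
move=> Vm0; have [C C0 hC] := phi_taylor J.
exists (Vm * C); first exact: mulr_ge0.
move=> w y d hw hV; have cV := V_cont (inT hw).
have okM (g : R -> R) : continuous g -> ok01 (fun x => V w x * g x).
  by move=> cg; apply: ok01M_cont => //; exact: ok01_cont.
set f := tp (phis alpha J y); set df := tp (map dterm _); set f' := tp (phis alpha J (y - d)).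
have okf : ok01 (fun x => V w x * f x) by apply: okM; exact: tp_cont.
have okdf : ok01 (fun x => V w x * df x) by apply: okM; exact: tp_cont.
have okf' : ok01 (fun x => V w x * f' x) by apply: okM; exact: tp_cont.
rewrite /ell -/f -/f' lerBlDr -lerBlDl.
have -> : I01 (fun x => V w x * f x) + d * I01 (fun x => V w x * df x) - I01 (fun x => V w x * f' x)
   = I01 (fun x => V w x * f x + d * (V w x * df x) - V w x * f' x).
  by rewrite I01B ?I01D ?I01Z//; [exact: ok01Z | apply: ok01D => //; exact: ok01Z].
apply: (le_trans (ler_norm _)); apply: I01_bound.
  by apply: ok01B => //; apply: ok01D => //; exact: ok01Z.
move=> x _.
have -> : V w x * f x + d * (V w x * df x) - V w x * f' x =
  - (V w x * (f' x - f x - d * df x)) by ring.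
rewrite normrN normrM -mulrA; apply: ler_pM => //.
rewrite /f /f' /df !tp_phis tp_dphis.
have := hC (x - y) (x - (y - d)).
by rewrite (_ : x - (y - d) - (x - y) = d)//; ring.
Qed.

Lemma dell_le t0 t (e P : R) : 0 <= t0 <= 2 -> 0 <= t <= 2 ->
  (forall x, `|V t x - V t0 x| <= e) -> forall g : R -> R, continuous g ->
  (forall x, `|g x| <= P) ->
  `|I01 (fun x => V t x * g x) - I01 (fun x => V t0 x * g x)| <= e * P.
Proof.
move=> ht0 ht hV g cg gP; have cV := V_cont (inT ht); have cV0 := V_cont (inT ht0).
have ok1 := ok01M_cont (ok01_cont cV) cg; have ok2 := ok01M_cont (ok01_cont cV0) cg.
rewrite -I01B//; apply: I01_bound; first exact: ok01B.
move=> x _; rewrite -mulrBl normrM; exact: ler_pM.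
Qed.

Lemma sum4_le (x1 x2 x3 x4 x5 x6 x7 : R) : x1 <= x2 -> x4 <= x5 -> x3 <= 1 ->
  x6 <= x7 + 1 -> x1 - x5 - 2 - x7 <= x2 - x4 - x3 - x6.
Proof. lra. Qed.

Lemma half_sqr_le (A B m M : R) : 0 <= A -> A / 2 <= B -> 0 < M -> M <= m ->
  A ^+ 2 / (16 * m ^+ 2) <= B ^+ 2 / (4 * M ^+ 2).
Proof.
move=> A0 AB M0 Mm; have m0 : 0 < m by exact: lt_le_trans Mm.
have A20 : 0 <= A / 2 by rewrite divr_ge0.
have E : A ^+ 2 / (16 * m ^+ 2) = (A / 2) ^+ 2 / (4 * m ^+ 2).
  by field; exact: lt0r_neq0.
rewrite E; apply: ler_pM.
- exact: sqr_ge0.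
- by rewrite invr_ge0 mulr_ge0// sqr_ge0.
- by rewrite lerXn2r ?nnegrE// (le_trans A20).
have M2 : M ^+ 2 <= m ^+ 2 by rewrite lerXn2r ?nnegrE ?(ltW m0) ?(ltW M0).
by rewrite lef_pV2 ?posrE ?mulr_gt0 ?exprn_gt0// ler_pM2l.
Qed.

(* The centre is kept at [y] during the time step [[u, w]]; [ell_shift] then
   moves it, and the transport term cancels to first order. *)
Lemma ell_growth J (Vm D e P1 : R) u w y :
  0 <= u -> u <= w -> w <= 2 -> 0 <= D -> 0 <= Vm ->
  (forall t x, 0 <= t <= 2 -> `|V t x| <= Vm) ->
  (forall t x z, 0 <= t <= 2 ->
     (V t x - V t z) ^+ 2 <= (3 * mb)^-1 + D * sin (pi * (x - z)) ^+ 2) ->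
  D / (2 ^ J)%:R <= (3 * mb)^-1 ->
  0 <= P1 -> (forall z, `|dphi alpha J z| <= P1) -> Vm * P1 * e <= 1 ->
  0 <= e -> e <= (3 * mb)^-1 ->
  (forall t t' x, u <= t <= w -> u <= t' <= w -> `|V t x - V t' x| <= e) ->
  2 <= ell J u y ->
  (w - u) * (ell J u y ^+ 2 / (16 * mb ^+ 2) - kb ^+ 2 * mb - 2
      - V u y * I01 (fun x => V w x * tp (map dterm (phis alpha J y)) x))
   <= ell J w y - ell J u y.
Proof.
move=> u0' uw w2 D0 Vm0 bV eV hDJ P10 hP1 hP1e e0 eM tV hell.
have m1 := mb_ge1; have m0 : 0 < mb by exact: lt_le_trans m1.
have M1 := mass_ge1 alpha J; have Mm := mass_mb J.
have M0 : 0 < mass alpha J by exact: lt_le_trans M1.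
have emb : e * mb <= 3^-1.
  by rewrite -ler_pdivlMr// -invfM.
have e1 : e <= 1 by apply: (@le_trans _ _ (e * mb)); [rewrite ler_peMr | move: emb; lra].
pose a := V u y.
set B := I01 (fun x => V w x * _).
have h02 t : u <= t <= w -> 0 <= t <= 2.
  by move=> /andP[ut tw]; rewrite (le_trans u0' ut) (le_trans tw w2).
have huu : u <= u <= w by rewrite lexx.
have hww : u <= w <= w by rewrite lexx uw.
pose f := tp (phis alpha J y).
pose df := tp (map dterm (phis alpha J y)).
pose lf := tp (map (lterm alpha) (phis alpha J y)).
have a0 : 0 < alpha by case/andP: halpha.
have [_ ac ae] := hv (tp_smooth (phis alpha J y)).
have ellE t : 0 <= t <= 2 -> pairing (v t) f = ell J t y.
  by move=> ht; rewrite pairing_V//; [exact: inT | exact: tp_cont].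
rewrite -(ellE w (h02 w hww)) -{2}(ellE u (h02 u huu)).
rewrite mulrC.
apply: (@AC_growth R (fun t => pairing (v t) f)
   (fun t => - 2^-1 * pairing (fun x => v t x ^+ 2) df - pairing (v t) lf) 2) => //.
- by apply: ac; rewrite hT andbT.
- move: ae; apply: filterS; first exact: (ae_filter_ringOfSetsType lebesgue_measure).
  move=> t h /andP[t0 tw]; have {h} := h (ltac:(rewrite t0/=; exact: lt_trans tw (le_lt_trans w2 hT))).
  by rewrite derive1_tp fractional_laplacian_tp.
- move=> t /andP[ut tw].
  have htw : u <= t <= w by rewrite !ltW.
  have ht := h02 t htw; have ht' := inT ht.
  rewrite pairing_V2//; last exact: tp_cont.
  rewrite pairing_V//; last exact: tp_cont.
  have cVt := V_cont ht'.
  (* [a] stays equal to [V u y] at every time of the step, so that one displacement at the end can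
     cancel the transport term. *)
  have SI := @static_ineq R alpha halpha J (V t) a y _ _ cVt erefl erefl.
  apply: le_trans SI.
  rewrite -/df -/f -/a.
  have C1 : I01 (fun x => (V t x - a) ^+ 2 * fejer (2 ^ J) (x - y)) <=
      (2 * (3 * mb)^-1 + 2 * e ^+ 2) + (2 * D) / (2 ^ J)%:R.
    apply: fejer_concentration => //; last by rewrite mulr_ge0.
    move=> x; have := eV t x y ht.
    have := tV t u y htw huu; rewrite -/a => h1 h2.
    have h3 : (V t y - a) ^+ 2 <= e ^+ 2.
      by rewrite -(real_normK (num_real (V t y - a))) lerXn2r// nnegrE.
    have := sqr_ge0 ((V t x - V t y) - (V t y - a)).
    move: h2 h3; set S := sin _ ^+ 2.
    rewrite -[V t x - a](subrKA (V t y)).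
    set p := V t x - V t y; set q := V t y - a.
    have -> : 2 * D * S = 2 * (D * S) by ring.
    nra.
  (* Space oscillation, time oscillation and kernel tail each contribute at most [2 / (3 * mb)]:
     this is the origin of the 3. *)
  have C2 : mass alpha J / 2 * I01 (fun x => (V t x - a) ^+ 2 * fejer (2 ^ J) (x - y)) <= 1.
    have : e ^+ 2 <= (3 * mb)^-1 by apply: le_trans eM; rewrite expr2 ler_piMr.
    move=> e2; have IB : I01 (fun x => (V t x - a) ^+ 2 * fejer (2 ^ J) (x - y)) <= 6 * (3 * mb)^-1.
      apply: (le_trans C1); rewrite -mulrA; move: e2 hDJ; lra.
    apply: (@le_trans _ _ (mb / 2 * (6 * (3 * mb)^-1))).
      apply: ler_pM => //.
      - by rewrite divr_ge0// ltW.
      - apply: I01_ge0 => x _; rewrite mulr_ge0 ?sqr_ge0// fejer_ge0//.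
        by rewrite expn_gt0.
      - by rewrite ler_pM2r.
    by rewrite le_eqVlt; apply/orP; left; apply/eqP; field; exact: lt0r_neq0.
  (* The pairing moves by at most [e * mb <= 1 / 3] during the step and starts from at least 2. *)
  have C3 : ell J u y / 2 <= I01 (fun x => V t x * f x).
    have H : `|I01 (fun x => V t x * f x) - ell J u y| <= e * mb.
      apply: (dell_le (h02 u huu) ht (fun x => tV t u x htw huu) (@tp_cont R _)).
      by move=> x; rewrite /f tp_phis; apply: le_trans (mass_mb J); exact: phi_le.
    move: H emb hell; rewrite ler_norml.
    by move: (ell J u y) (I01 _) (e * mb) => A B' C'; lra.
  have C4 : ell J u y ^+ 2 / (16 * mb ^+ 2) <= I01 (fun x => V t x * f x) ^+ 2 / (4 * mass alpha J ^+ 2).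
    exact: (half_sqr_le (le_trans (ler0n R 2) hell) C3 M0 Mm).
  have C5 : (2 * mass alpha J * Kpsi alpha) ^+ 2 * mass alpha J <= kb ^+ 2 * mb.
    have k0 : 0 <= Kpsi alpha.
      by rewrite /Kpsi !mulr_ge0 ?lam_ge0// ltW// (Kg_gt0 halpha).
    have k00 : 0 <= 2 * mass alpha J * Kpsi alpha.
      by apply: mulr_ge0 => //; apply: mulr_ge0 => //; exact: ltW.
    have kk : 2 * mass alpha J * Kpsi alpha <= kb.
      by rewrite /kb; apply: ler_wpM2r => //; apply: ler_wpM2l.
    have kk2 : (2 * mass alpha J * Kpsi alpha) ^+ 2 <= kb ^+ 2.
      by rewrite lerXn2r ?nnegrE ?kb_ge0.
    exact: ler_pM (sqr_ge0 _) (ltW M0) kk2 Mm.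
  (* The transport integral is transferred to the final time [w], where [ell_shift] displaces the
     centre. *)
  have C6 : a * I01 (fun x => V t x * df x) <= a * B + 1.
    have H := @dell_le w t e P1 (h02 w hww) ht (fun x => tV t w x htw hww) df (@tp_cont R _)
      (ltac:(by move=> x; rewrite /df tp_dphis)).
    have ha := bV u y (h02 u huu).
    have : `|a * (I01 (fun x => V t x * df x) - B)| <= 1.
      rewrite normrM; apply: le_trans hP1e; rewrite -mulrA [P1 * e]mulrC.
      by apply: ler_pM.
    by move=> /(le_trans (ler_norm _)); rewrite mulrBr lerBlDl.
  exact: (sum4_le C4 C5 C2 C6).
Qed.

(** Discrete form of (1 / l)' = - l' / l^2: the exact decrease is r / (1 + r A) with r = h k, and r
    A <= 1 limits the loss to a factor 2. *)
Lemma riccati_inv (k h A A' : R) : 0 < k -> 0 <= h -> 0 < A -> h * k * A <= 1 ->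
  A + h * k * A ^+ 2 <= A' -> k / 2 * h <= A^-1 - A'^-1.
Proof.
move=> k0 h0 A0 hkA AA'.
pose r := h * k; have r0 : 0 <= r by rewrite mulr_ge0// ltW.
have X0 : 0 < A + r * A ^+ 2 by rewrite ltr_wpDr// mulr_ge0// sqr_ge0.
apply: (@le_trans _ _ (A^-1 - (A + r * A ^+ 2)^-1)); last first.
  by rewrite lerD2l lerN2 lef_pV2// posrE (lt_le_trans X0).
have Y0 : 0 < 1 + r * A by rewrite ltr_wpDr// mulr_ge0// ltW.
have -> : A^-1 - (A + r * A ^+ 2)^-1 = r / (1 + r * A).
  have -> : A + r * A ^+ 2 = A * (1 + r * A) by ring.
  by field; rewrite !lt0r_neq0.
rewrite ler_pdivlMr//; have -> : k / 2 * h = r / 2 by rewrite /r; ring.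
by move: hkA; rewrite -/r; nra.
Qed.

Lemma chain_le (c u x w A B C : R) : c * (x - u) <= A - B -> c * (w - x) <= B - C ->
  c * (w - u) <= A - C.
Proof. lra. Qed.

(** Growth with a frozen centre plus displacement: the transport terms [h * z * B] cancel, and one
    half of [X] absorbs the errors [q], 2 and [c / h <= 1]. *)
Lemma step_combine (h X q z B l A A' c r : R) : 0 <= h -> X = 2 * r ->
  h * (X - q - 2 - z * B) <= l - A -> l + h * z * B - c <= A' -> c <= h ->
  q + 3 <= r -> A + h * r <= A'.
Proof.
move=> h0 -> G Sh ch hr; have := mulr_ge0 h0 (_ : 0 <= r - (q + 3)).
rewrite subr_ge0 => /(_ hr); move: G Sh ch.
have -> : h * (2 * r - q - 2 - z * B) = 2 * (h * r) - h * q - 2 * h - h * z * B by ring.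
have -> : h * (r - (q + 3)) = h * r - h * q - 3 * h by ring.
move: (h * z * B) (h * r) (h * q) => p1 p2 p3; lra.
Qed.

Lemma itv_dist_lt (u w t t0 d : R) : u <= t <= w -> u <= t0 -> t0 <= w ->
  w - u < d -> `|t - t0| < d.
Proof. by rewrite ltr_norml; lra. Qed.

Lemma ellmin_le (A : R) : ellmin <= A -> kb ^+ 2 * mb + 3 <= kap * A ^+ 2.
Proof.
move=> hA; have m1 := mb_ge1.
have q3 : 3 <= kb ^+ 2 * mb + 3.
  by rewrite lerDr mulr_ge0 ?sqr_ge0// (le_trans ler01).
have m20 : 0 < 32 * mb ^+ 2 by rewrite mulr_gt0// exprn_gt0// (lt_le_trans ltr01).
rewrite /kap [_^-1 * _]mulrC ler_pdivlMr//.
have h := mulr_ge0 (ltW m20) (le_trans (ler0n R 3) q3).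
have hA' : 2 + (32 * mb ^+ 2) * (kb ^+ 2 * mb + 3) <= A by [].
rewrite mulrC; move: h hA'; set Q := _ * (_ + 3) => h hA'.
have A1 : 1 <= A by move: h hA'; lra.
apply: (@le_trans _ _ A); first by move: hA'; lra.
by rewrite expr2 ler_peMr// (le_trans ler01).
Qed.

Lemma blowup_absurd :
  (forall J, (0 < J)%N -> ellmin <= pairing u0 (tp (phis alpha J 0))) -> False.
Proof.
move=> hinit; have [E E0 hE] := energy_uniform.
have m1 := mb_ge1; have m0 : 0 < mb by exact: lt_le_trans m1.
have e30 : 0 < (3 * mb)^-1 by rewrite invr_gt0 mulr_gt0.
have [D D0 hD] := rep_equicont hs2 E0 e30.
pose Vm := 1 * E + 4 * 1^-1 * rest (wgt s) 0.
have hVm t x : 0 <= t <= 2 -> `|V t x| <= Vm.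
  by move=> ht; apply: rep_sup => //; exact: hE.
have Vm0 : 0 <= Vm.
  apply: (le_trans (normr_ge0 (V 0 0))); apply: hVm.
  by rewrite lexx /= ler0n.
(* Large enough for [2 ^ J >= 3 * mb * D]; the successor gives the [0 < J] that [hinit] asks for. *)
pose J := (Num.bound (3 * mb * D)).+1.
have hDJ : D / (2 ^ J)%:R <= (3 * mb)^-1.
  have nJ : 3 * mb * D <= (2 ^ J)%:R.
    by rewrite natrX ltW// upper_nthrootP// /J leqnSn.
  rewrite ler_pdivrMr ?ltr0n ?expn_gt0// mulrC ler_pdivlMr ?mulr_gt0//.
  by rewrite mulrC.
have [P1 P10 hP1] := dphi_bound J.
have [C C0 hC] := ell_shift J Vm0.
have kap0 : 0 < kap by rewrite invr_gt0 mulr_gt0// exprn_gt0.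
have ell_le t y : 0 <= t <= 2 -> ell J t y <= Vm * mb.
  move=> ht; apply: (le_trans (ler_norm _)); apply: I01_bound.
    by apply: ok01M_cont; [exact/ok01_cont/V_cont/inT | exact: tp_cont].
  move=> x _; rewrite normrM; apply: ler_pM => //; first exact: hVm.
  by rewrite tp_phis; apply: le_trans (mass_mb J); exact: phi_le.
(* The new centre is existentially quantified, so every step picks its own and no curve of centres
   is built. The bound on inverses is additive over adjacent intervals. *)
pose P u w := forall y, ellmin <= ell J u y -> exists2 y', ellmin <= ell J w y' &
  kap / 2 * (w - u) <= (ell J u y)^-1 - (ell J w y')^-1.
have em2 : 2 <= ellmin.
  rewrite /ellmin lerDl; apply: mulr_ge0.
    by apply: mulr_ge0 => //; exact: sqr_ge0.
  by apply: addr_ge0 => //; apply: mulr_ge0; [exact: sqr_ge0 | exact: ltW].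
have em0 : 0 < ellmin by exact: lt_le_trans em2.
have : P 0 2.
  apply: cousin; first by [].
    move=> u w z _ _ _ _ h1 h2 y hy; have [y1 hy1 k1] := h1 y hy; have [y2 hy2 k2] := h2 y1 hy1.
    by exists y2 => //; exact: chain_le k1 k2.
  move=> t0 ht0.
  (* One number below both [(3 * mb)^-1] and the inverse of [Vm * P1]; adding the denominators
     avoids dividing by a possibly zero product. *)
  pose e := (3 * mb + Vm * P1)^-1.
  have den : 3 * mb <= 3 * mb + Vm * P1 by rewrite lerDl mulr_ge0.
  have den0 : 0 < 3 * mb + Vm * P1 by apply: lt_le_trans den; rewrite mulr_gt0.
  have e0 : 0 < e by rewrite invr_gt0.
  have eM : e <= (3 * mb)^-1 by rewrite lef_pV2// posrE mulr_gt0.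
  have hPe : Vm * P1 * e <= 1.
    by rewrite ler_pdivrMr// mul1r lerDr mulr_ge0// ltW.
  have e20 : 0 < e / 2 by rewrite divr_gt0.
  have [d1 d10 hd1] := V_time ht0 e20.
  (* The first summand makes the displacement error at most [h], the second gives the side condition
     of [riccati_inv], and 1 keeps the denominator positive. *)
  pose d2 := (C * Vm ^+ 2 + kap * (Vm * mb) + 1)^-1.
  have s1 : 0 <= C * Vm ^+ 2 by rewrite mulr_ge0// sqr_ge0.
  have s2 : 0 <= kap * (Vm * mb) by rewrite mulr_ge0 ?(ltW kap0)// mulr_ge0// ltW.
  have den2 : 0 < C * Vm ^+ 2 + kap * (Vm * mb) + 1.
    by apply: ltr_wpDl => //; exact: addr_ge0.
  have d20 : 0 < d2 by rewrite invr_gt0.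
  have d2E : (C * Vm ^+ 2 + kap * (Vm * mb) + 1) * d2 = 1.
    by rewrite divff// gt_eqF.
  exists (Num.min d1 d2); first by rewrite lt_min d10.
  move=> u w u0' ut tw w2; rewrite lt_min => /andP[h1 h2] y hA.
  have uw : u <= w by exact: le_trans tw.
  have h02 t : u <= t <= w -> 0 <= t <= 2.
    by move=> /andP[a1 a2]; rewrite (le_trans u0' a1) (le_trans a2 w2).
  have tV t t' x : u <= t <= w -> u <= t' <= w -> `|V t x - V t' x| <= e.
    move=> ht ht'.
    have k1 := itv_dist_lt ht ut tw h1; have k2 := itv_dist_lt ht' ut tw h1.
    have := hd1 t (h02 t ht) k1 x; have := hd1 t' (h02 t' ht') k2 x.
    rewrite [`|V t' x - _|]distrC => j1 j2.
    rewrite -(subrKA (V t0 x)); apply: (le_trans (ler_normD _ _)).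
    by have := lerD j2 j1; rewrite -splitr; apply.
  have A2 : 2 <= ell J u y.
    exact: le_trans em2 hA.
  have eVt t x z : 0 <= t <= 2 -> (V t x - V t z) ^+ 2 <= (3 * mb)^-1 + D * sin (pi * (x - z)) ^+ 2.
    by move=> ht; apply: hD; exact: hE.
  have G := ell_growth u0' uw w2 D0 Vm0 hVm eVt hDJ P10 hP1 hPe (ltW e0) eM tV A2.
  pose h := w - u; have h0 : 0 <= h by rewrite subr_ge0.
  have huu : u <= u <= w by rewrite lexx.
  have hww : u <= w <= w by rewrite lexx uw.
  have Sh := hC w y (h * V u y) (h02 w hww) (fun x => hVm w x (h02 w hww)).
  have XE : ell J u y ^+ 2 / (16 * mb ^+ 2) = 2 * (kap * ell J u y ^+ 2).
    by rewrite /kap; move: (ell J u y) => a; field; exact: lt0r_neq0.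
  have hkap : kb ^+ 2 * mb + 3 <= kap * ell J u y ^+ 2 by exact: ellmin_le.
  have hw : h <= d2 by exact: ltW.
  have hVu : V u y ^+ 2 <= Vm ^+ 2.
    by rewrite -(real_normK (num_real (V u y))) lerXn2r ?nnegrE// hVm// h02.
  have err : C * (h * V u y) ^+ 2 <= h.
    have k1 : C * Vm ^+ 2 * h <= 1.
      rewrite -d2E; apply: (le_trans (ler_wpM2l s1 hw)).
      by rewrite ler_pM2r// -addrA lerDl addr_ge0.
    apply: (@le_trans _ _ (h * (C * Vm ^+ 2 * h))); last by rewrite ler_piMr.
    have -> : C * (h * V u y) ^+ 2 = h * (C * V u y ^+ 2 * h) by ring.
    by rewrite ler_wpM2l// ler_wpM2r// ler_wpM2l.
  have AA' := step_combine h0 XE G Sh err hkap.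
  have A0 : 0 < ell J u y by exact: lt_le_trans (ltr0n R 2) A2.
  have hk0 : 0 <= h * (kap * ell J u y ^+ 2).
    by apply: mulr_ge0 => //; apply: mulr_ge0; [exact: ltW | exact: sqr_ge0].
  exists (y - h * V u y).
    by apply: (le_trans hA); apply: le_trans AA'; rewrite lerDl.
  rewrite mulrA in AA'; apply: (riccati_inv kap0 h0 A0 _ AA').
  have k1 : kap * (Vm * mb) * h <= 1.
    rewrite -d2E; apply: (le_trans (ler_wpM2l s2 hw)).
    by rewrite ler_pM2r// addrAC lerDr addr_ge0.
  apply: le_trans k1; rewrite -[h * kap * _]mulrA mulrC; apply: ler_wpM2r => //.
  by apply: ler_wpM2l; [exact: ltW | apply: ell_le; exact: h02].
move=> /(_ 0); have -> : ell J 0 0 = pairing u0 (tp (phis alpha J 0)).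
  have [<- _ _] := hv (tp_smooth (phis alpha J 0)).
  by rewrite pairing_V//; [apply: inT; rewrite lexx /= | exact: tp_cont].
have hA := hinit J (ltn0Sn _); move=> /(_ hA) [y' hy'].
set A := pairing u0 _ in hA *.
have A0 : 0 < A by exact: lt_le_trans em0 hA.
have A'0 : 0 < (ell J 2 y')^-1 by rewrite invr_gt0 (lt_le_trans em0).
(* Over [0, 2] the inverse has dropped by at least [kap] and is still positive, so [1 / A > kap];
   but [A >= 32 * mb ^ 2 = 1 / kap]. *)
rewrite subr0 divfK// => hk.
have : kap < A^-1 by apply: (le_lt_trans hk); rewrite ltrBlDr ltrDl.
rewrite /kap ltf_pV2 ?posrE ?mulr_gt0 ?exprn_gt0//.
have m2 : 0 < 32 * mb ^+ 2 by rewrite mulr_gt0// exprn_gt0.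
have h3 : 3 <= kb ^+ 2 * mb + 3 by rewrite lerDr mulr_ge0 ?sqr_ge0// ltW.
have hA3 : 32 * mb ^+ 2 <= A.
  apply: le_trans hA; rewrite /ellmin; apply: (@le_trans _ _ (32 * mb ^+ 2 * (kb ^+ 2 * mb + 3))); last by rewrite lerDr.
  by rewrite ler_peMr ?(ltW m2)//; apply: le_trans h3; rewrite ler1n.
by rewrite ltNge hA3.
Qed.

End blowup.

(** * The power series solution *)

Section cauchy_product.
Context {R : realFieldType}.
Implicit Types (u : nat -> R) (n N : nat).

(** The square is the value at 1 of the square of a truncated generating polynomial. Its
    coefficients are the convolution below [N] and are dominated by that of the absolute values
    beyond, which controls the error in [mertens_square]. *)
Lemma cauchy_square u N : exists c : nat -> R,
  [/\ (\sum_(i < N) u i) ^+ 2 = \sum_(n < N + N) c n,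
      forall n, (n < N)%N -> c n = \sum_(i < n.+1) u i * u (n - i)%N &
      forall n, `|c n| <= \sum_(i < n.+1) `|u i| * `|u (n - i)%N|].
Proof.
pose p := \poly_(i < N) u i.
have pE n : (p * p)`_n = \sum_(i < n.+1) p`_i * p`_(n - i) by rewrite coefM.
have pu n : `|p`_n| <= `|u n| by rewrite coef_poly; case: ifP => //; rewrite normr0.
exists (fun n => (p * p)`_n); split.
- have sp : (size p <= N)%N by exact: size_poly.
  have s2 : (size (p * p)%R <= N + N)%N.
    by apply: (leq_trans (size_polyMleq _ _)); apply: (leq_trans (leq_pred _)); exact: leq_add.
  have -> : \sum_(i < N) u i = p.[1].
    rewrite (horner_coef_wide _ sp); apply: eq_bigr => i _.
    by rewrite expr1n mulr1 coef_poly ltn_ord.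
  rewrite expr2 -hornerM (horner_coef_wide _ s2); apply: eq_bigr => i _.
  by rewrite expr1n mulr1.
- move=> n nN; rewrite pE; apply: eq_bigr => i _.
  by rewrite !coef_poly (leq_ltn_trans _ nN) ?(leq_ltn_trans _ nN)// ?leq_subr// -ltnS.
- move=> n; rewrite pE; apply: (le_trans (ler_norm_sum _ _ _)).
  by apply: ler_sum => i _; rewrite normrM ler_pM.
Qed.

End cauchy_product.

Section term_algebra.
Context {R : realType}.
Local Notation term := (@term R).
Implicit Types (p q : term) (l m : seq term) (x c : R) (n d e : nat).

Definition scaleT c l : seq term := [seq (c * p.1, p.2) | p <- l].

Lemma tp_scaleT c l x : tp (scaleT c l) x = c * tp l x.
Proof.
by rewrite /tp big_map mulr_sumr; apply: eq_bigr => p _; rewrite mulrA.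
Qed.

(** Product-to-sum formula; the cases ensure that the truncated subtraction removes the smaller
    frequency from the larger. *)
Definition mulT p q : seq term :=
  if (q.2.1 <= p.2.1)%N then
    [:: (2^-1 * (p.1 * q.1), ((p.2.1 + q.2.1)%N, p.2.2 + q.2.2));
        (2^-1 * (p.1 * q.1), ((p.2.1 - q.2.1)%N, p.2.2 - q.2.2))]
  else
    [:: (2^-1 * (p.1 * q.1), ((q.2.1 + p.2.1)%N, q.2.2 + p.2.2));
        (2^-1 * (p.1 * q.1), ((q.2.1 - p.2.1)%N, q.2.2 - p.2.2))].

Lemma tp_mulT p q x :
  tp (mulT p q) x = (p.1 * wave p.2.1 p.2.2 x) * (q.1 * wave q.2.1 q.2.2 x).
Proof.
rewrite mulrACA /mulT; case: leqP => [h|/ltnW h].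
  by rewrite !tp_cons tp_nil /= wave_mul//; ring.
by rewrite !tp_cons tp_nil /= [wave _ _ x * _]mulrC wave_mul//; ring.
Qed.

Definition prodT l m : seq term := [seq r | pq <- allpairs pair l m, r <- mulT pq.1 pq.2].

Lemma tp_prodT l m x : tp (prodT l m) x = tp l x * tp m x.
Proof.
rewrite /prodT /tp big_allpairs_dep /= big_allpairs /= mulr_suml.
apply: eq_bigr => p _; rewrite mulr_sumr; apply: eq_bigr => q _.
exact: tp_mulT.
Qed.

(** The Wiener norm of a list of terms. As lists are never simplified, it is exactly multiplicative
    ([nrm_prodT]). *)
Definition nrm l : R := \sum_(p <- l) `|p.1|.

Lemma nrm_ge0 l : 0 <= nrm l. Proof. exact: sumr_ge0. Qed.

Lemma nrm_scaleT c l : nrm (scaleT c l) = `|c| * nrm l.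
Proof. by rewrite /nrm big_map mulr_sumr; apply: eq_bigr => p _; rewrite normrM. Qed.

Lemma nrm_cat l m : nrm (l ++ m) = nrm l + nrm m.
Proof. by rewrite /nrm big_cat. Qed.

Lemma nrm_mulT p q : nrm (mulT p q) = `|p.1| * `|q.1|.
Proof.
rewrite /mulT /nrm; case: ifP => _; rewrite !big_cons big_nil /= !normrM [`|2^-1|]ger0_norm ?invr_ge0// addr0; lra.
Qed.

Lemma nrm_prodT l m : nrm (prodT l m) = nrm l * nrm m.
Proof.
rewrite /prodT /nrm big_allpairs_dep /= big_allpairs /= mulr_suml.
apply: eq_bigr => p _; rewrite mulr_sumr; apply: eq_bigr => q _.
exact: nrm_mulT.
Qed.

Definition degle d l : bool := all (fun p => p.2.1 <= d)%N l.

Lemma degle_mulT d e p q : (p.2.1 <= d)%N -> (q.2.1 <= e)%N -> degle (d + e) (mulT p q).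
Proof. by move=> hp hq; rewrite /mulT /degle; case: ifP => _ /=; rewrite andbT; lia. Qed.

Lemma degle_prodT d e l m : degle d l -> degle e m -> degle (d + e) (prodT l m).
Proof.
move=> /allP hl /allP hm; apply/allP => r /allpairsPdep[[p q] [r' [/allpairsP[[p' q'] /= [hp hq [-> ->]]] hr ->]]].
by have /allP := degle_mulT (hl _ hp) (hm _ hq); apply.
Qed.

Lemma degle_cat d l m : degle d (l ++ m) = degle d l && degle d m.
Proof. exact: all_cat. Qed.

Lemma degle_scaleT d c l : degle d (scaleT c l) = degle d l.
Proof. exact: all_map. Qed.

Lemma degle_dterm d l : degle d (map dterm l) = degle d l.
Proof. exact: all_map. Qed.

Lemma degle_lterm d alpha l : degle d (map (lterm alpha) l) = degle d l.
Proof. exact: all_map. Qed.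

Lemma degleW d e l : (d <= e)%N -> degle d l -> degle e l.
Proof. by move=> de; apply: sub_all => p /= h; exact: leq_trans de. Qed.

Lemma nrm_dterm d l : degle d l -> nrm (map dterm l) <= 2 * pi * d%:R * nrm l.
Proof.
move=> /allP hl; rewrite /nrm big_map mulr_sumr big_seq [leRHS]big_seq.
apply: ler_sum => p pl; rewrite /= normrM mulrC ler_wpM2r//.
rewrite ger0_norm ?mulr_ge0 ?pi_ge0// ler_pM2l ?pi2_gt0// ler_nat.
exact: hl.
Qed.

Lemma lam_le (alpha : R) k : 0 < alpha < 1 / 2 -> lam alpha k <= 2 * pi * k%:R.
Proof.
move=> /andP[a0 a2]; rewrite /lam; case: k => [|k].
  by rewrite mulr0 powR0// mulf_neq0 ?gt_eqF.
apply: ler1_powR; first exact: pi2k_ge1.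
by move: a2; lra.
Qed.

Lemma nrm_lterm (alpha : R) d l : 0 < alpha < 1 / 2 -> degle d l ->
  nrm (map (lterm alpha) l) <= 2 * pi * d%:R * nrm l.
Proof.
move=> ha /allP hl; rewrite /nrm big_map mulr_sumr big_seq [leRHS]big_seq.
apply: ler_sum => p pl; rewrite /= normrM mulrC ler_wpM2r//.
rewrite ger0_norm ?powR_ge0//; apply: (le_trans (lam_le _ ha)).
rewrite ler_pM2l ?pi2_gt0// ler_nat.
exact: hl.
Qed.

Lemma tp_nrm l x : `|tp l x| <= nrm l.
Proof. exact: tp_bound. Qed.

End term_algebra.

Section coefficients.
Context {R : realType}.
Variables (alpha A : R).
Hypothesis halpha : 0 < alpha < 1 / 2.
Local Notation term := (@term R).
Implicit Types (x t : R) (n i : nat).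

Definition convT (h : nat -> seq term) n : seq term :=
  flatten [seq prodT (h i) (h (n - i)%N) | i <- iota 0 n.+1].

Definition nextT (h : nat -> seq term) n : seq term :=
  scaleT n.+1%:R^-1 (scaleT 2^-1 (map dterm (convT h n))
    ++ scaleT (-1) (map (lterm alpha) (h n))).

(* The first [n + 1] coefficients: the recursion needs all the previous ones. *)
Fixpoint hist n : seq (seq term) :=
  if n is m.+1 then rcons (hist m) (nextT (nth [::] (hist m)) m)
  else [:: [:: (A, (1%N, - (pi / 2)))]].

Definition U n : seq term := nth [::] (hist n) n.

Lemma size_hist n : size (hist n) = n.+1.
Proof. by elim: n => //= n IH; rewrite size_rcons IH. Qed.

Lemma nth_hist n i : (i <= n)%N -> nth [::] (hist n) i = U i.
Proof.
elim: n => [|n IH]; first by rewrite leqn0 => /eqP ->.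
rewrite leq_eqVlt => /orP[/eqP -> //|]; rewrite ltnS => h.
by rewrite /= nth_rcons size_hist ltnS h IH.
Qed.

Lemma U_rec n : U n.+1 = nextT U n.
Proof.
rewrite /U /= nth_rcons size_hist ltnn eqxx /nextT nth_hist//.
congr (scaleT _ (scaleT _ (map _ (flatten _)) ++ _)).
apply/eq_in_map => i; rewrite mem_iota /= add0n ltnS => h.
by rewrite !nth_hist// leq_subr.
Qed.

Lemma tp_convT n x : tp (convT U n) x = \sum_(i < n.+1) tp (U i) x * tp (U (n - i)) x.
Proof.
rewrite /tp /convT big_flatten big_map.
rewrite -[iota 0 n.+1]/(index_iota 0 n.+1) big_mkord.
by apply: eq_bigr => i _; rewrite -[LHS]/(tp _ x) tp_prodT.
Qed.

Lemma nrm_convT n : nrm (convT U n) = \sum_(i < n.+1) nrm (U i) * nrm (U (n - i)).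
Proof.
rewrite /nrm /convT big_flatten big_map.
rewrite -[iota 0 n.+1]/(index_iota 0 n.+1) big_mkord.
by apply: eq_bigr => i _; rewrite -[LHS]/(nrm _) nrm_prodT.
Qed.

Lemma degle_convT n : (forall i, (i <= n)%N -> degle i.+1 (U i)) -> degle n.+2 (convT U n).
Proof.
move=> h; rewrite /degle /convT; apply/allP => r /flattenP[l /mapP[i]].
rewrite mem_iota /= add0n ltnS => iN -> rl; have : degle n.+2 (prodT (U i) (U (n - i))); last by move=> /allP; exact.
 apply: (@degleW _ (i.+1 + (n - i).+1)); first by lia.
by apply: degle_prodT; apply: h => //; exact: leq_subr.
Qed.

Lemma degle_U n : degle n.+1 (U n).
Proof.
elim/ltn_ind: n => -[|n] IH; first by [].
rewrite U_rec /nextT degle_scaleT degle_cat !degle_scaleT degle_dterm degle_lterm.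
rewrite degle_convT; last by move=> i iN; apply: IH.
by rewrite (degleW _ (IH n _)).
Qed.

Lemma tp_U_rec n x : n.+1%:R * tp (U n.+1) x =
  2^-1 * tp (map dterm (convT U n)) x - tp (map (lterm alpha) (U n)) x.
Proof.
rewrite U_rec /nextT tp_scaleT tp_cat !tp_scaleT mulrA divff ?pnatr_eq0//.
by rewrite mul1r mulN1r.
Qed.

Definition step_const : R := 4 * pi.

(** The derivative costs 2 pi (n + 2) <= 4 pi (n + 1) and the multiplier at most 2 pi (n + 1); the
    division by [n.+1] in the recursion removes the growth in [n]. *)
Lemma nrm_U_rec n : nrm (U n.+1) <= step_const * (nrm (convT U n) + nrm (U n)).
Proof.
have n0 : 0 < n.+1%:R :> R by rewrite ltr0n.
rewrite U_rec /nextT nrm_scaleT nrm_cat !nrm_scaleT normrN1 mul1r !ger0_norm ?invr_ge0//.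
rewrite mulrC ler_pdivrMr//.
have h1 : nrm (map dterm (convT U n)) <= 2 * pi * n.+2%:R * nrm (convT U n).
  by apply: nrm_dterm; apply: degle_convT => i _; exact: degle_U.
have h2 := nrm_lterm halpha (degle_U n).
have c0 := nrm_ge0 (convT U n); have u0 := nrm_ge0 (U n).
have n2 : n.+2%:R <= 2 * n.+1%:R :> R by rewrite -natrM ler_nat; lia.
have p0 := @pi_gt0 R.
rewrite /step_const; move: h1 h2 c0 u0 n2 p0 n0.
move: (nrm (map dterm (convT U n))) (nrm (convT U n)) (nrm (map (lterm alpha) (U n))) (nrm (U n)) (n.+2%:R : R) (n.+1%:R : R) (pi : R) => a b c d e f p.
move=> h1 h2 b0 d0 ef p0 f0.
have h3 : 2 * p * e * b <= 4 * (p * f * b).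
  have -> : 2 * p * e * b = 2 * (p * b * e) by ring.
  have -> : 4 * (p * f * b) = 2 * (p * b * (2 * f)) by ring.
  by rewrite ler_pM2l// ler_wpM2l// mulr_ge0// ltW.
have h4 : 0 <= p * f * b by rewrite !mulr_ge0// ltW.
have h5 : 0 <= p * f * d by rewrite !mulr_ge0// ltW.
have -> : 4 * p * (b + d) * f = 4 * (p * f * b) + 4 * (p * f * d) by ring.
move: h2; have -> : 2 * p * f * d = 2 * (p * f * d) by ring.
move=> h2; move: h1 h2 h3 h4 h5; move: (2 * p * e * b) (p * f * b) (p * f * d) => X Y Z; lra.
Qed.

Definition coef_bound : R := `|A| + 1.

Definition rho : R := (step_const * (coef_bound ^+ 2 + coef_bound))^-1.

Lemma coef_bound_ge1 : 1 <= coef_bound. Proof. by rewrite lerDr. Qed.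

Lemma step_const_gt0 : 0 < step_const. Proof. by rewrite mulr_gt0// pi_gt0. Qed.

Lemma rho_gt0 : 0 < rho.
Proof.
have b0 : 0 < coef_bound by exact: lt_le_trans ltr01 coef_bound_ge1.
by rewrite invr_gt0 mulr_gt0 ?step_const_gt0// addr_gt0// exprn_gt0.
Qed.

(** The pairs of indices with sum below [N] form a triangle inside the square of all pairs below
    [N]. *)
Lemma convolution_le (a : nat -> R) N : (forall i, 0 <= a i) ->
  \sum_(n < N) \sum_(i < n.+1) a i * a (n - i)%N <= (\sum_(i < N) a i) ^+ 2.
Proof.
move=> a0; pose p := \poly_(i < N) a i.
have p0 n : 0 <= p`_n by rewrite coef_poly; case: ifP.
have sp : (size p <= N)%N by exact: size_poly.
have s2 : (size (p * p)%R <= N + N)%N.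
  by apply: (leq_trans (size_polyMleq _ _)); apply: (leq_trans (leq_pred _)); exact: leq_add.
have -> : \sum_(i < N) a i = p.[1].
  rewrite (horner_coef_wide _ sp); apply: eq_bigr => i _.
  by rewrite expr1n mulr1 coef_poly ltn_ord.
rewrite expr2 -hornerM (horner_coef_wide _ s2) big_split_ord /=.
apply: (@le_trans _ _ (\sum_(i < N) (p * p)`_(lshift N i) * 1 ^+ lshift N i)); last first.
  rewrite lerDl; apply: sumr_ge0 => i _; rewrite expr1n mulr1 coefM.
  by apply: sumr_ge0 => j _; rewrite mulr_ge0.
apply: ler_sum => n _; rewrite expr1n mulr1 coefM le_eqVlt; apply/orP; left; apply/eqP.
apply: eq_bigr => i _; rewrite !coef_poly.
have h := ltn_ord n; have h' := ltn_ord i.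
have -> : (i < N)%N by apply: leq_ltn_trans h; rewrite -ltnS.
by have -> : (n - i < N)%N by apply: leq_ltn_trans h; exact: leq_subr.
Qed.

(* With this radius, S <= |A| + rho step_const (S ^ 2 + S) reproduces S <= |A| + 1
   when passing from one partial sum to the next. *)
Lemma nrm_series_le N : \sum_(n < N) nrm (U n) * rho ^+ n <= coef_bound.
Proof.
have r0 := rho_gt0; have b1 := coef_bound_ge1; have p0 := step_const_gt0.
elim: N => [|N IH]; first by rewrite big_ord0 (le_trans ler01).
rewrite big_ord_recl expr0 mulr1.
have -> : nrm (U 0) = `|A| by rewrite /U /nrm /= big_cons big_nil addr0.
rewrite /coef_bound lerD2l.
apply: (@le_trans _ _ (\sum_(n < N) rho * step_const * ((nrm (convT U n) + nrm (U n)) * rho ^+ n))).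
  apply: ler_sum => n _; rewrite /= exprS.
  have := nrm_U_rec n => h.
  have r1 : 0 <= rho * rho ^+ n by rewrite -exprS exprn_ge0// ltW.
  apply: (le_trans (ler_wpM2r r1 h)); rewrite le_eqVlt; apply/orP; left; apply/eqP; ring.
rewrite -mulr_sumr; under eq_bigr do rewrite mulrDl; rewrite big_split /=.
have h1 : \sum_(n < N) nrm (convT U n) * rho ^+ n <= coef_bound ^+ 2.
  apply: (@le_trans _ _ ((\sum_(n < N) nrm (U n) * rho ^+ n) ^+ 2)); last first.
    rewrite lerXn2r ?nnegrE ?(le_trans ler01 b1)//.
    by apply: sumr_ge0 => n _; rewrite mulr_ge0 ?nrm_ge0// exprn_ge0// ltW.
  apply: le_trans (@convolution_le (fun i => nrm (U i) * rho ^+ i) N _); last first.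
    by move=> i; rewrite mulr_ge0 ?nrm_ge0// exprn_ge0// ltW.
  apply: ler_sum => n _; rewrite nrm_convT mulr_suml; apply: ler_sum => i _.
  rewrite le_eqVlt; apply/orP; left; apply/eqP.
  by rewrite mulrACA -exprD subnKC// -ltnS.
apply: (@le_trans _ _ (rho * step_const * (coef_bound ^+ 2 + coef_bound))).
  by apply: ler_wpM2l; [rewrite mulr_ge0 ?ltW | exact: lerD].
rewrite /rho -mulrA mulVf// mulf_neq0 ?gt_eqF// addr_gt0 ?exprn_gt0 ?(lt_le_trans ltr01 b1)//.
Qed.

Lemma nrm_U_le n : nrm (U n) * rho ^+ n <= coef_bound.
Proof.
apply: le_trans (nrm_series_le n.+1); rewrite big_ord_recr /= lerDr.
by apply: sumr_ge0 => i _; rewrite mulr_ge0 ?nrm_ge0// exprn_ge0// ltW// rho_gt0.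
Qed.

End coefficients.

Section dyadic.
Context {R : realType}.

(** One term of the exponential series at z = (n + 1) / 4 gives z^m / m! <= e^z <= (4/3)^(n + 1),
    and (4/3) / 2 = 2/3. *)
Lemma powX_le_geometric m : exists C : R, 0 <= C /\
  forall n, n.+1%:R ^+ m / 2 ^+ n <= C * (2 / 3) ^+ n.
Proof.
have e4 : expR (4^-1 : R) <= 4 / 3.
  have h := expR_ge1Dx (- 4^-1 : R).
  rewrite -[leLHS]invrK -expRN -[leRHS]invrK lef_pV2 ?posrE ?invr_gt0 ?expR_gt0//.
  by apply: le_trans h; lra.
exists (4 ^+ m * m`!%:R * (4 / 3)); split.
  by rewrite !mulr_ge0// ?exprn_ge0//; lra.
move=> n.
have h : (n.+1%:R / 4) ^+ m / m`!%:R <= (4 / 3) ^+ n.+1 :> R.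
  apply: (@le_trans _ _ (expR (4^-1 : R) ^+ n.+1)); last first.
    by rewrite lerXn2r ?nnegrE ?expR_ge0//; lra.
  rewrite -expRM_natl; have [->|m0] := posnP m.
    rewrite expr0 fact0 divr1 -expR0 ler_expR mulr_ge0//; lra.
  have z0 : 0 <= n.+1%:R / 4 :> R by rewrite divr_ge0.
  by have := expR_ge1Dxn m.-1 z0; rewrite prednK//; lra.
have f0 : 0 < m`!%:R :> R by rewrite ltr0n fact_gt0.
move: h; rewrite expr_div_n ler_pdivrMr// ler_pdivrMr ?exprn_gt0// => h.
rewrite ler_pdivrMr ?exprn_gt0//; apply: (le_trans h).
have -> : (4 / 3) ^+ n.+1 = 4 / 3 * ((2 / 3) ^+ n * 2 ^+ n) :> R.
  by rewrite exprS -exprMn; congr (_ * _ ^+ _); lra.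
by move: (4 ^+ m) (m`!%:R) ((2 / 3) ^+ n) (2 ^+ n) => a b c d; rewrite le_eqVlt; apply/orP; left; apply/eqP; ring.
Qed.

Lemma summable_powX_dyadic m : summable_seq (fun n => n.+1%:R ^+ m / 2 ^+ n : R).
Proof.
have [C [C0 hC]] := powX_le_geometric m.
apply: (@normal_cvg _ _ (fun n => C * (2 / 3) ^+ n)).
  by move=> n; rewrite ger0_norm// divr_ge0// exprn_ge0.
by apply: is_cvg_geometric_series; rewrite ger0_norm//; lra.
Qed.

End dyadic.

(** * Integration by parts and decay of Fourier coefficients *)

Section by_parts.
Context {R : realType}.
Implicit Types (F : nat -> R -> R).

Lemma by_parts (f f1 g g1 : R -> R) :
  (forall x : R, is_derive x 1 f (f1 x)) -> (forall x : R, is_derive x 1 g (g1 x)) ->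
  continuous f1 -> continuous g1 -> periodic f 1 -> periodic g 1 ->
  I01 (fun x => f x * g1 x) = - I01 (fun x => f1 x * g x).
Proof.
move=> df dg cf1 cg1 pf pg.
have cf := derive_continuous df; have cg := derive_continuous dg.
apply/eqP; rewrite -subr_eq0 opprK -I01D; last 2 first.
- by apply: ok01M_cont => //; exact: ok01_cont.
- by apply: ok01M_cont => //; exact: ok01_cont.
have H (x : R) : is_derive x 1 (fun y => f y * g y) (f x * g1 x + f1 x * g x).
  have h1 := df x; have h2 := dg x.
  rewrite -[fun y => _]/(f * g); apply: is_derive_eq.
  by rewrite /GRing.scale /= [g x * _]mulrC.
rewrite (I01_deriv _ H); first by rewrite -[1]add0r pf pg subrr.
by move=> x; apply: cvgD; apply: cvgM; [exact: cf|exact: cg1|exact: cf1|exact: cg].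
Qed.

(** [F] lists the successive derivatives. Each integration by parts moves one step along the list,
    divides by the frequency and shifts the phase of the wave. *)
Lemma wave_coef_bound F m K k a :
  (forall j (x : R), is_derive x 1 (F j) (F j.+1 x)) -> (forall j, periodic (F j) 1) ->
  (forall x, 0 <= x <= 1 -> `|F m x| <= K) -> (0 < k)%N ->
  `|I01 (fun x => F 0%N x * wave k a x)| <= K / (2 * pi * k%:R) ^+ m.
Proof.
move=> + + + k0; have p0 := @pi2k_gt0 R _ k0.
elim: m F a => [|m IH] F a dF pF hK.
  rewrite expr0 divr1; apply: I01_bound.
    apply: ok01M_cont; last exact: wave_cont.
    exact/ok01_cont/(derive_continuous (dF 0%N)).
  by move=> x hx; rewrite normrM -[K]mulr1 ler_pM ?wave_le1 ?hK.
have cF j := derive_continuous (dF j).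
have dw : forall x : R, is_derive x 1 (fun x => (2 * pi * k%:R)^-1 * wave k (a - pi / 2) x) (wave k a x).
  move=> x; have := is_derive_wave k (a - pi / 2) x => h.
  rewrite -[fun x => _]/((2 * pi * k%:R)^-1 \*: wave k (a - pi / 2)).
  apply: is_derive_eq; rewrite /GRing.scale /= .
  by rewrite ?subrK mulrA mulVf ?gt_eqF// mul1r.
rewrite (@by_parts _ (F 1%N) _ _ (dF 0%N) dw) => //.
- rewrite normrN.
  have -> : I01 (fun x => F 1%N x * ((2 * pi * k%:R)^-1 * wave k (a - pi / 2) x)) =
      (2 * pi * k%:R)^-1 * I01 (fun x => F 1%N x * wave k (a - pi / 2) x).
    rewrite -I01Z; first by congr I01; apply/funext => x; rewrite mulrCA.
    by apply: ok01M_cont; [exact/ok01_cont/cF | exact: wave_cont].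
  rewrite normrM ger0_norm ?invr_ge0 ?(ltW p0)//.
  have := IH (fun j => F j.+1) (a - pi / 2) (fun j => dF j.+1) (fun j => pF j.+1) hK.
  move: p0 (`|_|); rewrite exprSr; move: (2 * pi * k%:R) => p p0 z.
  by move=> h; rewrite invfM mulrA [_^-1 * z]mulrC ler_pM2r ?invr_gt0.
- exact: wave_cont.
- by move=> x; rewrite wave_periodic.
Qed.

End by_parts.

(** * Regularity of the power series solution *)

Section tower_sobolev.
Context {R : realType}.
Implicit Types (F : nat -> R -> R).

Definition inv_square_sum : R := limn (series (fun k => (2 * pi * k.+1%:R) `^ (- 2) : R)).

Lemma inv_square_sum_ub n : series (fun k => (2 * pi * k.+1%:R) `^ (- 2) : R) n <= inv_square_sum.
Proof.
apply: nondecreasing_cvgn_le; last by apply: summable_powR; lra.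
by apply: nondecreasing_series => k _ _; exact: powR_ge0.
Qed.

Lemma inv_square_sum_ge0 : 0 <= inv_square_sum.
Proof. by apply: le_trans (inv_square_sum_ub 0); rewrite /series /= big_geq. Qed.

(** The weight has exponent 2 r, and [m] integrations by parts gain 2 m in the squares; [m >= r + 1]
    leaves the summable exponent -2. *)
Lemma eterm_tower F m K r k :
  (forall j (x : R), is_derive x 1 (F j) (F j.+1 x)) -> (forall j, periodic (F j) 1) ->
  (forall x, 0 <= x <= 1 -> `|F m x| <= K) -> r + 1 <= m%:R -> (0 < k)%N ->
  eterm r (F 0%N) k <= 4 * K ^+ 2 * (2 * pi * k%:R) `^ (- 2).
Proof.
move=> dF pF hK rm k0.
have h1 := wave_coef_bound 0 dF pF hK k0.
have h2 := wave_coef_bound (- (pi / 2)) dF pF hK k0.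
rewrite /eterm fcosE fsinE.
have p1 := @pi2k_ge1 R _ k0; move: h1 h2; move: (I01 _) (I01 _) => a b.
move: p1; move: (2 * pi * k%:R) => p p1 ha hb.
have p0 : 0 < p by exact: lt_le_trans ltr01 p1.
have q2 c : `|c| <= K / p ^+ m -> c ^+ 2 <= K ^+ 2 / (p ^+ m) ^+ 2.
  move=> h; rewrite -real_normK ?num_real// -expr_div_n lerXn2r ?nnegrE//.
  exact: le_trans h.
have E : p `^ (2 * r) / (p ^+ m) ^+ 2 <= p `^ (- 2).
  rewrite -exprM -(powR_mulrn _ (ltW p0)) -powRN -powRD; last by rewrite (gt_eqF p0) implybT.
  by apply: ler_powR => //; rewrite natrM; lra.
have {ha hb} H : a ^+ 2 + b ^+ 2 <= 2 * (K ^+ 2 / (p ^+ m) ^+ 2).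
  by have := q2 _ ha; have := q2 _ hb; lra.
have W : 0 <= p `^ (2 * r) by exact: powR_ge0.
have k20 : 0 <= K ^+ 2 by exact: sqr_ge0.
have h3 : 2 * p `^ (2 * r) * (a ^+ 2 + b ^+ 2) <= 2 * p `^ (2 * r) * (2 * (K ^+ 2 / (p ^+ m) ^+ 2)).
  by apply: ler_wpM2l => //; rewrite mulr_ge0.
rewrite [b ^+ 2 + _]addrC; apply: (le_trans h3); have := ler_wpM2l k20 E.
move: (p `^ (2 * r)) (K ^+ 2) ((p ^+ m) ^+ 2)^-1 (p `^ (- 2)) => w z v y.
have -> : 2 * w * (2 * (z * v)) = 4 * (z * (w * v)) by ring.
have -> : 4 * z * y = 4 * (z * y) by ring.
by move=> h; rewrite ler_pM2l.
Qed.

Lemma tower_energy F m K r :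
  (forall j (x : R), is_derive x 1 (F j) (F j.+1 x)) -> (forall j, periodic (F j) 1) ->
  (forall x, 0 <= x <= 1 -> `|F m x| <= K) -> r + 1 <= m%:R ->
  energy_le r (4 * K ^+ 2 * inv_square_sum) (F 0%N).
Proof.
move=> dF pF hK rm n.
have K0 : 0 <= 4 * K ^+ 2 by rewrite mulr_ge0// sqr_ge0.
have := ler_wpM2l K0 (inv_square_sum_ub n.-1); apply: le_trans.
rewrite big_add1 /series /= mulr_sumr; apply: ler_sum => k _.
exact: eterm_tower dF pF hK rm _.
Qed.

Lemma tower_sobolev F m K r : 0 <= K ->
  (forall j (x : R), is_derive x 1 (F j) (F j.+1 x)) -> (forall j, periodic (F j) 1) ->
  (forall x, 0 <= x <= 1 -> `|F m x| <= K) -> r + 1 <= m%:R ->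
  (sobolev_norm r (F 0%N) <= (2 * K * Num.sqrt inv_square_sum)%:E)%E.
Proof.
move=> K0 dF pF hK rm; have h := tower_energy dF pF hK rm.
have := sobolev_of_energy _ h.
have -> : Num.sqrt (4 * K ^+ 2 * inv_square_sum) = 2 * K * Num.sqrt inv_square_sum.
  rewrite -[4 * _](_ : (2 * K) ^+ 2 = _); last by rewrite exprMn; ring.
  by rewrite sqrtrM ?sqr_ge0// sqrtr_sqr ger0_norm// mulr_ge0.
by apply; rewrite mulr_ge0 ?inv_square_sum_ge0// mulr_ge0// sqr_ge0.
Qed.

End tower_sobolev.

Section series_solution.
Context {R : realType}.
Variables (alpha A : R).
Hypothesis halpha : 0 < alpha < 1 / 2.
Local Notation U := (U alpha A).
Implicit Types (t x : R).

(** At half the radius, the factors 2^-n absorb the powers of n that differentiation produces, so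
    all x-derivatives converge on the same time interval. *)
Definition tmax : R := rho A / 2.

Lemma tmax_gt0 : 0 < tmax.
Proof. by rewrite divr_gt0// rho_gt0. Qed.

Definition deriv_coef m n : seq (@term R) := iter m (map dterm) (U n).

Definition maj m n : R := (2 * pi * n.+1%:R) ^+ m * nrm (U n) * tmax ^+ n.

Lemma maj_ge0 m n : 0 <= maj m n.
Proof.
by rewrite /maj !mulr_ge0 ?nrm_ge0 ?exprn_ge0 ?ltW ?tmax_gt0// mulr_gt0 ?pi2_gt0.
Qed.

Lemma summable_maj m : summable_seq (maj m).
Proof.
apply: (@normal_cvg _ _ (fun n => (2 * pi) ^+ m * coef_bound A * (n.+1%:R ^+ m / 2 ^+ n))).
  move=> n; rewrite ger0_norm ?maj_ge0// /maj /tmax exprMn expr_div_n.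
  have := nrm_U_le A halpha n.
  have : 0 <= (2 * pi) ^+ m * (n.+1%:R ^+ m / 2 ^+ n) :> R.
    by rewrite mulr_ge0 ?exprn_ge0 ?ltW ?pi2_gt0// divr_ge0// exprn_ge0.
  move: (nrm _) (rho A ^+ n) ((2 * pi) ^+ m) (n.+1%:R ^+ m) (2 ^+ n)^-1 (coef_bound A) => a b c d e f h0 h.
  have := ler_wpM2l h0 h.
  have -> : c * (d * e) * (a * b) = c * d * a * (b * e) by ring.
  by have -> : c * (d * e) * f = c * f * (d * e) by ring.
rewrite /summable_seq -[fun n => _]/(((2 * pi) ^+ m * coef_bound A) *: (fun n => n.+1%:R ^+ m / 2 ^+ n)).
by apply: is_cvg_seriesZ; exact: summable_powX_dyadic.
Qed.

Lemma degle_deriv_coef m n : degle n.+1 (deriv_coef m n).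
Proof. by elim: m => [|m IH]; [exact: degle_U | rewrite /deriv_coef iterS degle_dterm]. Qed.

Lemma nrm_deriv_coef m n : nrm (deriv_coef m n) <= (2 * pi * n.+1%:R) ^+ m * nrm (U n).
Proof.
elim: m => [|m IH]; first by rewrite expr0 mul1r.
rewrite /deriv_coef iterS; apply: (le_trans (nrm_dterm (degle_deriv_coef m n))).
rewrite exprS -[leRHS]mulrA; apply: ler_wpM2l => //.
by rewrite ltW// mulr_gt0 ?pi2_gt0.
Qed.

Definition uterm m t n (x : R) : R := t ^+ n * tp (deriv_coef m n) x.

Definition um m t : R -> R := nser (uterm m t).

Lemma uterm_le m t n x : `|t| <= tmax -> `|uterm m t n x| <= maj m n.
Proof.
move=> ht; rewrite /uterm /maj normrM normrX mulrC ler_pM//.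
  exact: le_trans (tp_nrm _ _) (nrm_deriv_coef m n).
by rewrite lerXn2r ?nnegrE// ltW// tmax_gt0.
Qed.

Lemma uterm_deriv m t n (x : R) : is_derive x 1 (uterm m t n) (uterm m.+1 t n x).
Proof.
have h := tp_deriv (deriv_coef m n) x; rewrite -[uterm m t n]/((t ^+ n) \*: tp (deriv_coef m n)).
exact: is_derive_eq.
Qed.

Lemma um_deriv m t (x : R) : `|t| <= tmax -> is_derive x 1 (um m t) (um m.+1 t x).
Proof.
move=> ht; apply: (@nser_deriv _ _ _ (maj m) (maj m.+1) (maj m.+2)).
- move=> k y z; apply: (taylor1_bound (uterm_deriv m t k) (uterm_deriv m.+1 t k)).
  by move=> w; exact: uterm_le.
- by move=> k y; exact: uterm_le.
- by move=> k y; exact: uterm_le.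
- exact: summable_maj.
- exact: summable_maj.
- exact: summable_maj.
Qed.

Lemma um_periodic m t : periodic (um m t) 1.
Proof.
move=> x; rewrite /um /nser; congr (limn (series _)); apply/funext => n.
by rewrite /uterm tp_periodic.
Qed.

Lemma uterm_cvg m t x : `|t| <= tmax ->
  series (fun n => uterm m t n x) @ \oo --> um m t x.
Proof.
move=> ht; have h n : `|uterm m t n x| <= maj m n by exact: uterm_le.
by have := normal_cvg h (@summable_maj m).
Qed.

(** The factor [tmax] on the left replaces the exponent n - 1 of the mean value bound, so that n = 0
    fits the same formula. *)
Lemma powX_lip (t t0 : R) n : `|t| <= tmax -> `|t0| <= tmax ->
  tmax * `|t ^+ n - t0 ^+ n| <= n%:R * tmax ^+ n * `|t - t0|.
Proof.
move=> ht ht0; have T0 := tmax_gt0.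
elim: n => [|n IH]; first by rewrite subrr normr0 mulr0 mul0r mul0r.
have -> : t ^+ n.+1 - t0 ^+ n.+1 = t * (t ^+ n - t0 ^+ n) + (t - t0) * t0 ^+ n by rewrite !exprS; ring.
have h1 : `|t * (t ^+ n - t0 ^+ n)| <= tmax * `|t ^+ n - t0 ^+ n| by rewrite normrM ler_wpM2r.
have h2 : `|(t - t0) * t0 ^+ n| <= `|t - t0| * tmax ^+ n.
  by rewrite normrM normrX ler_wpM2l// lerXn2r ?nnegrE// ltW.
apply: (le_trans (ler_wpM2l (ltW T0) (ler_normD _ _))).
apply: (@le_trans _ _ (tmax * (n%:R * tmax ^+ n * `|t - t0| + `|t - t0| * tmax ^+ n))).
  by rewrite ler_pM2l//; apply: lerD => //; exact: le_trans h1 IH.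
rewrite exprS -natr1 le_eqVlt; apply/orP; left; apply/eqP; ring.
Qed.

Definition um_lip_const m : R := tmax^-1 * limn (series (maj m.+1)).

Lemma um_lip_const_ge0 m : 0 <= um_lip_const m.
Proof.
rewrite mulr_ge0 ?invr_ge0 ?(ltW tmax_gt0)// -[0](_ : series (maj m.+1) 0 = _).
  apply: nondecreasing_cvgn_le; last exact: summable_maj.
  by apply: nondecreasing_series => k _ _; exact: maj_ge0.
by rewrite /series /= big_geq.
Qed.

(** Varying t^n costs n <= 2 pi (n + 1), no more than one further x-derivative: hence the majorant
    of order [m.+1]. *)
Lemma um_lip m t (t0 : R) x : `|t| <= tmax -> `|t0| <= tmax ->
  `|um m t x - um m t0 x| <= um_lip_const m * `|t - t0|.
Proof.
move=> ht ht0; have T0 := tmax_gt0.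
have c1 := @uterm_cvg m t x ht; have c2 := @uterm_cvg m t0 x ht0.
have c3 : series (fun n => uterm m t n x - uterm m t0 n x) @ \oo --> um m t x - um m t0 x.
  rewrite (_ : series _ = (fun n => series (fun n => uterm m t n x) n - series (fun n => uterm m t0 n x) n)).
    exact: cvgB.
  by apply/funext => n; rewrite /series /= sumrB.
rewrite -(lim_series_unique c3).
have cM : summable_seq (fun n => (tmax^-1 * `|t - t0|) * maj m.+1 n).
  rewrite /summable_seq -[fun n => _]/((tmax^-1 * `|t - t0|) *: maj m.+1).
  by apply: is_cvg_seriesZ; exact: summable_maj.
have -> : um_lip_const m * `|t - t0| = limn (series (fun n => (tmax^-1 * `|t - t0|) * maj m.+1 n)).
  apply/esym; rewrite -[fun n => _]/((tmax^-1 * `|t - t0|) *: maj m.+1).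
  by rewrite lim_seriesZ ?/um_lip_const; [rewrite /GRing.scale /= mulrAC | exact: summable_maj].
apply: normal_bound cM => n.
rewrite /uterm -mulrBl normrM.
have h1 := powX_lip n ht ht0.
have h2 := le_trans (tp_nrm (deriv_coef m n) x) (nrm_deriv_coef m n).
have n0 := nrm_ge0 (U n).
have q1 : n%:R <= 2 * pi * n.+1%:R :> R.
  apply: (@le_trans _ _ n.+1%:R); first by rewrite ler_nat.
  by rewrite ler_peMl//; have := @pi2k_ge1 R 1 isT; rewrite mulr1.
have N0 : 0 <= (2 * pi * n.+1%:R) ^+ m * nrm (U n) by exact: le_trans h2.
rewrite /maj exprS -[tmax^-1 * _ * _]mulrA ler_pdivlMl// mulrA.
have TT : 0 <= tmax ^+ n by rewrite exprn_ge0// ltW.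
apply: (le_trans (ler_pM _ _ h1 h2)) => //; first by rewrite mulr_ge0// ltW.
move: q1 N0 TT (normr_ge0 (t - t0)).
move: (n%:R : R) (tmax ^+ n) (`|t - t0|) (2 * pi * n.+1%:R) => a b c d q1.
move: (d ^+ m) (nrm (U n)) => e f N0 b0 c0.
have -> : a * b * c * (e * f) = a * (b * c * (e * f)) by ring.
have -> : c * (d * e * f * b) = d * (b * c * (e * f)) by ring.
by apply: ler_wpM2r => //; exact: mulr_ge0 (mulr_ge0 b0 c0) N0.
Qed.

End series_solution.

Lemma I01_tp_dterm (R : realType) (l : seq (@term R)) : I01 (tp (map dterm l)) = 0.
Proof.
rewrite (I01_deriv _ (tp_deriv l)); last exact: tp_cont.
by rewrite -[1]add0r tp_periodic subrr.
Qed.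

Lemma I01_tp_lterm (R : realType) (alpha : R) (l : seq (@term R)) : 0 < alpha ->
  I01 (tp (map (lterm alpha) l)) = 0.
Proof.
move=> a0; elim: l => [|p l IH].
  rewrite -(I01_tp_dterm [::]); congr I01.
rewrite -(IH) /=; transitivity (I01 (fun x => tp [:: lterm alpha p] x + tp (map (lterm alpha) l) x)).
  by congr I01; apply/funext => x; rewrite !tp_cons tp_nil addr0.
rewrite I01D; [|exact/ok01_cont/tp_cont|exact/ok01_cont/tp_cont].
rewrite (_ : I01 (tp [:: _]) = 0) ?add0r//.
have -> : tp [:: lterm alpha p] = (fun x => (lterm alpha p).1 * wave p.2.1 p.2.2 x).
  by apply/funext => x; rewrite tp_cons tp_nil addr0.
rewrite I01Z; last exact: ok01_wave.
have [k0|k0] := posnP p.2.1; last by rewrite I01_wave// mulr0.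
by rewrite /= k0 mulr0 powR0 ?mul0r ?mulr0 ?mulf_neq0 ?gt_eqF ?mul0r.
Qed.

Section solution_regularity.
Context {R : realType}.
Variables (alpha A : R).
Hypothesis halpha : 0 < alpha < 1 / 2.
Local Notation U := (U alpha A).
Local Notation um := (um alpha A).
Local Notation tmax := (tmax A).
Implicit Types (t x : R).

Lemma I01_tp_U n : I01 (tp (U n)) = 0.
Proof.
have /andP[a0 _] := halpha.
case: n => [|n].
  rewrite -[tp _]/(tp [:: (A, (1%N, - (pi / 2)))]).
  have -> : tp [:: (A, (1%N, - (pi / 2)))] = (fun x => A * wave 1 (- (pi / 2)) x).
    by apply/funext => x; rewrite tp_cons tp_nil addr0.
  by rewrite I01Z ?I01_wave ?mulr0//; exact: ok01_wave.
have /(congr1 (fun f => I01 f)) : (fun x => n.+1%:R * tp (U n.+1) x) =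
    (fun x => 2^-1 * tp (map dterm (convT U n)) x - tp (map (lterm alpha) (U n)) x).
  by apply/funext => x; exact: tp_U_rec.
have ok l : ok01 (tp l : R -> R) by exact/ok01_cont/tp_cont.
rewrite I01Z// I01B//; last by apply: ok01Z; exact: ok.
rewrite I01Z// I01_tp_dterm I01_tp_lterm// mulr0 subr0 => /eqP.
by rewrite mulf_eq0 pnatr_eq0 /= => /eqP.
Qed.

Lemma um_cont m t : `|t| <= tmax -> continuous (um m t).
Proof. by move=> ht; apply: derive_continuous => x; exact: um_deriv. Qed.

Lemma um_nser_I01 t g : `|t| <= tmax -> continuous g ->
  series (fun n => t ^+ n * I01 (fun x => tp (U n) x * g x)) @ \oo -->
    I01 (fun x => um 0 t x * g x).
Proof.
move=> ht cg.
have h := @nser_I01 _ (uterm alpha A 0 t) (maj alpha A 0) g (fun n x => uterm_le halpha 0 n x ht)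
  (@summable_maj _ alpha A halpha 0).
have -> : (fun n => t ^+ n * I01 (fun x => tp (U n) x * g x)) =
    (fun n => I01 (fun x => uterm alpha A 0 t n x * g x)).
  apply/funext => n; rewrite -I01Z; last by apply: ok01M_cont => //; exact/ok01_cont/tp_cont.
  by congr I01; apply/funext => x; rewrite mulrA.
apply: h => // n; apply: derive_continuous => x; exact: uterm_deriv.
Qed.

Lemma I01_um t : `|t| <= tmax -> I01 (um 0 t) = 0.
Proof.
move=> ht; have c1 : continuous (fun _ : R => 1 : R) by move=> x; exact: cvg_cst.
have := um_nser_I01 ht c1.
have -> : (fun x => um 0 t x * 1) = um 0 t by apply/funext => x; rewrite mulr1.
move/lim_series_unique => <-; apply: lim_series_unique.
rewrite (_ : series _ = fun=> 0); first exact: cvg_cst.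
apply/funext => n; rewrite /series /=; apply: big1 => k _.
have -> : (fun x => tp (U k) x * 1) = tp (U k) by apply/funext => x; rewrite mulr1.
by rewrite I01_tp_U mulr0.
Qed.

Lemma um_smooth t : `|t| <= tmax -> smooth_periodic (um 0 t).
Proof.
move=> ht; split; last exact: um_periodic.
by have [] := smooth_of_derivs (fun m x => um_deriv halpha m x ht).
Qed.

Lemma um_init : um 0 0 = tp (U 0).
Proof.
apply/funext => x; apply: lim_series_unique; apply: cvg_near_cst.
exists 1%N => // -[//|n] _; rewrite /series /= big_nat_recl//= /uterm expr0 mul1r.
by rewrite big1 ?addr0// => k _; rewrite expr0n /= mul0r.
Qed.

Lemma um_bounded m t : `|t| <= tmax -> exists2 K, 0 <= K & forall x, `|um m t x| <= K.
Proof.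
move=> ht; exists (limn (series (maj alpha A m))) => [|x].
  have := normal_bound (fun n => uterm_le halpha m n 0 ht) (@summable_maj _ alpha A halpha m).
  exact: le_trans.
exact: (normal_bound (fun n => uterm_le halpha m n x ht) (@summable_maj _ alpha A halpha m)).
Qed.

Lemma um_in_sobolev r t : 0 <= r -> `|t| <= tmax -> in_sobolev r (um 0 t).
Proof.
move=> r0 ht; have cu := @um_cont 0%N t ht; split.
- exact: um_periodic.
- exact: continuous_measurable_fun.
- apply: (@ok01_cont _ (fun x => um 0 t x ^+ 2)); exact: cont_sqr.
- exact: I01_um.
- have [m hm] : exists m : nat, r + 1 <= m%:R.
    by exists (Num.truncn (r + 1)).+1; apply/ltW/truncnS_gt.
  have [K K0 hK] := um_bounded m ht.
  have := @tower_sobolev _ (fun m => um m t) m K r K0 (fun m x => um_deriv halpha m x ht)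
    (fun m => um_periodic alpha A m t) (fun x _ => hK x) hm.
  by move=> /le_lt_trans; apply; rewrite ltry.
Qed.

(** The derivatives of a difference of two time slices again form a tower; the Lipschitz bound at an
    order [m >= r + 1] makes the solution Lipschitz in time with values in H^r. *)
Lemma um_continuous_in_sobolev r : 0 <= r -> continuous_in_sobolev r tmax (um 0).
Proof.
move=> r0; have ht t : 0 <= t < tmax -> `|t| <= tmax.
  by move=> /andP[t0 tT]; rewrite ger0_norm// ltW.
split=> [t /ht|t0 /ht ht0]; first exact: um_in_sobolev.
have [m hm] : exists m : nat, r + 1 <= m%:R.
  by exists (Num.truncn (r + 1)).+1; apply/ltW/truncnS_gt.
have L0 := @um_lip_const_ge0 _ alpha A halpha m.
have B t : 0 <= t < tmax ->
    (sobolev_norm r (fun x => um 0%N t x - um 0%N t0 x)%R <=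
      (2 * (um_lip_const alpha A m * `|t - t0|) * Num.sqrt inv_square_sum)%:E)%E.
  move=> /ht ht1; apply: (@tower_sobolev _ (fun m x => um m t x - um m t0 x) m) => //.
  - by rewrite mulr_ge0.
  - move=> j x; have h1 := um_deriv halpha j x ht1; have h2 := um_deriv halpha j x ht0.
    exact: is_deriveB.
  - by move=> j x; rewrite !um_periodic.
  - by move=> x _; exact: um_lip.
apply: (@squeeze_cvge _ _ _ _ (cst 0%E) _ (fun t => (2 * (um_lip_const alpha A m * `|t - t0|) * Num.sqrt inv_square_sum)%:E)).
- near=> t; apply/andP; split; first exact: poweR_ge0.
  by apply: B; near: t; exact: withinT.
- exact: cvg_cst.
- apply: cvg_within_filter; apply: cvg_EFin; first by apply: nearW.
  have -> : 0 = 2 * (um_lip_const alpha A m * `|t0 - t0|) * Num.sqrt inv_square_sum by rewrite subrr normr0 !(mulr0,mul0r).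
  rewrite /comp /=; apply: cvgM; last exact: cvg_cst.
  apply: cvgM; first exact: cvg_cst.
  apply: cvgM; first exact: cvg_cst.
  by apply: cvg_norm; apply: cvgB; [exact: cvg_id | exact: cvg_cst].
Unshelve. all: by end_near. Qed.

End solution_regularity.

(** * The weak form of the equation *)

Section mertens.
Context {R : realType}.
Implicit Types u M : R^nat.

Definition conv u n : R := \sum_(i < n.+1) u i * u (n - i)%N.

Lemma summable_conv M : (forall n, 0 <= M n) -> summable_seq M -> summable_seq (conv M).
Proof.
move=> M0 cM; apply: (@summable_bounded _ _ (limn (series M) ^+ 2)) => [n|N].
  by apply: sumr_ge0 => i _; rewrite mulr_ge0.
have S0 N' : 0 <= series M N' by apply: sumr_ge0.
have le1 : series M N <= limn (series M).
  by apply: nondecreasing_cvgn_le => //; apply: nondecreasing_series => k _ _.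
apply: (@le_trans _ _ (series M N ^+ 2)); last first.
  by rewrite lerXn2r ?nnegrE// (le_trans (S0 N)).
by rewrite /series /= !big_mkord; exact: convolution_le.
Qed.

(** The squared partial sum and the partial sum of the convolution differ only in indices from [N]
    on, hence by at most a tail of [conv M]. *)
Lemma mertens_square u M : (forall n, `|u n| <= M n) -> summable_seq M ->
  series (conv u) @ \oo --> limn (series u) ^+ 2.
Proof.
move=> uM cM; have M0 n : 0 <= M n by exact: le_trans (uM n).
have cC := summable_conv M0 cM.
have C0 n : 0 <= conv M n by apply: sumr_ge0 => i _; rewrite mulr_ge0.
have cu : series u @ \oo --> limn (series u) by exact: (normal_cvg uM cM).
have c2 : (fun N => series u N ^+ 2) @ \oo --> limn (series u) ^+ 2.
  by under eq_fun do rewrite expr2; rewrite expr2; exact: cvgM.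
rewrite -[limn (series u) ^+ 2](subr0).
rewrite (_ : series (conv u) = (fun N => series u N ^+ 2 - (series u N ^+ 2 - series (conv u) N))); last first.
  by apply/funext => N; rewrite opprB addrC subrK.
apply: cvgB => //; apply/norm_cvg0P.
apply: (squeeze_cvgr _ (cvg_cst 0) (rest_cvg0 cC)).
apply: nearW => N /=; rewrite normr_ge0 /=.
have [c [cE cN cB]] := cauchy_square u N.
have -> : series u N ^+ 2 - series (conv u) N = \sum_(N <= n < N + N) c n.
  rewrite /series /= !big_mkord cE -(big_mkord xpredT c) (@big_cat_nat _ _ _ N)//= ?leq_addr//.
  rewrite [X in X + _ - _]big_mkord (_ : \sum_(i < N) c i = \sum_(i < N) conv u i) 1?addrC ?addKr//.
  by apply: eq_bigr => i _; exact: cN.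
apply: (le_trans (ler_norm_sum _ _ _)).
apply: (@le_trans _ _ (series (conv M) (N + N)%N - series (conv M) N)).
  rewrite sub_series_geq ?leq_addr//; apply: ler_sum => n _.
  by apply: (le_trans (cB n)); apply: ler_sum => i _; rewrite ler_pM.
rewrite /rest lerB//; apply: nondecreasing_cvgn_le => //.
by apply: nondecreasing_series => k _ _.
Qed.

End mertens.

(** * The fractional Laplacian of a smooth periodic function *)

Section fractional_laplacian_theory.
Context {R : realType}.
Variables (alpha : R) (phi : R -> R).
Hypothesis halpha : 0 < alpha < 1 / 2.
Hypothesis sphi : smooth_periodic phi.
Implicit Types (x : R) (k j : nat).

Lemma smooth_tower m x : is_derive x 1 (derive1n m phi) (derive1n m.+1 phi x).
Proof.
have [sm _] := sphi; have := sm m x; rewrite derive1nS derive1E => h.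
exact/derivableP.
Qed.

Lemma smooth_tower_periodic m : periodic (derive1n m phi) 1.
Proof.
have [_ pp] := sphi; elim: m => // m IH x.
have h : is_derive x 1 (derive1n m phi) (derive1n m.+1 phi (x + 1)).
  rewrite (_ : derive1n m phi = derive1n m phi \o (fun y => y + 1)); last first.
    by apply/funext => y; rewrite /= IH.
  have h1 := smooth_tower m (x + 1).
  have h2 : is_derive x 1 (fun y : R => y + 1) 1 by apply: is_derive_eq; rewrite addr0.
  by have := @is_derive1_comp _ (derive1n m phi) (fun y : R => y + 1) x _ _ h1 h2; rewrite mulr1.
by case: h => _ <-; case: (smooth_tower m x).
Qed.

Lemma smooth_cont m : continuous (derive1n m phi).
Proof. exact/derive_continuous/smooth_tower. Qed.

Lemma phi_cont : continuous phi. Proof. exact: (@smooth_cont 0%N). Qed.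

Definition fterm k x : R := lam alpha k.+1 * tp (vterm phi k.+1) x.

(** Three integrations by parts give the power -3 of the frequency, and the multiplier costs at most
    one power back. *)
Lemma fterm_bound : exists K, forall k x, `|fterm k x| <= K * (2 * pi * k.+1%:R) `^ (- 2).
Proof.
have [K hK] := cont_bounded01 (@smooth_cont 3%N).
exists (4 * K) => k x.
have b a := wave_coef_bound a smooth_tower smooth_tower_periodic hK (ltn0Sn k).
have h : fabs phi k.+1 <= 4 * K / (2 * pi * k.+1%:R) ^+ 3.
  rewrite /fabs fcosE fsinE -mulrA; have := b 0; have := b (- (pi / 2)).
  rewrite /=; move: `|_| `|_| (K / _) => p q w; lra.
have p1 := @pi2k_ge1 R k.+1 isT.
have l0 : 0 <= lam alpha k.+1 by exact: lam_ge0.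
rewrite /fterm normrM ger0_norm//.
apply: (le_trans (ler_pM _ _ (lam_le k.+1 halpha) (le_trans (tp_vterm_le phi k.+1 x) h))) => //.
move: p1; move: (2 * pi * k.+1%:R) => p p1; have p0 : 0 < p by exact: lt_le_trans p1.
have -> : p `^ (- 2) = (p ^+ 2)^-1 by rewrite powRN powR_mulrn// ltW.
rewrite le_eqVlt; apply/orP; left; apply/eqP; field.
by rewrite gt_eqF.
Qed.

Lemma fterm_cont k : continuous (fterm k).
Proof.
move=> x; apply: cvgM; first exact: cvg_cst.
exact: tp_cont.
Qed.

Lemma summable_fterm K : summable_seq (fun k => K * (2 * pi * k.+1%:R) `^ (- 2) : R).
Proof.
rewrite /summable_seq -[fun k => _]/(K *: (fun k => (2 * pi * k.+1%:R) `^ (- 2) : R)).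
by apply: is_cvg_seriesZ; apply: summable_powR; lra.
Qed.

Lemma fractional_laplacian_nser : fractional_laplacian alpha phi = nser fterm.
Proof.
apply/funext => x; rewrite /fractional_laplacian /nser.
rewrite (_ : (fun n => _) = (fun n => series (fterm^~ x) n.-1)); last first.
  apply/funext => n; rewrite big_add1 /series /=; apply: eq_bigr => k _.
  rewrite /fterm tp_vterm -cos_wave -sin_wave /lam; ring.
have [K hK] := fterm_bound.
have c : series (fterm^~ x) @ \oo --> limn (series (fterm^~ x)).
  exact: (normal_cvg (hK^~ x) (@summable_fterm K)).
apply: cvg_lim => //; rewrite -cvg_shiftS.
exact: c.
Qed.

Lemma fractional_laplacian_cont : continuous (fractional_laplacian alpha phi).
Proof.
have [K hK] := fterm_bound; rewrite fractional_laplacian_nser.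
apply: (nser_cont hK); [exact: summable_fterm | exact: fterm_cont].
Qed.

(** Termwise integration leaves the frequency [j] alone. For [j = 0] no term is left, in agreement
    with [lam alpha 0 = 0]. *)
Lemma fractional_laplacian_wave j a :
  I01 (fun x => wave j a x * fractional_laplacian alpha phi x) =
  lam alpha j * I01 (fun x => wave j a x * phi x).
Proof.
have /andP[a0 _] := halpha.
have [K hK] := fterm_bound; rewrite fractional_laplacian_nser.
have h := nser_I01 hK (@summable_fterm K) fterm_cont (@wave_cont _ j a).
have -> : I01 (fun x => wave j a x * nser fterm x) = I01 (fun x => nser fterm x * wave j a x).
  by congr I01; apply/funext => x; rewrite mulrC.
rewrite -(lim_series_unique h).
set c := lam alpha j * _.
have E k : I01 (fun x => fterm k x * wave j a x) = if k.+1 == j then c else 0.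
  have -> : (fun x => fterm k x * wave j a x) = (fun x =>
      (lam alpha k.+1 * (2 * fcos phi k.+1)) * (wave j a x * wave k.+1 0 x) +
      (lam alpha k.+1 * (2 * fsin phi k.+1)) * (wave j a x * wave k.+1 (- (pi / 2)) x)).
    by apply/funext => x; rewrite /fterm tp_vterm; ring.
  have ok b : ok01 (fun x => wave j a x * wave k.+1 b x).
    by apply: ok01M_cont; [exact: ok01_wave | exact: wave_cont].
  rewrite I01D ?I01Z//; try exact: ok01Z.
  rewrite !I01_wave_mul// eq_sym; case: eqP => [jk|_]; last by rewrite !mulr0 addr0.
  rewrite /c jk.
  have -> : I01 (fun x => wave j a x * phi x) = cos a * fcos phi j - sin a * fsin phi j.
    have -> : (fun x => wave j a x * phi x) =
        (fun x => cos a * (phi x * wave j 0 x) - sin a * (phi x * wave j (- (pi / 2)) x)).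
      by apply/funext => x; rewrite -cos_wave -sin_wave /wave cosD; ring.
    have ok2 b : ok01 (fun x => phi x * wave j b x).
      by apply: ok01M_cont; [exact/ok01_cont/phi_cont | exact: wave_cont].
    by rewrite I01B ?I01Z ?fcosE ?fsinE//; exact: ok01Z.
  rewrite subr0 opprK cosDpihalf; lra.
apply: lim_series_unique; apply: cvg_near_cst.
exists j.+1 => // n /= jn; rewrite /series /=.
under eq_bigr do rewrite E.
case: j @c E jn {h} => [|j] c E jn.
  rewrite big1// /c /lam mulr0 powR0 ?mul0r// mulf_neq0 ?gt_eqF//.
under eq_bigr do rewrite eqSS.
by rewrite -big_mkcond big_nat1_eq /= (leq_trans _ jn).
Qed.

(** Self-adjointness: the recursion has the multiplier on the [U n], the weak form has it on the
    test function. *)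
Lemma fractional_laplacian_sym l :
  I01 (fun x => tp l x * fractional_laplacian alpha phi x) =
  I01 (fun x => tp (map (lterm alpha) l) x * phi x).
Proof.
have ok m g : continuous g -> ok01 (fun x : R => tp m x * g x).
  by move=> cg; apply: ok01M_cont => //; exact/ok01_cont/tp_cont.
have cf := fractional_laplacian_cont; have cp := phi_cont.
elim: l => [|p l IH].
  by congr I01; apply/funext => x; rewrite !tp_nil !mul0r.
have okw g : continuous g -> ok01 (fun x => wave p.2.1 p.2.2 x * g x).
  by move=> cg; apply: ok01M_cont => //; exact: ok01_wave.
have -> : (fun x => tp (p :: l) x * fractional_laplacian alpha phi x) =
    (fun x => p.1 * (wave p.2.1 p.2.2 x * fractional_laplacian alpha phi x) + tp l x * fractional_laplacian alpha phi x).
  by apply/funext => x; rewrite tp_cons; ring.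
have -> : (fun x => tp (map (lterm alpha) (p :: l)) x * phi x) =
    (fun x => (p.1 * lam alpha p.2.1) * (wave p.2.1 p.2.2 x * phi x) + tp (map (lterm alpha) l) x * phi x).
  by apply/funext => x; rewrite tp_cons /= /lam; ring.
rewrite I01D; [|exact/ok01Z/okw|exact: ok]. rewrite I01D; [|exact/ok01Z/okw|exact: ok].
rewrite IH I01Z; last exact: okw. rewrite I01Z; last exact: okw.
by rewrite fractional_laplacian_wave mulrA.
Qed.

End fractional_laplacian_theory.

Section power_series_growth.
Context {R : realType}.
Variable (r : R).
Hypothesis r0 : 0 < r.
Implicit Types (d : R^nat) (m n : nat).

(** Polynomial growth relative to the radius [r]: enough for convergence at [r / 2], and stable
    under formal differentiation, which raises the degree by one. *)
Definition growth m d : Prop :=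
  exists2 D, 0 <= D & forall n, `|d n| * r ^+ n <= D * n.+1%:R ^+ m.

Lemma growth_diffs m d : growth m d -> growth m.+1 (pseries_diffs d).
Proof.
move=> [D D0 hD]; exists (D / r * 2 ^+ m) => [|n]; first by rewrite mulr_ge0 ?exprn_ge0// divr_ge0// ltW.
rewrite /pseries_diffs normrM [`|_%:R|]ger0_norm//.
have h := hD n.+1.
have h2 : n.+2%:R ^+ m <= 2 ^+ m * n.+1%:R ^+ m :> R.
  by rewrite -exprMn lerXn2r ?nnegrE// -natrM ler_nat; lia.
have h3 : `|d n.+1| * r ^+ n <= D / r * (2 ^+ m * n.+1%:R ^+ m).
  rewrite mulrAC ler_pdivlMr// -mulrA -exprSr; apply: (le_trans h).
  exact: ler_wpM2l.
rewrite -[leLHS]mulrA; apply: (le_trans (ler_wpM2l (ler0n R n.+1) h3)).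
by rewrite exprS le_eqVlt; apply/orP; left; apply/eqP; ring.
Qed.

Lemma growth_cvg m d : growth m d -> cvgn (pseries d (r / 2)).
Proof.
move=> [D D0 hD]; apply: (@normal_cvg _ _ (fun n => D * (n.+1%:R ^+ m / 2 ^+ n))).
  move=> n /=; rewrite expr_div_n normrM [`|_ / _|]ger0_norm ?divr_ge0 ?exprn_ge0 ?(ltW r0)//.
  by rewrite !mulrA ler_pM2r ?invr_gt0 ?exprn_gt0.
rewrite /summable_seq -[fun n => _]/(D *: (fun n => n.+1%:R ^+ m / 2 ^+ n)).
by apply: is_cvg_seriesZ; exact: summable_powX_dyadic.
Qed.

End power_series_growth.

Lemma lipschitz_absolutely_continuous (R : realType) (a b L : R) (g : R -> R) :
  0 <= L -> (forall x y, a <= x <= b -> a <= y <= b -> `|g x - g y| <= L * `|x - y|) ->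
  absolutely_continuous a b g.
Proof.
move=> L0 hL e e0; exists (e / (L + 1)); first by rewrite divr_gt0// ltr_wpDl.
move=> n l r hlr _ hs.
apply: (@le_lt_trans _ _ (L * \sum_(i < n) (r i - l i))).
  rewrite mulr_sumr; apply: ler_sum => i _; have [al [lr rb]] := hlr i.
  rewrite -[r i - l i]ger0_norm ?subr_ge0//; apply: hL.
    by rewrite rb (le_trans al lr).
  by rewrite al (le_trans lr rb).
have S0 : 0 <= \sum_(i < n) (r i - l i).
  by apply: sumr_ge0 => i _; rewrite subr_ge0; have [_ []] := hlr i.
move: hs; rewrite ltr_pdivlMr ?ltr_wpDl// => hs; apply: le_lt_trans hs.
by rewrite mulrC ler_wpM2l// lerDl.
Qed.

Section weak_form.
Context {R : realType}.
Variables (alpha A : R).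
Hypothesis halpha : 0 < alpha < 1 / 2.
Local Notation U := (U alpha A).
Local Notation um := (um alpha A).
Local Notation tmax := (tmax A).
Implicit Types (t x : R).

(** The Cauchy product holds at each point by [mertens_square]; the convolved majorants then allow
    integration term by term. *)
Lemma um_sqr_I01 t g : `|t| <= tmax -> continuous g ->
  series (fun n => t ^+ n * I01 (fun x => tp (convT U n) x * g x)) @ \oo -->
    I01 (fun x => um 0 t x ^+ 2 * g x).
Proof.
move=> ht cg.
pose f n x := t ^+ n * tp (convT U n) x.
pose M := conv (maj alpha A 0).
have majE n : maj alpha A 0 n = nrm (U n) * tmax ^+ n by rewrite /maj expr0 mul1r.
have cM : summable_seq M.
  by apply: summable_conv; [exact: maj_ge0 | exact: summable_maj].
have fE n x : f n x = conv (fun k => uterm alpha A 0 t k x) n.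
  rewrite /f tp_convT mulr_sumr; apply: eq_bigr => i _; rewrite /uterm mulrACA -exprD.
  by rewrite subnKC// -ltnS.
have fM n x : `|f n x| <= M n.
  rewrite fE; apply: (le_trans (ler_norm_sum _ _ _)); apply: ler_sum => i _.
  by rewrite normrM ler_pM//; exact: uterm_le.
have cf n : continuous (f n).
  by move=> x; apply: cvgM; [exact: cvg_cst | exact: tp_cont].
have fN : nser f = (fun x => um 0 t x ^+ 2).
  apply/funext => x; apply: lim_series_unique.
  rewrite (_ : (fun k => f k x) = conv (fun k => uterm alpha A 0 t k x)).
    apply: (@mertens_square _ _ (maj alpha A 0)) => [n|]; first exact: uterm_le.
    exact: summable_maj.
  by apply/funext => n.
have := nser_I01 fM cM cf cg; rewrite fN.
rewrite (_ : (fun k => I01 _) = (fun n => t ^+ n * I01 (fun x => tp (convT U n) x * g x)))//.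
apply/funext => n; rewrite -I01Z; first by congr I01; apply/funext => x; rewrite /f mulrA.
by apply: ok01M_cont => //; exact/ok01_cont/tp_cont.
Qed.

Variable phi : R -> R.
Hypothesis sphi : smooth_periodic phi.

Definition wcoef n : R := I01 (fun x => tp (U n) x * phi x).

Lemma phi_bound : exists2 C, 0 <= C & forall x, 0 <= x <= 1 -> `|phi x| <= C.
Proof.
have [C hC] := cont_bounded01 (phi_cont sphi).
exists C => //; have : 0 <= (0 : R) <= 1 by rewrite lexx ler01.
by move=> /hC; apply: le_trans.
Qed.

Lemma ok_tp_phi (l : seq (@term R)) (g : R -> R) : continuous g -> ok01 (fun x => tp l x * g x).
Proof. by move=> cg; apply: ok01M_cont => //; exact/ok01_cont/tp_cont. Qed.

Lemma wcoef_growth : growth (rho A) 0 wcoef.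
Proof.
have [C C0 hC] := phi_bound; have r0 := rho_gt0 A.
have b0 : 0 <= coef_bound A by exact: le_trans (coef_bound_ge1 A).
exists (C * coef_bound A) => [|n]; first exact: mulr_ge0.
rewrite expr0 mulr1.
have h : `|wcoef n| <= C * nrm (U n).
  apply: I01_bound; first exact/ok_tp_phi/phi_cont.
  by move=> x hx; rewrite normrM mulrC ler_pM ?hC ?tp_nrm.
have r1 : 0 <= rho A ^+ n by rewrite exprn_ge0// ltW.
apply: (le_trans (ler_wpM2r r1 h)); rewrite -mulrA; apply: ler_wpM2l => //.
exact: nrm_U_le.
Qed.

Lemma pairing_um t : `|t| <= tmax -> pairing (um 0 t) phi = limn (pseries wcoef t).
Proof.
move=> ht; have h := um_nser_I01 halpha ht (phi_cont sphi).
rewrite pairingE -(lim_series_unique h) /pseries; congr (limn (series _)).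
by apply/funext => n; rewrite mulrC.
Qed.

(** The formal time derivative has coefficients (n + 1) U_(n+1), which the recursion rewrites.
    Integration by parts, source of the minus sign before 1/2, and [fractional_laplacian_sym] move
    the operators onto [phi]. *)
Lemma pairing_um_diffs t : `|t| <= tmax -> limn (pseries (pseries_diffs wcoef) t) =
  - 2^-1 * pairing (fun x => um 0 t x ^+ 2) (phi^`())%classic
  - pairing (um 0 t) (fractional_laplacian alpha phi).
Proof.
move=> ht; have cp := phi_cont sphi.
have cp1 : continuous (phi^`()%classic) by exact: (@smooth_cont _ _ sphi 1%N).
have cl := fractional_laplacian_cont halpha sphi.
have h1 := um_sqr_I01 ht cp1; have h2 := um_nser_I01 halpha ht cl.
apply: lim_series_unique.
rewrite (_ : (fun n => _) = (fun n => - 2^-1 * (t ^+ n * I01 (fun x => tp (convT U n) x * phi^`()%classic x))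
   - t ^+ n * I01 (fun x => tp (U n) x * fractional_laplacian alpha phi x))); last first.
  apply/funext => n; rewrite /pseries_diffs /wcoef -I01Z; last exact: ok_tp_phi.
  have -> : (fun x => n.+1%:R * (tp (U n.+1) x * phi x)) =
      (fun x => 2^-1 * (tp (map dterm (convT U n)) x * phi x) - tp (map (lterm alpha) (U n)) x * phi x).
    by apply/funext => x; rewrite mulrA tp_U_rec mulrBl mulrA.
  rewrite I01B; [|exact/ok01Z/ok_tp_phi|exact: ok_tp_phi].
  rewrite I01Z; last exact: ok_tp_phi.
  rewrite -fractional_laplacian_sym//.
  have -> : I01 (fun x => tp (map dterm (convT U n)) x * phi x) =
      - I01 (fun x => tp (convT U n) x * phi^`()%classic x).
    apply/esym/eqP; rewrite eqr_oppLR; apply/eqP.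
    apply: by_parts => //; [exact: tp_deriv | exact: (smooth_tower sphi 0) | exact: tp_cont | exact: tp_periodic | by have [] := sphi].
  ring.
rewrite (_ : series _ = (fun n =>
  - 2^-1 * series (fun n => t ^+ n * I01 (fun x => tp (convT U n) x * phi^`()%classic x)) n -
  series (fun n => t ^+ n * I01 (fun x => tp (U n) x * fractional_laplacian alpha phi x)) n)); last first.
  by apply/funext => n; rewrite /series /= sumrB mulr_sumr.
by apply: cvgB => //; apply: cvgM => //; exact: cvg_cst.
Qed.

Lemma is_derive_pairing_um t : 0 < t < tmax ->
  is_derive t 1 (fun t => pairing (um 0 t) phi)
    (- 2^-1 * pairing (fun x => um 0 t x ^+ 2) (phi^`())%classic
     - pairing (um 0 t) (fractional_laplacian alpha phi)).
Proof.
move=> /andP[t0 tT]; have ht : `|t| <= tmax by rewrite ger0_norm ltW.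
rewrite -pairing_um_diffs//.
have r0 := rho_gt0 A; have g := wcoef_growth.
have g1 := growth_diffs r0 g; have g2 := growth_diffs r0 g1.
have T0 := tmax_gt0 A.
(* Differentiation inside the disc asks for convergence at [tmax] of the series and of its first two
   formal derivatives. *)
have := @pseries_snd_diffs _ wcoef tmax t (growth_cvg r0 g) (growth_cvg r0 g1) (growth_cvg r0 g2).
rewrite (ger0_norm (ltW t0)) (ger0_norm (ltW T0)) => /(_ tT).
apply: near_eq_is_derive.
near=> z; apply/esym/pairing_um.
have z0 : 0 < z by near: z; exact: lt_nbhsr.
by rewrite ger0_norm ?(ltW z0)// ltW//; near: z; exact: lt_nbhsl.
Unshelve. all: by end_near. Qed.

Lemma pairing_um_lip : exists2 L, 0 <= L & forall t t0 : R, `|t| <= tmax -> `|t0| <= tmax ->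
  `|pairing (um 0 t) phi - pairing (um 0 t0) phi| <= L * `|t - t0|.
Proof.
have [C C0 hC] := phi_bound; exists (um_lip_const alpha A 0 * C) => [|t t0 ht ht0].
  by rewrite mulr_ge0//; exact: um_lip_const_ge0.
have ok s : `|s| <= tmax -> ok01 (fun x => um 0 s x * phi x).
  move=> hs; apply: ok01M_cont; last exact: phi_cont.
  exact/ok01_cont/um_cont.
rewrite !pairingE -I01B; [|exact: ok|exact: ok].
apply: I01_bound; first by apply: ok01B; exact: ok.
move=> x hx; rewrite -mulrBl normrM mulrAC ler_pM ?hC//; exact: um_lip.
Qed.

End weak_form.

Lemma um_weak_solution (R : realType) (alpha A : R) : 0 < alpha < 1 / 2 ->
  weak_solution alpha (tmax A) (tp [:: (A, (1%N, - (pi / 2)))]) (um alpha A 0).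
Proof.
move=> halpha phi sphi; split.
- by rewrite um_init.
- move=> b /andP[b0 bT]; have [L L0 hL] := pairing_um_lip A halpha sphi.
  apply: (@lipschitz_absolutely_continuous _ _ _ L) => // x y.
  by move=> /andP[x0 xb] /andP[y0 yb]; apply: hL; rewrite ger0_norm// (le_trans _ (ltW bT)).
- by apply: aeW => t ht; exact: is_derive_pairing_um.
Qed.

(** By orthogonality the pairing is A / 2 times the first sine coefficient [pco alpha J 1], which is
    at least 1 / (2 pi) >= 1/8. *)
Lemma pairing_sine_phis (R : realType) (alpha A : R) J : 0 <= A -> (0 < J)%N ->
  A / 16 <= pairing (tp [:: (A, (1%N, - (pi / 2)))]) (tp (phis alpha J 0)).
Proof.
move=> A0 J0; rewrite pairingE.
have -> : (fun x => tp [:: (A, (1%N, - (pi / 2)))] x * tp (phis alpha J 0) x) =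
    (fun x => A * (tp (phis alpha J 0) x * wave 1 (- (pi / 2)) x)).
  by apply/funext => x; rewrite tp_cons tp_nil addr0 /=; ring.
rewrite I01Z; last by apply: ok01M_cont; [exact: ok01_tp | exact: wave_cont].
rewrite I01_tp_wave// big_map.
have J1 : (1 <= 1 < 2 ^ J)%N by rewrite leqnn -{1}(expn0 2) ltn_exp2l.
rewrite big_nat1_eq J1 /= mulr0 subr0 subrr cos0.
have h := @pco1 _ alpha _ J0.
have h8 : (8 : R)^-1 <= pco alpha J 1.
  apply: le_trans h; rewrite lef_pV2 ?posrE ?pi2_gt0//.
  by have := @pi_le4 R; lra.
have := ler_wpM2l A0 h8; lra.
Qed.

Theorem theorem6p4 (R : realType) (alpha : R) (halpha : 0 < alpha < 1 / 2) :
  exists u0 : R -> R,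
    [/\ smooth_periodic u0,
        mean_zero u0,
        (exists (T : R) (u : R -> R -> R),
          0 < T /\ smooth_solution alpha T u0 u) &
        forall (T : R) (u : R -> R -> R),
          0 < T -> smooth_solution alpha T u0 u ->
          forall s : R, 3 / 2 - 2 * alpha <= s ->
            blows_up_in_finite_time alpha s T u0 u].
Proof.
(* The factor 16 compensates the one in [pairing_sine_phis]; [ellmin] depends on alpha alone, so one
   datum serves every [s]. *)
pose A := 16 * `|ellmin alpha|.
have A0 : 0 <= A by rewrite mulr_ge0.
exists (tp [:: (A, (1%N, - (pi / 2)))]); split.
- exact: tp_smooth.
- exact: (I01_tp_U A halpha 0).
- exists (tmax A), (um alpha A 0); split; first exact: tmax_gt0.
  have ht t : 0 <= t < tmax A -> `|t| <= tmax A.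
    by move=> /andP[t0 tT]; rewrite ger0_norm// ltW.
  split; first exact: um_weak_solution.
    by move=> t /ht; exact: um_smooth.
  by move=> r r0; exact: um_continuous_in_sobolev.
(* The maximal time is at most 2: a solution in C([0, T'), H^s) with T' > 2 is excluded by
   [blowup_absurd]. *)
- move=> T u _ _ s hs; apply: (@le_lt_trans _ _ 2%:E); last exact: ltry.
  apply: ge_ereal_sup => _ [T' [_ [v [wv cv _]]] <-].
  rewrite lee_fin leNgt; apply/negP => T2.
  apply: (blowup_absurd halpha hs T2 wv cv) => J J0.
  apply: le_trans (pairing_sine_phis alpha A0 J0).
  by rewrite /A mulrC mulKf// ler_norm.
Qed.
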